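(* Let $G$ be a graph polyhedrally embedded in a closed surface. Then for any three distinct vertices $x_1,x_2,x_3$ of $G$ and any other vertex $z\in V(G)\setminus\{x_1,x_2,x_3\}$, $G$ has a cycle that contains $x_1,x_2,x_3$ and avoids $z$.
   Context: Graphs are finite and simple. A closed surface is a compact connected 2-manifold without boundary. An embedding of a graph in a closed surface is polyhedral if every face is an open disk whose boundary is a cycle of the graph, and the boundaries of every two distinct faces meet properly, i.e., their intersection is either empty, or a single vertex, or a single edge (with its two endvertices). *)

(* Defs.v *)
From HB Require Import structures.
From mathcomp Require Import all_boot all_order all_algebra.
From mathcomp Require Import all_classical all_reals all_analysis.

Set Implicit Arguments.
Unset Strict Implicit.
Unset Printing Implicit Defensive.

Import Order.TTheory GRing.Theory Num.Theory.
Import numFieldNormedType.Exports.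

Local Open Scope classical_set_scope.
Local Open Scope ring_scope.

Definition homeomorphism (T U : topologicalType) (A : set T) (B : set U)
    (f : T -> U) : Prop :=
  [/\ set_bij A B f, {within A, continuous f}
    & exists2 g : U -> T, {within B, continuous g} & {in A, cancel f g}].

Definition frontier (T : topologicalType) (A : set T) : set T :=
  closure A `\` interior A.

Section Surface.
Variable R : realType.

Definition closed_disk : set (R * R) := [set p | p.1 ^+ 2 + p.2 ^+ 2 <= 1].
Definition open_disk : set (R * R) := [set p | p.1 ^+ 2 + p.2 ^+ 2 < 1].
Definition unit_circle : set (R * R) := [set p | p.1 ^+ 2 + p.2 ^+ 2 = 1].

Definition manifold2 (S : topologicalType) : Prop :=
  [/\ hausdorff_space S, @second_countable S
    & forall p : S, exists (U : set S) (W : set (R * R)) (f : S -> R * R),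
        [/\ open U, U p, open W & homeomorphism U W f]].

Definition closed_surface (S : topologicalType) : Prop :=
  [/\ manifold2 S, compact [set: S] & connected [set: S]].

Definition is_arc (S : topologicalType) (p q : S) (A : set S) : Prop :=
  exists f : R -> S, [/\ homeomorphism (`[0, 1] : set R) A f, f 0 = p & f 1 = q].

End Surface.

Arguments closed_disk R : clear implicits.
Arguments open_disk R : clear implicits.
Arguments unit_circle R : clear implicits.

Section SimpleGraph.
Variables (V : finType) (e : rel V).

Definition simple_graph : Prop := symmetric e /\ irreflexive e.

(* [ucycle] alone also accepts the sequences [::] and [:: x; y] with e x y. *)
Definition is_cycle (c : seq V) : Prop := ucycle e c /\ (2 < size c)%N.

End SimpleGraph.

Section Embedding.
Variables (R : realType) (V : finType) (e : rel V) (S : topologicalType).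

(* The vertex x is drawn at the point [pt x], and the edge xy is drawn as the
   closed arc [arc x y]; [arc x y] is meaningless when x and y are not
   adjacent. *)
Variables (pt : V -> S) (arc : V -> V -> set S).

Definition embedding : Prop :=
  [/\ injective pt,
      forall x y, e x y -> is_arc R (pt x) (pt y) (arc x y)
                           /\ arc x y = arc y x,
      forall x y v, e x y -> arc x y (pt v) -> v = x \/ v = y
    & forall x y u v, e x y -> e u v -> [set x; y]%SET != [set u; v]%SET ->
        arc x y `&` arc u v `<=` pt @` [set` [set x; y]%SET :&: [set u; v]%SET]].

Definition drawing : set S :=
  range pt `|` [set p | exists x y, e x y /\ arc x y p].

Definition face (F : set S) : Prop :=
  exists2 p, ~ drawing p & F = connected_component (~` drawing) p.

Definition cycle_drawing (c : seq V) : set S :=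
  \bigcup_(x in [set` c]) arc x (next c x).

(* F is an open disk whose boundary is the cycle c of the graph: the boundary
   walk of F traverses c exactly once, i.e. the closure of F is a closed disk
   with boundary circle c. Asking only that F be homeomorphic to an open disk
   and that [frontier F] be the point set of c is too weak: it would accept the
   unique face of a noncontractible cycle drawn in the projective plane, whose
   boundary walk traverses that cycle twice. *)
Definition open_disk_bounded_by (F : set S) (c : seq V) : Prop :=
  frontier F = cycle_drawing c /\
  exists f : R * R -> S,
    [/\ homeomorphism (closed_disk R) (closure F) f,
        f @` open_disk R = F & f @` unit_circle R = frontier F].

Definition meet_properly (A B : set S) : Prop :=
  [\/ A `&` B = set0,
      exists v, A `&` B = [set pt v]
    | exists x y, e x y /\ A `&` B = arc x y].

Definition polyhedral_embedding : Prop :=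
  [/\ embedding,
      forall F, face F -> exists2 c, is_cycle e c & open_disk_bounded_by F c
    & forall F1 F2, face F1 -> face F2 -> F1 <> F2 ->
        meet_properly (frontier F1) (frontier F2)].

End Embedding.

(* Main.v *)
Require Import Defs.
From HB Require Import structures.
From mathcomp Require Import all_boot all_order all_algebra.
From mathcomp Require Import all_classical all_reals all_analysis.
From mathcomp Require Import ring lra.

(** Topology enters only through the following facts: the graph is connected;
    two facial cycles share at most a vertex or an edge; every edge lies on
    exactly two facial cycles; and the faces at a vertex z form one class under
    sharing an edge at z, because small punctured disks around z are connected.
    A single face at an edge is excluded because the generator of H^1 of a
    punctured disk (coefficients Z/2) would be a coboundary on a closed disk minus
    a boundary point; three faces are excluded because they would give two
    independent classes in that group.

    Hence the facial paths C - z around z form a 2-regular connected graph, that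
    is, a cycle W (the rim of z) through all neighbours of z.  Rerouting along rims
    shows that deleting two vertices does not disconnect the graph, so in G - z no
    two vertices separate a vertex x from W.  By Menger's theorem, x then has three
    disjoint paths to W, which give three ways to replace a segment of W by a detour
    through x.  Another vertex y that must stay on W, or stay unseparable from it by
    two vertices, rules out at most one of the three, since the replaced segments
    are disjoint.  So W can absorb x1, x2, x3 one after the other. *)

Set Implicit Arguments.
Unset Strict Implicit.
Unset Printing Implicit Defensive.

Import Order.TTheory GRing.Theory Num.Theory.
Import numFieldNormedType.Exports.

(** * Menger's theorem *)

(** Edges are arbitrary topological arcs. A flat picture with two sides near an interior point of an
    edge would require a Schoenflies theorem. The sides are counted instead by H^1 of a punctured
    neighbourhood, with the arc used only as a closed set with two halves and each face only through
    the parametrization of its closure by the closed disk. Coefficients Z/2 are enough because only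
    the parity of crossings matters, and no orientation of the surface has to be chosen. Exactness
    is always obtained by gluing locally constant corrections along connected intersections.

    The bridge from deleting two vertices of the graph to separations of x from W in G - z is that z
    itself serves as a target: a path from x to z must enter z through one of its neighbours, hence
    through W.

    Three detours are needed because in the last round two vertices already lie on the cycle and
    both have to be kept, each costing at most one detour. *)

Section Walks.
Variable V : finType.
Implicit Types (e : rel V) (A B S T : {set V}) (p : seq V).

Lemma first_hit (a : pred V) u p : has a (u :: p) ->
  exists p1 p2, [/\ p = p1 ++ p2, a (last u p1) & ~~ has a (belast u p1)].
Proof.
elim: p u => [|v p IH] u /=; first by rewrite orbF => au; exists [::], [::].
have [au _|/= nau h] := boolP (a u); first by exists [::], (v :: p).
by have [p1 [p2 [-> al nb]]] := IH v h; exists (v :: p1), p2; rewrite /= negb_or nau.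
Qed.

Lemma last_hit (a : pred V) u p : has a (u :: p) ->
  exists p1 p2, [/\ p = p1 ++ p2, a (last u p1) & ~~ has a p2].
Proof.
elim: p u => [|v p IH] u; first by rewrite /= orbF => au; exists [::], [::].
have [h _|nh] := boolP (has a (v :: p)).
  by have [p1 [p2 [-> al nb]]] := IH v h; exists (v :: p1), p2.
by rewrite -[u :: _]cat1s has_cat (negbTE nh) /= !orbF => au; exists [::], (v :: p).
Qed.

(** Inner vertices may lie in [A] or [B], and a single vertex of [A :&: B] is an admissible walk.
    The relation [e] need not be symmetric, so walks are directed. *)
Definition walkAB e A B (s : seq V) :=
  if s is u :: p then [&& uniq s, u \in A, path e u p & last u p \in B] else false.

Definition separates e A B S := forall s : seq V, walkAB e A B s -> has (mem S) s.

(** The vertices in [T] are mere labels at first, so that [#|T|] counts the disjoint paths.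
    [linkage_last] and [linkage_head] later relabel a tight linkage by its ends or its starts. *)
Definition linkage e A B T (P : V -> seq V) :=
  (forall t, t \in T -> walkAB e A B (P t)) /\
  (forall t t' v, t \in T -> t' \in T -> v \in P t -> v \in P t' -> t = t').

Lemma walkAB_shorten e A B u p : u \in A -> path e u p -> last u p \in B ->
  exists2 s : seq V, walkAB e A B s & {subset s <= u :: p}.
Proof.
move=> uA pp; case/shortenP: pp => p' pp' up' sub lB.
exists (u :: p'); first by apply/and4P; split.
by move=> v; rewrite !inE => /orP[->//|/sub ->]; rewrite orbT.
Qed.

Lemma surj_of_inj T B (f : V -> V) : {in T &, injective f} ->
  (forall t, t \in T -> f t \in B) -> (#|B| <= #|T|)%N ->
  forall b, b \in B -> exists2 t, t \in T & f t = b.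
Proof.
move=> inj fT BT b bB.
have : [set f t | t in T] == B.
  rewrite eqEcard card_in_imset // BT andbT; apply/fintype.subsetP => _ /imsetP[t tT ->]; exact: fT.
by move=> /eqP E; move: bB; rewrite -E => /imsetP[t tT ->]; exists t.
Qed.

(** Disjoint paths have distinct ends, so the end map from [T] to [B] is injective, hence bijective
    by the cardinality bound, and its inverse does the relabelling. *)
Lemma linkage_last e A B T P : linkage e A B T P -> (#|B| <= #|T|)%N ->
  exists Q, linkage e A B B Q /\ forall b, b \in B -> last b (Q b) = b.
Proof.
case=> PAB dis BT.
have lP t u : t \in T -> last u (P t) \in B /\ last u (P t) \in P t.
  by move=> /PAB; case: (P t) => [|v p] //= /and4P[_ _ _ ->]; rewrite mem_last.
have [t0 _|T0] := pickP (mem T); last first.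
  have B0 b : b \in B = false.
    apply/negbTE/negP => bB; have : (0 < #|T|)%N by apply: leq_trans BT; apply/card_gt0P; exists b.
    by move=> /card_gt0P[t]; rewrite [_ \in _]T0.
  by exists P; split => [|b]; [split=> [b|b b' v]|]; rewrite B0.
have inj : {in T &, injective (fun t => last t0 (P t))}.
  move=> t t' tT t'T /= E; apply: (dis t t' (last t0 (P t))) => //.
    by case: (lP t t0 tT).
  by rewrite E; case: (lP t' t0 t'T).
have sur := surj_of_inj inj (fun t tT => (lP t t0 tT).1) BT.
have {sur}/choice[g gT] b : exists t, b \in B -> t \in T /\ last t0 (P t) = b.
  have [bB|_] := boolP (b \in B); last by exists b.
  by have [t tT E] := sur b bB; exists t.
exists (P \o g); split.
  split=> [b /gT[/PAB //]|b b' v /gT[gb E] /gT[gb' E'] vb vb'].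
  by rewrite -E -E' (dis _ _ v gb gb').
move=> b /gT[gb E]; rewrite /= -[RHS]E.
by move: (PAB _ gb); case: (P (g b)).
Qed.

Lemma linkage_head e A B T P : linkage e A B T P -> (#|A| <= #|T|)%N ->
  exists Q, linkage e A B A Q /\ forall a, a \in A -> head a (Q a) = a.
Proof.
case=> PAB dis BT.
have lP t u : t \in T -> head u (P t) \in A /\ head u (P t) \in P t.
  by move=> /PAB; case: (P t) => [|v p] //= /and4P[_ -> _ _]; rewrite inE eqxx.
have [t0 _|T0] := pickP (mem T); last first.
  have B0 b : b \in A = false.
    apply/negbTE/negP => bB; have : (0 < #|T|)%N by apply: leq_trans BT; apply/card_gt0P; exists b.
    by move=> /card_gt0P[t]; rewrite [_ \in _]T0.
  by exists P; split => [|b]; [split=> [b|b b' v]|]; rewrite B0.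
have inj : {in T &, injective (fun t => head t0 (P t))}.
  move=> t t' tT t'T /= E; apply: (dis t t' (head t0 (P t))) => //.
    by case: (lP t t0 tT).
  by rewrite E; case: (lP t' t0 t'T).
have sur := surj_of_inj inj (fun t tT => (lP t t0 tT).1) BT.
have {sur}/choice[g gT] b : exists t, b \in A -> t \in T /\ head t0 (P t) = b.
  have [bB|_] := boolP (b \in A); last by exists b.
  by have [t tT E] := sur b bB; exists t.
exists (P \o g); split.
  split=> [b /gT[/PAB //]|b b' v /gT[gb E] /gT[gb' E'] vb vb'].
  by rewrite -E -E' (dis _ _ v gb gb').
move=> b /gT[gb E]; rewrite /= -[RHS]E.
by move: (PAB _ gb); case: (P (g b)).
Qed.

Definition delete_arc e x y : rel V := [rel u v | e u v && ((u, v) != (x, y))].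

Lemma path_delete_l e x y u p : path e u p -> x \notin belast u p -> path (delete_arc e x y) u p.
Proof.
elim: p u => [|v p IH] u //= /andP[euv pp]; rewrite inE negb_or => /andP[xu xp].
by rewrite IH // andbT /delete_arc /= euv; apply: contra xu => /eqP[-> _].
Qed.

Lemma path_delete_r e x y u p : path e u p -> y \notin p -> path (delete_arc e x y) u p.
Proof.
elim: p u => [|v p IH] u //= /andP[euv pp]; rewrite inE negb_or => /andP[yv yp].
by rewrite IH // andbT /delete_arc /= euv; apply: contra yv => /eqP[_ ->].
Qed.

Lemma sub_path_delete e x y u p : path (delete_arc e x y) u p -> path e u p.
Proof. by apply: sub_path => a b /andP[]. Qed.

(* Göring's proof: delete an arc (x, y); if the separation number drops, a small
   separator S of the rest yields linkages from A to x |: S and from y |: S to B,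
   which meet only in S. *)
Theorem menger e A B n : (forall S, separates e A B S -> (n <= #|S|)%N) ->
  exists T P, (n <= #|T|)%N /\ linkage e A B T P.
Proof.
have [m] := ubnP #|[set a : V * V | e a.1 a.2]|; elim: m => // m IH in e A B n *.
rewrite ltnS => em sepn.
(* Without arcs every walk is a single vertex, so [A :&: B] is both a separator and a linkage. *)
have [[x y] /= exy|ne] := pickP (fun a : V * V => e a.1 a.2); last first.
  exists (A :&: B), (fun t => [:: t]); split; last first.
    split=> [t|t t' v _ _]; first by rewrite inE /= => /andP[-> ->].
    by rewrite !inE => /eqP -> /eqP.
  apply: sepn => -[|u [|v p]] //=; first by rewrite inE orbF => /andP[-> ->].
  by move=> /and4P[_ _ /andP[euv _] _]; move: (ne (u, v)); rewrite /= euv.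
pose e' := delete_arc e x y.
have e'm : (#|[set a : V * V | e' a.1 a.2]| < m)%N.
  apply: leq_trans em; apply: proper_card; apply/properP; split.
    by apply/fintype.subsetP => -[u v]; rewrite !inE => /andP[].
  by exists (x, y); rewrite !inE //= /e' /delete_arc /= eqxx andbF.
have [h|] := pselect (forall S, separates e' A B S -> (n <= #|S|)%N).
  have [T [P [nT [PAB dis]]]] := IH e' A B n e'm h; exists T, P; split => //; split => // t tT.
  by move: (PAB t tT); case: (P t) => [|u p] //= /and4P[-> -> /sub_path_delete -> ->].
move=> /existsNP[S /not_implyP[sS /negP]]; rewrite -ltnNge => Sn.
(* A walk avoiding [x] does not use the deleted arc, so it is a walk of [e'] and meets [S]. The same
   holds for [y]. *)
have sepx : separates e A B (x |: S).
  move=> [|u p] // /and4P[us uA pp lB].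
  have [xp|xp] := boolP (x \in u :: p); first by apply/hasP; exists x; rewrite //= !inE eqxx.
  have : has (mem S) (u :: p).
    apply: sS; rewrite /= -/(uniq (u :: p)) us uA lB andbT /=; apply: path_delete_l pp _.
    by apply: contra xp => /mem_belast.
  by apply: sub_has => v /= vS; rewrite !inE vS orbT.
have sepy : separates e A B (y |: S).
  move=> [|u p] // /and4P[us uA pp lB].
  have [xp|xp] := boolP (y \in u :: p); first by apply/hasP; exists y; rewrite //= !inE eqxx.
  have : has (mem S) (u :: p).
    apply: sS; rewrite /= -/(uniq (u :: p)) us uA lB andbT /=; apply: path_delete_r pp _.
    by apply: contra xp; rewrite inE orbC => ->.
  by apply: sub_has => v /= vS; rewrite !inE vS orbT.
(* Separators in [e] have at least [n] elements while [S] has fewer, so adding one vertex gives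
   exactly [n]. This makes both linkages below tight. *)
have cardS z : separates e A B (z |: S) -> z \notin S /\ #|z |: S| = n.
  move=> /sepn; rewrite cardsU1; case: (z \in S) => /=.
    by rewrite add0n leqNgt Sn.
  by rewrite add1n => h; split => //; apply/eqP; rewrite eqn_leq h Sn.
have [xS cx] := cardS x sepx; have [yS cy] := cardS y sepy.
(* An [A]-[B] walk of [e], cut at its first vertex in [x |: S], cannot leave [x] and so stays in
   [e']. Thus separating [A] from [x |: S] in [e'] already separates [A] from [B] in [e]. The second
   linkage uses the last vertex in [y |: S] in the same way. *)
have [|T1 [P1 [n1 l1]]] := IH e' A (x |: S) n e'm.
  move=> S' sS'; apply: sepn => -[|u p] // uAB; move: (uAB) => /and4P[us uA pp lB].
  have [p1 [p2 [pE lp nb]]] := first_hit (sepx _ uAB); have {}lp : last u p1 \in x |: S := lp.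
  have : has (mem S') (u :: p1).
    apply: sS'; rewrite /=; move: us pp; rewrite pE -cat_cons cat_uniq cat_path.
    move=> /andP[/= -> _] /andP[pp1 _]; rewrite uA lp andbT /=; apply: path_delete_l => //.
    by apply: contra nb => xb; apply/hasP; exists x => //=; rewrite !inE eqxx.
  by rewrite pE -cat_cons has_cat => ->.
have [|T2 [P2 [n2 l2]]] := IH e' (y |: S) B n e'm.
  move=> S' sS'; apply: sepn => -[|u p] // uAB; move: (uAB) => /and4P[us uA pp lB].
  have [p1 [p2 [pE lp nb]]] := last_hit (sepy _ uAB); have {}lp : last u p1 \in y |: S := lp.
  have : has (mem S') (last u p1 :: p2).
    have u2 : uniq (last u p1 :: p2).
      by move: us; rewrite pE -cat_cons lastI cat_rcons cat_uniq => /and3P[].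
    move: pp lB; rewrite pE cat_path last_cat => /andP[_ pp2] lB2.
    apply: sS'; apply/and4P; split => //; apply: path_delete_r => //.
    by apply: contra nb => xb; apply/hasP; exists y => //=; rewrite !inE eqxx.
  rewrite pE -cat_cons has_cat /= => /orP[h|->]; last by rewrite orbT.
  apply/orP; left; suff: has (mem S') (u :: p1) by [].
  by apply/hasP; exists (last u p1) => //; exact: mem_last.
rewrite -cx in n1; rewrite -cy in n2.
have [P [[PAB Pdis] Plast]] := linkage_last l1 n1.
have [Q [[QAB Qdis] Qhead]] := linkage_head l2 n2.
have Plst s : s \in x |: S -> s \in P s.
  move=> sT; move: (PAB s sT) (Plast s sT); case: (P s) => [|u p] //= _ E.
  by rewrite -{1}E mem_last.
have Qhd s : s \in y |: S -> s \in Q s.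
  move=> sT; move: (QAB s sT) (Qhead s sT); case: (Q s) => [|u p] //= _ ->.
  by rewrite inE eqxx.
have subS z w : w \in S -> w \in z |: S by rewrite !inE => ->; rewrite orbT.
(* Splicing the two paths at [v] gives an [A]-[B] walk of [e'], which must hit [S]. By disjointness
   a hit can only be the end [s] of the first path or the start [t] of the second, and either one
   forces [v] into [S]. *)
have meet v s t : s \in x |: S -> t \in y |: S -> v \in P s -> v \in Q t ->
    v \in S /\ v = s /\ v = t.
  move=> sT tT vP vQ.
  suff vS : v \in S.
    by split => //; split; [apply: (Pdis _ _ v (subS x v vS) sT)|apply: (Qdis _ _ v (subS y v vS) tT)];
      rewrite ?Plst ?Qhd ?subS.
  move: (PAB s sT) (Plast s sT) (Pdis s) (QAB t tT) (Qhead t tT) (Qdis t).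
  case PsE : (P s) vP => [|u p] // vP /and4P[uup uA pp lp] lps Pd.
  case QtE : (Q t) vQ => [|u' q] // vQ /and4P[uuq uB pq lq] /= hqt Qd.
  have [p1 [p2 [pE lv _]]] : exists p1 p2, [/\ p = p1 ++ p2, pred1 v (last u p1) & ~~ has (pred1 v) (belast u p1)].
    by apply: first_hit; rewrite has_pred1.
  have [q1 [q2 [qE lv' _]]] : exists q1 q2, [/\ q = q1 ++ q2, pred1 v (last u' q1) & ~~ has (pred1 v) q2].
    by apply: last_hit; rewrite has_pred1.
  move: lv lv' => /= /eqP lv /eqP lv'.
  move: pp pq; rewrite pE qE !cat_path lv lv' => /andP[pp1 _] /andP[_ pq2].
  have [|||s0 ws0 sub0] := @walkAB_shorten e' A B u (p1 ++ q2) => //.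
  - by rewrite cat_path pp1 lv.
  - by rewrite last_cat lv; move: lq; rewrite qE last_cat lv'.
  have /hasP[w /sub0 ws0' /= wS] := sS _ ws0.
  move: ws0'; rewrite -cat_cons mem_cat => /orP[wp|wq].
    have ws : w = s.
      apply: (Pdis _ _ w (subS x w wS) sT); first exact/Plst/subS.
      by rewrite PsE pE -cat_cons mem_cat wp.
    suff -> : v = s by rewrite -ws.
    move: lps; rewrite /= pE last_cat lv => lps.
    case: p2 pE lps => [|a p2] pE lps; first by rewrite /= in lps.
    move: uup; rewrite pE -cat_cons cat_uniq => /and3P[_ /hasPn hn _].
    have := hn s; rewrite -{1}lps /= mem_last => /(_ isT) /=.
    by rewrite -ws wp.
  have wt : w = t.
    apply: (Qdis _ _ w (subS y w wS) tT); first exact/Qhd/subS.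
    by rewrite QtE qE inE mem_cat wq !orbT.
  by move: uuq; rewrite qE /= mem_cat hqt -wt wq orbT.
(* The restored arc from [x] to [y] joins one pair of paths; the other pairs share their vertex [s],
   which [behead] keeps from occurring twice. *)
pose R s := if s == x then P x ++ Q y else P s ++ behead (Q s).
have xT : x \in x |: S by rewrite !inE eqxx.
have yT : y \in y |: S by rewrite !inE eqxx.
have inS s : s \in x |: S -> s != x -> s \in S by rewrite !inE => /orP[->|].
have eP u p : path e' u p -> path e u p by exact: sub_path_delete.
exists (x |: S), R; split; first by rewrite cx.
split.
  move=> s sT; rewrite /R; have [sx|sx] := eqVneq s x.
    move: (PAB x xT) (Plast x xT) (QAB y yT) (Qhead y yT).
    have := fun v => meet v x y xT yT.
    case: (P x) => [|u p] //; case: (Q y) => [|u' q] // mt.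
    move=> /and4P[uup uA pp lp] /= lpx /and4P[uuq uB pq lq] hq; rewrite hq in mt uuq pq lq *.
    suff: [&& uniq ((u :: p) ++ y :: q), u \in A, path e u (p ++ y :: q) & last u (p ++ y :: q) \in B] by [].
    apply/and4P; split => //.
    - rewrite cat_uniq; apply/and3P; split => //.
      by apply/hasPn => v vq; apply/negP => vp; have [vS [vx _]] := mt v vp vq; move: xS; rewrite -vx vS.
    - by rewrite cat_path eP //= lpx exy eP.
    - by rewrite last_cat.
  have sS' := inS s sT sx; have sTy := subS y s sS'.
  move: (PAB s sT) (Plast s sT) (QAB s sTy) (Qhead s sTy).
  have := fun v => meet v s s sT sTy.
  case: (P s) => [|u p] //; case: (Q s) => [|u' q] // mt.
  move=> /and4P[uup uA pp lp] /= lpx /and4P[uuq uB pq lq] hq; rewrite hq in mt uuq pq lq *.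
  suff: [&& uniq ((u :: p) ++ q), u \in A, path e u (p ++ q) & last u (p ++ q) \in B] by [].
  apply/and4P; split => //.
  - case/andP: uuq => sq uq; rewrite cat_uniq; apply/and3P; split => //.
    apply/hasPn => v vq; apply/negP => vp; have [|_ [vx _]] := mt v vp; first by rewrite inE vq orbT.
    by move: sq; rewrite -vx vq.
  - by rewrite cat_path eP //= lpx eP.
  - by rewrite last_cat lpx.
have Rsub s v : s \in x |: S -> v \in R s -> v \in P s \/ exists t, [/\ t \in y |: S, v \in Q t &
    (s = x /\ t = y) \/ (s = t /\ s \in S)].
  move=> sT; rewrite /R; have [->|sx] := eqVneq s x.
    by rewrite mem_cat => /orP[|vq]; [left|right; exists y; split => //; left].
  rewrite mem_cat => /orP[|/mem_behead vq]; [by left|right; exists s].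
  by have := inS s sT sx => sS'; split => //; [exact: subS|right].
move=> s s' v sT s'T /(Rsub s v sT) hs /(Rsub s' v s'T) hs'.
case: hs => [vs|[t [tT vt ht]]]; case: hs' => [vs'|[t' [t'T vt' ht']]].
- exact: Pdis vs vs'.
- have [vS [vs1 vt1]] := meet v s t' sT t'T vs vt'.
  by case: ht' => [[_ ty]|[-> _]]; [move: yS; rewrite -ty -vt1 vS|rewrite -vs1].
- have [vS [vs1 vt1]] := meet v s' t s'T tT vs' vt.
  by case: ht => [[_ ty]|[-> _]]; [move: yS; rewrite -ty -vt1 vS|rewrite -vs1].
- have tt := Qdis _ _ v tT t'T vt vt'.
  case: ht => [[sx ty]|[st sS1]]; case: ht' => [[sx' ty']|[st' sS1']].
  + by rewrite sx sx'.
  + by move: yS; rewrite -ty tt -st' sS1'.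
  + by move: yS; rewrite -ty' -tt -st sS1.
  + by rewrite st st'.
Qed.
End Walks.

(** * Absorbing three vertices into a cycle *)

Section ThreeVertices.
Variables (V : finType) (e : rel V).
Hypothesis e_sym : symmetric e.
Implicit Types (W c p a b s : seq V).

(** The case [u = v] is allowed, so this excludes separators of one or two vertices other than [x].
    Vertices of [W] may serve as separators too. *)
Definition linked3 W x := forall u v, x <> u -> x <> v ->
  exists p, [/\ path e x p, last x p \in W, u \notin x :: p & v \notin x :: p].

Lemma linked3_mem W x : x \in W -> linked3 W x.
Proof. by move=> xW u v xu xv; exists [::]; rewrite !inE; split => //; apply/eqP => /esym. Qed.

Lemma linked3_eq W W' x : W =i W' -> linked3 W x -> linked3 W' x.
Proof. by move=> E h u v xu xv; have [p [? ? ? ?]] := h u v xu xv; exists p; rewrite -E. Qed.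

(** The list [p] omits the start [x], so legs from the same vertex can be disjoint as lists. *)
Definition leg W x w p := [/\ path e x p, uniq (x :: p), last x p = w, w \in W &
  forall v, v \in p -> v \in W -> v = w].

Definition disj (s s' : seq V) := forall v : V, v \in s -> v \in s' -> False.

(** Menger's theorem with three paths is applied in the graph without [x], from the neighbours of
    [x] to [W]; each path is then cut at its first vertex on [W]. *)
Lemma fan W x w0 : w0 \in W -> x \notin W -> linked3 W x -> exists w1 w2 w3 p1 p2 p3,
  [/\ leg W x w1 p1, leg W x w2 p2, leg W x w3 p3 & [/\ disj p1 p2, disj p2 p3 & disj p1 p3]].
Proof.
move=> w0W xW lx.
pose ex := [rel u v | [&& e u v, u != x & v != x]].
pose A := [set u | e x u & u != x]; pose B := [set w in W].
have pathx u p : path e u p -> x \notin u :: p -> path ex u p.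
  elim: p u => [|v p IH] u //= /andP[euv pp]; rewrite !inE !negb_or => /and3P[xu xv xp].
  by rewrite euv eq_sym xu eq_sym xv IH // inE negb_or xv.
have pathe u p : path ex u p -> path e u p by apply: sub_path => ? ? /and3P[].
have notx u p : path ex u p -> u != x -> x \notin u :: p.
  elim: p u => [|v p IH] u /=; first by rewrite inE eq_sym.
  by move=> /andP[/and3P[_ ux vx] pp] _; rewrite inE negb_or eq_sym ux IH.
have [|T [P [nT [PAB dis]]]] := @menger V ex A B 3.
  move=> S sS; rewrite leqNgt; apply/negP => S2.
  (* A separator with fewer than two vertices is padded by the default [w0], which is admissible
     because it differs from [x]. *)
  pose en := enum (S :\ x); pose u := nth w0 en 0; pose v := nth w0 en 1.
  have en2 : size en <= 2.
    by rewrite /en -cardE -ltnS; apply: leq_ltn_trans S2; apply: subset_leq_card; exact: finset.subD1set.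
  have w0x : x <> w0 by move=> E; move: xW; rewrite E w0W.
  have nx i : x <> nth w0 en i.
    have [h|h] := ltnP i (size en); last by rewrite nth_default.
    by have := mem_nth w0 h; rewrite mem_enum !inE => /andP[/eqP ? _] /esym.
  have [p [pp lp up vp]] := lx u v (nx 0) (nx 1).
  have uv r : r \in S -> r != x -> r = u \/ r = v.
    move=> rS rx; have rin : r \in en by rewrite mem_enum !inE rx.
    have := nth_index w0 rin; have : index r en < 2 by apply: leq_trans en2; rewrite index_mem.
    by case: (index r en) => [|[|]] // _ <-; [left|right].
  move: lp up vp; case/shortenP: pp => p' pp' up' sub lp up vp.
  case: p' pp' up' sub lp => [|r p'] /=; first by move=> _ _ _ xW'; rewrite xW' in xW.
  move=> /andP[exr pr] /andP[xp' ur] sub lp.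
  have rx : r != x by move: xp'; rewrite inE negb_or eq_sym => /andP[].
  have /sS/hasP[t tp /= tS] : walkAB ex A B (r :: p').
    by apply/and4P; split => //; [rewrite inE exr|exact: pathx|rewrite inE].
  have tx : t != x by apply: contra xp' => /eqP <-.
  have := sub t tp => tp'.
  by case: (uv t tS tx) => E; [move: up|move: vp]; rewrite -E inE tp' orbT.
have getleg t : t \in T -> exists w p, leg W x w p /\ {subset p <= P t}.
  move=> tT; move: (PAB t tT); case: (P t) => [|u p] // /and4P[uup uA pp lB].
  have hW : has (mem W) (u :: p) by apply/hasP; exists (last u p); [exact: mem_last|move: lB; rewrite inE].
  have [p1 [p2 [pE l1 nb]]] := first_hit hW.
  have ux : u != x by move: uA; rewrite inE => /andP[].
  have xn := notx u p pp ux.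
  exists (last u p1), (u :: p1); split; last first.
    by move=> v; rewrite pE -cat_cons mem_cat => ->.
  move: pp; rewrite pE cat_path => /andP[/pathe pp1 _]; split => //.
  - by rewrite /= pp1 andbT; move: uA; rewrite inE => /andP[].
  - move: uup xn; rewrite pE -cat_cons cat_uniq mem_cat negb_or => /andP[up1 _] /andP[xp1 _].
    by rewrite cons_uniq xp1.
  - move=> v; rewrite lastI mem_rcons inE => /orP[/eqP //|vb] vW.
    by case/hasP: nb; exists v.
have [t1 [t2 [t3 [t1T t2T t3T n12 [n23 n13]]]]] : exists t1 t2 t3,
    [/\ t1 \in T, t2 \in T, t3 \in T, t1 <> t2 & t2 <> t3 /\ t1 <> t3].
  move: nT; rewrite cardE; have := enum_uniq (mem T); have := mem_enum (mem T).
  case: (enum T) => [|t1 [|t2 [|t3 l]]] // mT.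
  rewrite /= !inE !negb_or => /and4P[/and3P[/eqP ? /eqP ? _] /andP[/eqP ? _] _ _] _.
  by exists t1, t2, t3; split => //; rewrite -[_ \in T]mT !inE eqxx ?orbT.
have [w1 [p1 [l1 s1]]] := getleg t1 t1T.
have [w2 [p2 [l2 s2]]] := getleg t2 t2T.
have [w3 [p3 [l3 s3]]] := getleg t3 t3T.
exists w1, w2, w3, p1, p2, p3; split => //; split.
- by move=> v /s1 v1 /s2 v2; apply: n12; exact: dis v1 v2.
- by move=> v /s2 v1 /s3 v2; apply: n23; exact: dis v1 v2.
- by move=> v /s1 v1 /s3 v2; apply: n13; exact: dis v1 v2.
Qed.

Lemma leg_eq W W' x w p : W =i W' -> leg W x w p -> leg W' x w p.
Proof. by move=> E [? ? ? ? h]; split; rewrite -?E // => v; rewrite -E; exact: h. Qed.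

Lemma leg_rcons W x w p : x \notin W -> leg W x w p -> exists q, p = rcons q w.
Proof.
case: (lastP p) => [|q v]; first by move=> xW [_ _ /= <- wW _]; rewrite wW in xW.
by move=> _ [_ _ + _ _]; rewrite last_rcons => ->; exists q.
Qed.

Lemma path_rev u p : path e u p -> path e (last u p) (rev (belast u p)).
Proof. by rewrite rev_path => h; rewrite (eq_path (e' := e)) // => v w /=; rewrite e_sym. Qed.

(* Replace the open segment a of W by a detour through x. *)
Lemma reroute W x w w' a b p p' : W = w :: a ++ w' :: b -> is_cycle e W ->
  x \notin W -> leg W x w p -> leg W x w' p' -> disj p p' ->
  let c := x :: p' ++ b ++ rev p in
  [/\ is_cycle e c, x \in c & forall v, v \in W -> v \notin a -> v \in c].
Proof.
move=> WE [/andP[cW uW] _] xW lp lp' dis c.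
have [q pE] := leg_rcons xW lp; have [q' pE'] := leg_rcons xW lp'.
case: lp => pp up _ wW hp; case: lp' => pp' up' lp' wW' hp'.
have bW v : v \in b -> v \in W by rewrite WE inE mem_cat inE => ->; rewrite !orbT.
have [nwb nwb'] : w \notin b /\ w' \notin b.
  move: uW; rewrite WE /= mem_cat inE !negb_or cat_uniq /=.
  by case/andP => /and3P[_ _ ->] /and4P[_ _ -> _].
split; last 2 first.
- by rewrite inE eqxx.
- move=> v; rewrite WE /c !inE !mem_cat mem_rev inE pE pE' !mem_rcons !inE.
  move=> /or4P[->|->//|->|->]; rewrite ?orbT //.
split; last by rewrite /c /= !size_cat size_rev pE pE' !size_rcons addSn !addnS.
apply/andP; split.
  rewrite /c /= -cats1 -!catA cat_path pp' lp' /=.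
  have : path e w' (rcons b w).
    move: cW; rewrite WE /= rcons_cat cat_path /= => /andP[_ /andP[_]]; done.
  rewrite pE rev_rcons -cats1 !cat_path /= andbT => /andP[-> ->] /=.
  have := path_rev pp; rewrite pE last_rcons belast_rcons rev_cons -cats1 cat_path /=.
  by rewrite ?andbT.
rewrite /c cons_uniq !mem_cat mem_rev !cat_uniq rev_uniq has_cat.
move: up up'; rewrite !cons_uniq => /andP[xp up] /andP[xp' up'].
rewrite up up' (negbTE xp) (negbTE xp') !andbT /= orbF.
have ub : uniq b by move: uW; rewrite WE /= cat_uniq /= => /and5P[_ _ _ _ ->].
rewrite ub /=; apply/and3P; split.
- by apply: contra xW => /bW.
- rewrite negb_or; apply/andP; split; apply/hasPn => v.
    by move=> vb; apply/negP => /= vp; have E := hp' v vp (bW v vb); move: nwb'; rewrite -E vb.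
  by rewrite mem_rev => vp; apply/negP => /= vp'; exact: dis vp vp'.
- by apply/hasPn => v; rewrite mem_rev => vp; apply/negP => /= vb; have E := hp v vp (bW v vb); move: nwb; rewrite -E vb.
Qed.

(** This is what a rerouting must preserve: absorbed vertices stay on the cycle, and the others can
    still be absorbed later. *)
Definition good W c y := linked3 c y /\ (y \in W -> y \in c).

(** Some pair [u], [v] separates [y] from [c] but not from [W], so a path from [y] avoiding the pair
    first meets [W] inside [a]. From there both directions along the segment lead to [c], through
    [w] and through [w'], and each of them must be blocked by one of [u], [v]. *)
Lemma bad_segment W c w w' a b y : W = w :: a ++ w' :: b -> is_cycle e W ->
  (forall v, v \in W -> v \notin a -> v \in c) -> linked3 W y -> ~ good W c y -> y \notin W ->
  (exists v p, [/\ v \in a, path e y p, last y p = v & forall u, u \in y :: p -> u \in W -> u = v]) /\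
  (exists u v, [/\ y <> u, y <> v, u \in w :: rcons a w', v \in w :: rcons a w' &
     forall p, path e y p -> last y p \in c -> u \in y :: p \/ v \in y :: p]).
Proof.
move=> WE [/andP[cW uW] _] hc ly nG yW.
have [u [v [yu yv huv]]] : exists u v, [/\ y <> u, y <> v &
    forall p, path e y p -> last y p \in c -> u \in y :: p \/ v \in y :: p].
  apply: contrapT => none; apply: nG; split; last by move=> yW'; rewrite yW' in yW.
  move=> u v yu yv; apply: contrapT => np; apply: none; exists u, v; split => // p pp lp.
  have [up|up] := boolP (u \in y :: p); first by left.
  have [vp|vp] := boolP (v \in y :: p); first by right.
  by case: np; exists p.
have [p0 [pp0 lp0 up0 vp0]] := ly u v yu yv.
have hW : has (mem W) (y :: p0) by apply/hasP; exists (last y p0); [exact: mem_last|].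
have [p [p2 [pE l1 nb]]] := first_hit hW; have {}l1 : last y p \in W := l1.
have pp : path e y p by move: pp0; rewrite pE cat_path => /andP[].
have [up vp] : u \notin y :: p /\ v \notin y :: p.
  by move: up0 vp0; rewrite pE -cat_cons !mem_cat !negb_or => /andP[-> _] /andP[-> _].
have onlyW t : t \in y :: p -> t \in W -> t = last y p.
  rewrite lastI mem_rcons inE => /orP[/eqP //|tb] tW.
  by case/hasP: nb; exists t.
have la : last y p \in a.
  apply/negP => /negP na; have := hc _ l1 na => /(huv p pp).
  by case=> h; [move: up|move: vp]; rewrite h.
split; first by exists (last y p), p.
have [a1 [a2 aE]] : exists a1 a2, a = a1 ++ last y p :: a2 by case/splitPr: la => a1 a2; exists a1, a2.
set z := last y p in la aE.
have [wa w'a] : w \notin a /\ w' \notin a.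
  move: uW; rewrite WE /= mem_cat inE negb_or cat_uniq /= => /andP[/andP[-> _]].
  by rewrite negb_or => /and3P[_ /andP[-> _] _].
have [wc w'c] : w \in c /\ w' \in c.
  by split; apply: hc => //; rewrite WE !inE ?mem_cat ?inE ?eqxx ?orbT.
have [pL pR] : path e z (rev (w :: a1)) /\ path e z (rcons a2 w').
  move: cW; rewrite WE aE /= rcons_cat cat_path last_cat rcons_cons /=.
  rewrite cat_path /= => /andP[/and3P[h1 h2 h3] /andP[h4 _]].
  split; last by rewrite -cats1 cat_path h3 /= h4.
  have : path e w (rcons a1 z) by rewrite -cats1 cat_path h1 /= h2.
  by move=> /path_rev; rewrite last_rcons belast_rcons.
(* The two ways out of the segment are disjoint, so one vertex cannot block both and the pair splits
   between them. *)
have dLR t : t \in w :: a1 -> t \in rcons a2 w' -> False.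
  have E : W = (w :: a1) ++ (z :: a2) ++ w' :: b by rewrite WE aE /= -catA.
  move: uW; rewrite E cat_uniq => /and3P[_ /hasPn h _] tL tR.
  have /h /negP : t \in (z :: a2) ++ w' :: b; last by apply.
  by move: tR; rewrite mem_rcons !(inE, mem_cat) => /orP[->|->]; rewrite ?orbT.
have hR := huv (p ++ rcons a2 w'); have hL := huv (p ++ rev (w :: a1)).
have {}hR : u \in rcons a2 w' \/ v \in rcons a2 w'.
  have [||h|h] := hR; rewrite ?cat_path ?pp //; first by rewrite last_cat last_rcons.
    by left; move: h; rewrite -cat_cons mem_cat (negbTE up).
  by right; move: h; rewrite -cat_cons mem_cat (negbTE vp).
have {}hL : u \in w :: a1 \/ v \in w :: a1.
  have [||h|h] := hL; rewrite ?cat_path ?pp //; first by rewrite last_cat rev_cons last_rcons.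
    by left; move: h; rewrite -cat_cons mem_cat (negbTE up) mem_rev.
  by right; move: h; rewrite -cat_cons mem_cat (negbTE vp) mem_rev.
have inL t : t \in w :: a1 -> t \in w :: rcons a w'.
  by rewrite aE rcons_cat !inE mem_cat => /orP[->|->]; rewrite ?orbT.
have inR t : t \in rcons a2 w' -> t \in w :: rcons a w'.
  by move=> tR; rewrite aE rcons_cat !inE mem_cat rcons_cons !inE tR !orbT.
exists u, v; case: hL => hL; case: hR => hR; try by case: (dLR _ hL hR).
  by split => //; [exact: inL|exact: inR].
by split => //; [exact: inR|exact: inL].
Qed.

(* A path from y reaching a before the rest of W avoids the two vertices that
   separate y from cb, since these lie on the closed segment b. *)
Lemma bad_two ca cb w w' w'' a b c y : let W := w :: a ++ w' :: b ++ w'' :: c in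
  is_cycle e W -> (forall v, v \in W -> v \notin a -> v \in ca) ->
  (forall v, v \in W -> v \notin b -> v \in cb) -> linked3 W y ->
  ~ good W ca y -> ~ good W cb y -> False.
Proof.
move=> W cW ha hb ly na nb; have [_ uW] := andP cW.1.
have dis v : v \in a -> v \in w' :: rcons b w'' -> False.
  move: uW; rewrite /W /= cat_uniq => /and4P[_ _ /hasPn h _] va vb.
  have /h /negP : v \in w' :: b ++ w'' :: c; last by apply.
  by move: vb; rewrite !inE mem_rcons !inE mem_cat !inE => /or3P[] ->; rewrite ?orbT.
have [yW|yW] := boolP (y \in W).
  have ya : y \in a.
    apply: contrapT => /negP nya; apply: na; have yc := ha y yW nya; split => //.
    exact: linked3_mem.
  have yb : y \in b.
    apply: contrapT => /negP nyb; apply: nb; have yc := hb y yW nyb; split => //.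
    exact: linked3_mem.
  by apply: (dis y) => //; rewrite inE mem_rcons inE yb !orbT.
have [[v [p [va pp lp hp]]] _] := bad_segment erefl cW ha ly na yW.
(* [bad_segment] speaks of the segment right after the head, so the cycle is rotated to bring [b]
   there. *)
pose W2 := w' :: b ++ w'' :: c ++ w :: a.
have W2E : W2 = rot (size (w :: a)) W by rewrite (_ : W = (w :: a) ++ w' :: b ++ w'' :: c) // rot_size_cat /= -catA.
have mW2 : W =i W2 by move=> u; rewrite W2E mem_rot.
have cW2 : is_cycle e W2.
  by case: cW => /andP[h1 h2] h3; rewrite W2E; split; rewrite ?size_rot // /ucycle rot_cycle rot_uniq h1.
have [|||_ [r [s [yr ys rb sb hrs]]]] := bad_segment erefl cW2 _ (linked3_eq mW2 ly) (c := cb) (y := y).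
- by move=> u; rewrite -mW2; exact: hb.
- by move=> [g1 g2]; apply: nb; split => //; rewrite mW2.
- by rewrite -mW2.
have vcb : last y p \in cb.
  rewrite lp; apply: hb; first by rewrite inE mem_cat va orbT.
  by apply/negP => vb; apply: (dis v) => //; rewrite inE mem_rcons inE vb !orbT.
have inW2 t : t \in w' :: rcons b w'' -> t \in W.
  by rewrite mW2 !inE mem_rcons !inE mem_cat !inE => /or3P[] ->; rewrite ?orbT.
case: (hrs p pp vcb) => h.
  by have E := hp r h (inW2 r rb); apply: (dis v) => //; rewrite -E.
by have E := hp s h (inW2 s sb); apply: (dis v) => //; rewrite -E.
Qed.

Lemma good_eq W W' c y : W =i W' -> good W c y -> good W' c y.
Proof. by move=> E [g1 g2]; split => //; rewrite -E. Qed.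

(* Each of y, z obstructs at most one of the three reroutings through x. *)
Lemma absorb_ordered w w' w'' a b c x y z p p' p'' : let W := w :: a ++ w' :: b ++ w'' :: c in
  is_cycle e W -> x \notin W -> linked3 W y -> linked3 W z ->
  leg W x w p -> leg W x w' p' -> leg W x w'' p'' ->
  disj p p' -> disj p' p'' -> disj p p'' ->
  exists W', [/\ is_cycle e W', x \in W', good W W' y & good W W' z].
Proof.
move=> W cW xW ly lz l l' l'' d1 d2 d3.
have rotc i : is_cycle e (rot i W).
  by case: cW => /andP[h1 h2] h3; split; rewrite ?size_rot // /ucycle rot_cycle rot_uniq h1.
pose W2 := w' :: b ++ w'' :: c ++ w :: a.
pose W3 := w'' :: c ++ w :: a ++ w' :: b.
have W2E : W2 = rot (size (w :: a)) W by rewrite (_ : W = (w :: a) ++ w' :: b ++ w'' :: c) // rot_size_cat /= -catA.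
have W3E : W3 = rot (size (w :: a ++ w' :: b)) W.
  by rewrite (_ : W = (w :: a ++ w' :: b) ++ w'' :: c) ?rot_size_cat // /W /= -catA.
have m2 : W =i W2 by move=> u; rewrite W2E mem_rot.
have m3 : W =i W3 by move=> u; rewrite W3E mem_rot.
have c2 : is_cycle e W2 by rewrite W2E.
have c3 : is_cycle e W3 by rewrite W3E.
have [q1 q2] : x \notin W2 /\ x \notin W3 by rewrite -m2 -m3.
have d3' : disj p'' p by move=> v v1 v2; exact: d3 v2 v1.
have [k1 x1 h1] := reroute (erefl : W = w :: a ++ w' :: (b ++ w'' :: c)) cW xW l l' d1.
have [k2 x2 h2] := reroute (erefl : W2 = w' :: b ++ w'' :: (c ++ w :: a)) c2 q1
  (leg_eq m2 l') (leg_eq m2 l'') d2.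
have [k3 x3 h3] := reroute (erefl : W3 = w'' :: c ++ w :: (a ++ w' :: b)) c3 q2
  (leg_eq m3 l'') (leg_eq m3 l) d3'.
move: k1 x1 h1 k2 x2 h2 k3 x3 h3.
set C1 := x :: _; set C2 := x :: _; set C3 := x :: _ => k1 x1 h1 k2 x2 h2 k3 x3 h3.
have h2' v : v \in W -> v \notin b -> v \in C2 by rewrite m2; exact: h2.
have h3' v : v \in W -> v \notin c -> v \in C3 by rewrite m3; exact: h3.
have bad12 t : linked3 W t -> ~ good W C1 t -> ~ good W C2 t -> False.
  by move=> lt; exact: bad_two cW h1 h2' lt.
have bad23 t : linked3 W t -> ~ good W C2 t -> ~ good W C3 t -> False.
  move=> lt g2 g3; apply: (bad_two c2 h2 _ (linked3_eq m2 lt) _ _ (cb := C3)).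
  - by move=> v; rewrite -m2; exact: h3'.
  - by move=> g; apply: g2; apply: good_eq g => u; rewrite m2.
  - by move=> g; apply: g3; apply: good_eq g => u; rewrite m2.
have bad31 t : linked3 W t -> ~ good W C3 t -> ~ good W C1 t -> False.
  move=> lt g3 g1; apply: (bad_two c3 h3 _ (linked3_eq m3 lt) _ _ (cb := C1)).
  - by move=> v; rewrite -m3; exact: h1.
  - by move=> g; apply: g3; apply: good_eq g => u; rewrite m3.
  - by move=> g; apply: g1; apply: good_eq g => u; rewrite m3.
have [y1|y1] := pselect (good W C1 y); last first.
  have y2 : good W C2 y by apply: contrapT => n; exact: bad12 ly y1 n.
  have y3 : good W C3 y by apply: contrapT => n; exact: bad31 ly n y1.
  have [z2|z2] := pselect (good W C2 z); first by exists C2.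
  by exists C3; split => //; apply: contrapT => n; exact: bad23 lz z2 n.
have [z1|z1] := pselect (good W C1 z); first by exists C1.
have z2 : good W C2 z by apply: contrapT => n; exact: bad12 lz z1 n.
have z3 : good W C3 z by apply: contrapT => n; exact: bad31 lz n z1.
have [y2|y2] := pselect (good W C2 y); first by exists C2.
by exists C3; split => //; apply: contrapT => n; exact: bad23 ly y2 n.
Qed.

Lemma absorb W x y z : is_cycle e W -> linked3 W x -> linked3 W y -> linked3 W z ->
  exists W', [/\ is_cycle e W', x \in W', good W W' y & good W W' z].
Proof.
move=> cW lx ly lz; have [xW|xW] := boolP (x \in W).
  by exists W.
have [w0 w0W] : exists w0, w0 \in W.
  by case: W cW {lx ly lz xW} => [[]//|w0 W] _; exists w0; rewrite inE eqxx.
have [w1 [w2 [w3 [p1 [p2 [p3 [l1 l2 l3 [d12 d23 d13]]]]]]]] := fan w0W xW lx.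
have neq w w' p p' : leg W x w p -> leg W x w' p' -> disj p p' -> w != w'.
  move=> lp lp' d; apply/eqP => E; have [q pE] := leg_rcons xW lp; have [q' pE'] := leg_rcons xW lp'.
  by apply: (d w); rewrite ?pE ?pE' -?E mem_rcons inE eqxx.
have [n12 [n23 n13]] : w1 != w2 /\ w2 != w3 /\ w1 != w3.
  by split; [exact: neq d12|split; [exact: neq d23|exact: neq d13]].
have [w1W w2W w3W] : [/\ w1 \in W, w2 \in W & w3 \in W] by case: l1 l2 l3 => ? ? ? ? _ [? ? ? ? _] [].
have [i r rE] := rot_to w1W.
have mr : W =i w1 :: r by move=> u; rewrite -rE mem_rot.
have cr : is_cycle e (w1 :: r).
  by case: cW => /andP[h1 h2] h3; rewrite -rE; split; rewrite ?size_rot // /ucycle rot_cycle rot_uniq h1.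
(* The cycle is read from [w1] on; the other two feet may come in either order, and both cases
   reduce to this claim. *)
have main w w' p p' a b c : r = a ++ w :: b ++ w' :: c -> leg W x w p -> leg W x w' p' ->
    disj p1 p -> disj p p' -> disj p1 p' ->
    exists W', [/\ is_cycle e W', x \in W', good W W' y & good W W' z].
  move=> rE' lp lp' e1 e2 e3; have mr' := mr; move: cr; rewrite rE' in mr' *.
  move=> cr'; have [||||||W' [h1 h2 h3 h4]] := absorb_ordered cr' _ _ _ _ _ _ e1 e2 e3 (x := x) (y := y) (z := z).
  - by rewrite -mr'.
  - exact: linked3_eq mr' ly.
  - exact: linked3_eq mr' lz.
  - exact: leg_eq mr' l1.
  - exact: leg_eq mr' lp.
  - exact: leg_eq mr' lp'.
  by exists W'; split => //; [apply: good_eq h3|apply: good_eq h4] => u; rewrite mr'.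
have w2r : w2 \in r by move: w2W; rewrite mr inE eq_sym (negbTE n12).
have w3r : w3 \in r by move: w3W; rewrite mr inE eq_sym (negbTE n13).
case/splitPr rE2: r / w2r => [a b].
move: w3r; rewrite rE2 mem_cat inE eq_sym (negbTE n23) /= => /orP[h|h].
  case/splitPr aE: a / h => [a1 a2]; apply: (main w3 w2 p3 p2 a1 a2 b) => //.
  - by rewrite rE2 aE -catA.
  - by move=> v v1 v2; exact: d23 v2 v1.
by case/splitPr bE: b / h => [b1 b2]; apply: (main w2 w3 p2 p3 a b1 b2) => //; rewrite rE2 bE.
Qed.

(** In each round the two vertices to be protected are passed as [y] and [z]: those already
    absorbed, which count as [linked3] by membership, and those still to come. *)
Theorem cycle_through_three W x1 x2 x3 : is_cycle e W ->
  linked3 W x1 -> linked3 W x2 -> linked3 W x3 ->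
  exists c, is_cycle e c /\ {subset [:: x1; x2; x3] <= c}.
Proof.
move=> cW l1 l2 l3.
have [W1 [c1 x1W1 [l2' _] [l3' _]]] := absorb cW l1 l2 l3.
have [W2 [c2 x2W2 [_ /(_ x1W1) x1W2] [l3'' _]]] := absorb c1 l2' (linked3_mem x1W1) l3'.
have [W3 [c3 x3W3 [_ /(_ x1W2) x1W3] [_ /(_ x2W2) x2W3]]] :=
  absorb c2 l3'' (linked3_mem x1W2) (linked3_mem x2W2).
by exists W3; split => // v; rewrite !inE => /or3P[] /eqP ->.
Qed.
End ThreeVertices.

(** * Rims of vertices *)

Section CycleNeighbours.
Variables (V : finType) (e : rel V).
Implicit Types c : seq V.

Lemma next_neq_prev c u : uniq c -> 2 < size c -> u \in c -> next c u != prev c u.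
Proof.
move=> uc c2 uin; apply/eqP => E; have := next_prev uc u; rewrite -E.
have [i s rE] := rot_to uin; have nr : next (rot i c) =1 next c := next_rot i uc.
rewrite -nr -nr; have := uc; have := c2; rewrite -(size_rot i) -(rot_uniq i) rE.
case: s {rE} => [|v [|w s]] //= _ /and3P[]; rewrite !inE !negb_or eqxx.
move=> /and3P[uv uw _] _ _; rewrite eq_sym (negbTE uv) eqxx => wu.
by rewrite wu eqxx in uw.
Qed.

Definition consecutive c x y := [&& x \in c, y \in c & (next c x == y) || (next c y == x)].

Lemma consecutiveC c x y : consecutive c x y = consecutive c y x.
Proof. by rewrite /consecutive andbCA orbC. Qed.

Lemma consecutiveP c x y : uniq c -> x \in c ->
  reflect (y = next c x \/ y = prev c x) (consecutive c x y).
Proof.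
move=> uc xc; rewrite /consecutive xc /=; apply: (iffP andP) => [[yc /orP[]/eqP <-]|].
- by left.
- by right; rewrite prev_next.
by case=> ->; rewrite ?mem_next ?mem_prev xc ?next_prev // eqxx ?orbT.
Qed.

Lemma consecutive_other c x y : is_cycle e c -> consecutive c x y ->
  exists a, [/\ a <> y, consecutive c x a & forall v, consecutive c x v -> v = y \/ v = a].
Proof.
move=> [/andP[_ uc] c2] cxy; have xc : x \in c by case/and3P: cxy.
have /eqP np := next_neq_prev uc c2 xc.
have /(consecutiveP _ uc xc)[->|->] := cxy.
  exists (prev c x); split; first by move=> /esym.
    by apply/consecutiveP => //; right.
  by move=> v /(consecutiveP _ uc xc).
exists (next c x); split => //.
  by apply/consecutiveP => //; left.
by move=> v /(consecutiveP _ uc xc)[]; auto.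
Qed.

Lemma path_const (f : V -> V) (X : V -> Prop) x s : path (frel f) x s ->
  (forall u, u \in x :: s -> f u \in s -> (X u <-> X (f u))) ->
  forall v, v \in x :: s -> (X x <-> X v).
Proof.
elim: s x => [|y s IH] x /=; first by move=> _ _ v; rewrite inE => /eqP ->.
move=> /andP[/eqP fx ps] hX v; rewrite inE => /orP[/eqP -> //|vs].
have xy : X x <-> X y by rewrite -fx; apply: hX; rewrite ?fx !inE eqxx.
rewrite xy; apply: IH ps _ v vs => u us fus.
by apply: hX; rewrite inE ?us ?fus orbT.
Qed.

(** Rotated to start at [z], the rest of the cycle is a path, along which [X] spreads in both
    directions. *)
Lemma cycle_minus_connected c z (X : V -> Prop) u v : is_cycle e c -> z \in c ->
  (forall s t, consecutive c s t -> s <> z -> t <> z -> X s -> X t) ->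
  u \in c -> v \in c -> u <> z -> v <> z -> X u -> X v.
Proof.
move=> [/andP[_ uc] _] zc hX uin vin uz vz.
have [i s rE] := rot_to zc.
have ms t : t \in c -> t <> z -> t \in s.
  by rewrite -(mem_rot i) rE inE => /orP[/eqP|].
have sc t : t \in s -> t \in c /\ t <> z.
  move=> ts; rewrite -(mem_rot i) rE inE ts orbT; split => // E.
  by have := uc; rewrite -(rot_uniq i) rE /= -E ts.
have fc : fcycle (next c) (rot i c) by rewrite rot_cycle; exact: cycle_next.
have [us vs] := (ms u uin uz, ms v vin vz).
case: s us vs {ms} rE sc => // x s us vs rE sc; move: fc.
rewrite rE /= rcons_path => /and3P[_ ps _].
have hf t : t \in x :: s -> next c t \in s -> (X t <-> X (next c t)).
  move=> ts nts; have [tc tz] := sc t ts.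
  have [nc nz] : next c t \in c /\ next c t <> z by apply: sc; rewrite inE nts orbT.
  have ct : consecutive c t (next c t) by apply/consecutiveP => //; left.
  by split; apply: hX => //; rewrite consecutiveC.
have xu := path_const ps hf us; have xv := path_const ps hf vs.
by rewrite -xu xv.
Qed.
Lemma cycle_connected c (X : V -> Prop) u v : is_cycle e c ->
  (forall s t, consecutive c s t -> X s -> X t) -> u \in c -> v \in c -> X u -> X v.
Proof.
move=> cc hX uc vc Xu; case: (cc) => /andP[_ uq] _.
have [<-//|/eqP uv] := eqVneq u v.
have [i s rE] := rot_to uc.
have fcy : fcycle (next c) (rot i c) by rewrite rot_cycle; exact: cycle_next.
move: vc; rewrite -(mem_rot i) rE => vs.
move: fcy; rewrite rE /= rcons_path => /andP[ps _].
rewrite -(path_const ps _ vs) // => t ts nts.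
have tc : t \in c by rewrite -(mem_rot i) rE.
have ct : consecutive c t (next c t) by apply/consecutiveP => //; left.
by split; apply: hX => //; rewrite consecutiveC.
Qed.
End CycleNeighbours.

(** * Connected 2-regular relations are cycles *)

Section TwoRegular.
Variables (V : finType) (r : rel V) (D : V -> Prop).
Hypothesis rsym : symmetric r.
Hypothesis rirr : irreflexive r.
Hypothesis rD : forall u v, r u v -> D u.
Hypothesis r2 : forall u, D u -> exists a b, [/\ a <> b, r u a, r u b &
  forall v, r u v -> v = a \/ v = b].
Hypothesis rconn : forall X : V -> Prop, (forall u v, r u v -> X u -> X v) ->
  forall u v, D u -> D v -> X u -> X v.

Lemma r2_pigeon u a b c : r u a -> r u b -> r u c -> a <> b -> b <> c -> a <> c -> False.
Proof.
move=> ra rb rc ab bc ac; have [x [y [_ _ _ h]]] := r2 (rD ra).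
by case: (h a ra) => ?; case: (h b rb) => ?; case: (h c rc) => ?; subst; auto.
Qed.

(* In a longest path, both neighbours of the last vertex lie on the path, and
   2-regularity forces the second one to be the first vertex of the path. *)
Lemma two_regular_cycle u0 : D u0 -> exists c, is_cycle r c /\ forall v, v \in c <-> D v.
Proof.
move=> Du0.
(* Lengths of paths inside [D]; they are bounded by the number of vertices, so a longest path
   exists. *)
pose good n := `[< exists x p, [/\ path r x p, uniq (x :: p), size p = n & D x] >].
have ex : exists n, good n by exists 0; apply/asboolP; exists u0, [::].
have bound n : good n -> n <= #|V|.
  move=> /asboolP[x [p [_ up <- _]]]; rewrite -(card_uniqP (proj2 (andP up))); exact: max_card.
case: (ex_maxnP ex bound) => n /asboolP[x [p [pp up pn Dx]]] maxn.
have ext y : r (last x p) y -> y \in x :: p.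
  move=> rly; apply: contrapT => /negP ny.
  suff /maxn : good n.+1 by rewrite ltnn.
  apply/asboolP; exists x, (rcons p y); split => //; last by rewrite size_rcons pn.
    by rewrite rcons_path pp.
  by rewrite -rcons_cons rcons_uniq ny.
have [a0 [_ [_ rxa _ _]]] := r2 Dx.
case/lastP: p pp up pn ext => [|q l] pp up pn ext.
  by have := ext a0 rxa; rewrite inE => /eqP E; rewrite E rirr in rxa.
rewrite last_rcons in ext.
move: pp; rewrite rcons_path => /andP[pq rkl].
set k := last x q in rkl.
have rlk : r l k by rewrite rsym.
have [a [b [ab ra rb hab]]] := r2 (rD rlk).
have [j [rlj jk]] : exists j, r l j /\ j <> k.
  by case: (hab k rlk) => ->; [exists b|exists a]; split => // /esym.
have jl : j <> l by move=> E; rewrite E rirr in rlj.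
(* An inner vertex [j] of the path would have three neighbours: its two path neighbours and [l]. *)
have jx : j = x.
  apply: contrapT => jx.
  have jq : j \in q.
    by have := ext j rlj; rewrite inE mem_rcons inE => /or3P[/eqP|/eqP|].
  case/splitPr qE: q / jq => [q1 q2].
  case: q2 qE => [|s q3] qE; first by apply: jk; rewrite /k qE cats1 last_rcons.
  have E : x :: rcons q l = (x :: q1) ++ j :: s :: rcons q3 l by rewrite qE rcons_cat.
  move: pq; rewrite qE cat_path /= => /and4P[_ r1 r2' _].
  move: up; rewrite E cat_uniq => /and3P[_ /hasPn nh].
  rewrite !cons_uniq => /and3P[_ sl _].
  have {}sl : s <> l by move=> E'; rewrite E' mem_rcons inE eqxx in sl.
  have sn : last x q1 <> s.
    move=> E'; have /nh/negP : s \in j :: s :: rcons q3 l by rewrite !inE eqxx orbT.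
    by apply; rewrite /= -E' mem_last.
  have ln : last x q1 <> l.
    move=> E'; have /nh/negP : l \in j :: s :: rcons q3 l by rewrite !inE mem_rcons inE eqxx !orbT.
    by apply; rewrite /= -E' mem_last.
  by apply: (@r2_pigeon j (last x q1) s l) => //; rewrite rsym.
exists (x :: rcons q l).
have cyc : is_cycle r (x :: rcons q l).
  split; last first.
    rewrite /= size_rcons !ltnS; case: (posnP (size q)) => // /size0nil q0.
    by case: jk; rewrite jx /k q0.
  by rewrite /ucycle up andbT /= !rcons_path pq rkl last_rcons -jx rlj.
split => // v; split=> [vc|Dv].
  case: cyc => /andP[cc _] _; exact: (rD (next_cycle cc vc)).
have xc : x \in x :: rcons q l by rewrite inE eqxx.
(* The cycle is closed under [r], since its two neighbours along the cycle exhaust the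
   [r]-neighbours of each vertex; by connectedness it fills [D]. *)
apply: (@rconn (fun v => v \in x :: rcons q l) _ x v Dx Dv xc) => s t rst sc.
case: cyc => /andP[cc uc] c2.
have np := next_neq_prev uc c2 sc.
have rn := next_cycle cc sc; have rp : r s (prev (x :: rcons q l) s) by rewrite rsym; exact: prev_cycle.
have [->|tn] := eqVneq t (next (x :: rcons q l) s); first by rewrite mem_next.
have [->|tp] := eqVneq t (prev (x :: rcons q l) s); first by rewrite mem_prev.
by exfalso; apply: (r2_pigeon rn rp rst); apply/eqP => //; rewrite eq_sym.
Qed.
End TwoRegular.

(** * Rims and 3-connectedness from abstract facial cycles *)

Section Rim.
Variables (V : finType) (e : rel V) (I : Type) (fc : I -> Prop) (cyc : I -> seq V).
Hypothesis he : simple_graph e.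
Hypothesis hc : forall F, fc F -> is_cycle e (cyc F).
Hypothesis share : forall F G u v, fc F -> fc G -> F <> G -> u <> v ->
  u \in cyc F -> u \in cyc G -> v \in cyc F -> v \in cyc G ->
  [/\ consecutive (cyc F) u v, consecutive (cyc G) u v &
    forall w, w \in cyc F -> w \in cyc G -> w = u \/ w = v].
Hypothesis two : forall x y, e x y -> exists F G, [/\ fc F, fc G, F <> G,
  consecutive (cyc F) x y /\ consecutive (cyc G) x y &
  forall H, fc H -> consecutive (cyc H) x y -> H = F \/ H = G].
(** Connectedness of the faces around [z], phrased by cuts: any [Q] that splits these faces is
    crossed at an edge [zw]. *)
Hypothesis link : forall z (Q : I -> Prop) F G, fc F -> fc G -> z \in cyc F -> z \in cyc G ->
  Q F -> ~ Q G -> exists F' G' w, [/\ fc F', fc G', Q F', ~ Q G' &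
    consecutive (cyc F') z w /\ consecutive (cyc G') z w].
Hypothesis conn : forall (X : V -> Prop) x y, (forall u v, e u v -> X u -> X v) -> X x -> X y.
Hypothesis vface : forall v, exists2 F, fc F & v \in cyc F.

Lemma facial_edge F x y : fc F -> consecutive (cyc F) x y -> e x y.
Proof.
move=> /hc[/andP[cc _] _] /and3P[xc yc /orP[/eqP <-|/eqP <-]]; first exact: next_cycle.
by case: he => -> _; exact: next_cycle.
Qed.

Lemma edge_neq x y : e x y -> x <> y.
Proof. by move=> exy xy; case: he => _ /(_ x); rewrite {2}xy exy. Qed.

Definition rim_edge z u v := `[< exists F, [/\ fc F, z \in cyc F, consecutive (cyc F) u v & u <> z /\ v <> z] >].
Definition rim_vertex z u := exists F, [/\ fc F, z \in cyc F, u \in cyc F & u <> z].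

Lemma rim_edgeW z u v : rim_edge z u v -> [/\ e u v, u <> z & v <> z].
Proof. by move=> /asboolP[F [fF zF c [uz vz]]]; split => //; exact: facial_edge c. Qed.

(** If [u] is not adjacent to [z], only one face contains both, for two faces sharing [u] and [z]
    would share the edge; its cycle gives the two neighbours. If [zu] is an edge, each of its two
    faces contributes the neighbour of [u] other than [z], and these differ because the two faces
    share only [z] and [u]. *)
Lemma rim_two_regular z u : rim_vertex z u -> exists a b, [/\ a <> b, rim_edge z u a, rim_edge z u b &
  forall v, rim_edge z u v -> v = a \/ v = b].
Proof.
move=> [F [fF zF uF uz]]; have cF := hc fF; have [/andP[_ uc] c2] := cF.
have [ezu|nezu] := boolP (e z u); last first.
  have np := next_neq_prev uc c2 uF.
  have cn : consecutive (cyc F) u (next (cyc F) u) by apply/consecutiveP => //; left.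
  have cp : consecutive (cyc F) u (prev (cyc F) u) by apply/consecutiveP => //; right.
  have nz t : consecutive (cyc F) u t -> t <> z.
    move=> ct tz; move/negP: nezu; apply; apply: (facial_edge fF).
    by rewrite consecutiveC -tz.
  exists (next (cyc F) u), (prev (cyc F) u); split; first exact/eqP.
  - by apply/asboolP; exists F; split => //; split => //; exact: nz.
  - by apply/asboolP; exists F; split => //; split => //; exact: nz.
  move=> v /asboolP[G [fG zG cG [_ vz]]].
  have uG : u \in cyc G by case/and3P: cG.
  suff E : G = F by rewrite E in cG; exact/consecutiveP.
  apply: contrapT => nGF; move/negP: nezu; apply.
  have zu : z <> u by move=> /esym.
  by have [/(facial_edge fG)] := share fG fF nGF zu zG zF uG uF.
have [G [H [fG fH nGH [cG cH] hGH]]] := two ezu.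
rewrite consecutiveC in cG; rewrite consecutiveC in cH.
have [a [az ca ha]] := consecutive_other (hc fG) cG.
have [b [bz cb hb]] := consecutive_other (hc fH) cH.
have [uG zG] : u \in cyc G /\ z \in cyc G by case/and3P: cG.
have [uH zH] : u \in cyc H /\ z \in cyc H by case/and3P: cH.
exists a, b; split.
- move=> E; have aG : a \in cyc G by case/and3P: ca.
  have aH : a \in cyc H by rewrite E; case/and3P: cb.
  have [_ _ /(_ a aG aH)[au|//]] := share fG fH nGH uz uG uH zG zH.
  by apply: (edge_neq (facial_edge fG ca)).
- by apply/asboolP; exists G.
- by apply/asboolP; exists H.
move=> v /asboolP[K [fK zK cK [_ vz]]].
have uK : u \in cyc K by case/and3P: cK.
have : K = G \/ K = H.
  have [->|nKG] := pselect (K = G); first by left.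
  apply: hGH => //; rewrite consecutiveC.
  by have [] := share fK fG nKG uz uK uG zK zG.
by case=> E; subst K; [case: (ha v cK)|case: (hb v cK)]; auto.
Qed.

(** Within one face at [z], [X] spreads over the whole path left after deleting [z]. Two faces
    sharing an edge [zw] pass it on through [w]. *)
Lemma rim_connected z (X : V -> Prop) : (forall u v, rim_edge z u v -> X u -> X v) ->
  forall u v, rim_vertex z u -> rim_vertex z v -> X u -> X v.
Proof.
move=> hX u v [F [fF zF uF uz]] [G [fG zG vG vz]] Xu.
pose Q H := exists t, [/\ t \in cyc H, t <> z & X t].
have full H t : fc H -> z \in cyc H -> Q H -> t \in cyc H -> t <> z -> X t.
  move=> fH zH [s [sH sz Xs]] tH tz.
  apply: (cycle_minus_connected (hc fH) zH _ sH tH sz tz Xs) => a b cab az bz.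
  by apply: hX; apply/asboolP; exists H.
suff QG : Q G by exact: full vG vz.
apply: contrapT => nQG.
have QF : Q F by exists u.
have [F' [G' [w [fF' fG' QF' nQG' [cF' cG']]]]] := link fF fG zF zG QF nQG.
have [/and3P[zF' wF' _] /and3P[zG' wG' _]] := (cF', cG').
have wz : w <> z by move=> /esym; apply: edge_neq; exact: facial_edge cF'.
by apply: nQG'; exists w; split => //; exact: full wF' wz.
Qed.

Lemma edge_face x y : e x y -> exists2 F, fc F & consecutive (cyc F) x y.
Proof. by move=> /two[F [_ [fF _ _ [cF _] _]]]; exists F. Qed.

Lemma rim_exists z : exists W, [/\ is_cycle e W, z \notin W & forall u, e z u -> u \in W].
Proof.
have [F fF zF] := vface z; have [/andP[cF _] _] := hc fF.
have ezn := next_cycle cF zF.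
have nb u : e z u -> rim_vertex z u.
  move=> ezu; have [G fG /and3P[zG uG _]] := edge_face ezu.
  by exists G; split => //; move=> /esym; exact: edge_neq.
have [|||W [cW WD]] := @two_regular_cycle V (rim_edge z) (rim_vertex z) _ _ _
  (@rim_two_regular z) (@rim_connected z) _ (nb _ ezn).
- by move=> u v; apply/asboolP/asboolP => -[G [? ? c [? ?]]]; exists G; rewrite consecutiveC.
- by move=> u; apply/negP => /rim_edgeW[/edge_neq].
- by move=> u v /asboolP[G [fG zG /and3P[uG _ _] [uz _]]]; exists G.
exists W; split.
- case: cW => /andP[cc uc] c2; split => //; rewrite /ucycle uc andbT.
  by apply: sub_cycle cc => u v /rim_edgeW[].
- by apply/negP => /WD[G [_ _ _]].
- by move=> u /nb/WD.
Qed.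

(** Connectedness of the graph without [B], stated as propagation of properties so that no explicit
    paths have to be rerouted. *)
Definition connected_off (B : V -> Prop) := forall X : V -> Prop,
  (forall u v, ~ B u -> ~ B v -> e u v -> X u -> X v) -> forall x y, ~ B x -> ~ B y -> X x -> X y.

(* Paths through a are rerouted along the rim of a. *)
Lemma connected_off_add B a : connected_off B ->
  (forall X : V -> Prop, (forall u v, ~ B u -> ~ B v -> u <> a -> v <> a -> e u v -> X u -> X v) ->
    forall u v, ~ B u -> ~ B v -> e a u -> e a v -> X u -> X v) ->
  connected_off (fun t => B t \/ t = a).
Proof.
move=> cB hN X hX x y /not_orP[Bx xa] /not_orP[By ya] Xx.
have hX' u v : ~ B u -> ~ B v -> u <> a -> v <> a -> e u v -> X u -> X v.
  by move=> *; apply: (hX u v) => //; case.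
(* The property is extended to [a]: [a] counts as reached when all its neighbours off [B] are. By
   [hN], one reached neighbour is enough. *)
pose X' v := (v <> a /\ X v) \/ (v = a /\ forall w, ~ B w -> e a w -> X w).
suff [[_ //]|[ya' _]] : X' y by case: ya.
apply: (cB X') Bx By _; last by left.
move=> u v Bu Bv euv [[ua Xu]|[ua hu]].
  have [va|va] := pselect (v = a); last by left; split => //; exact: hX' euv Xu.
  right; split => // w Bw eaw; apply: (hN X hX' u w) => //.
  by case: he => -> _; rewrite -va.
left; split; last by apply: hu => //; rewrite -ua.
by move=> va; apply: (edge_neq euv); rewrite ua va.
Qed.

Lemma connected_off0 : connected_off (fun=> False).
Proof. by move=> X hX x y _ _; apply: conn => u v; exact: hX. Qed.

Lemma connected_off1 a : connected_off (fun t => t = a).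
Proof.
have -> : (fun t => t = a) = (fun t => False \/ t = a).
  by apply/funext => t; apply/propext; split => [|[]//]; right.
apply: connected_off_add connected_off0 _ => X hX u v _ _ eau eav.
have [W [cW aW NW]] := rim_exists a.
have na t : t \in W -> t <> a by move=> tW ta; move/negP: aW; rewrite -ta.
apply: (cycle_connected cW) (NW u eau) (NW v eav) => s t cst.
have [sW tW] : s \in W /\ t \in W by case/and3P: cst.
have [/andP[cc _] _] := cW.
apply: hX => //; try exact: na.
case/and3P: cst => _ _ /orP[]/eqP <-; first exact: next_cycle.
by case: he => -> _; exact: next_cycle.
Qed.

(** The rim of [a] is a cycle, so it remains connected after losing [b] and still joins the
    neighbours of [a]. *)
Lemma connected_off2 a b : connected_off (fun t => t = b \/ t = a).
Proof.
apply: (@connected_off_add (fun t => t = b) a (@connected_off1 b)) => X hX u v ub vb eau eav.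
have [W [cW aW NW]] := rim_exists a.
have na t : t \in W -> t <> a by move=> tW ta; move/negP: aW; rewrite -ta.
have [/andP[cc _] _] := cW.
have eW s t : consecutive W s t -> e s t.
  case/and3P=> sW tW /orP[]/eqP <-; first exact: next_cycle.
  by case: he => -> _; exact: next_cycle.
have mW s t : consecutive W s t -> s <> a /\ t <> a.
  by case/and3P=> /na ? /na.
have [bW|bW] := boolP (b \in W).
  apply: (cycle_minus_connected cW bW) (NW u eau) (NW v eav) ub vb => s t cst sb tb.
  by have [? ?] := mW s t cst; apply: hX => //; exact: eW.
apply: (cycle_connected cW) (NW u eau) (NW v eav) => s t cst.
have [? ?] := mW s t cst; have [sW tW] : s \in W /\ t \in W by case/and3P: cst.
by apply: hX => //; try exact: eW; move=> E; move/negP: bW; rewrite -E.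
Qed.

Definition delete_vertex z : rel V := [rel u v | [&& e u v, u != z & v != z]].

(** If [u], [v] cut [x] off from [W] without [z], they would cut [x] off from [z] in the whole
    graph, because every neighbour of [z] lies on [W]. *)
Lemma linked3_rim z W x : (forall u, e z u -> u \in W) -> x <> z -> linked3 (delete_vertex z) W x.
Proof.
move=> NW xz u v xu xv; apply: contrapT => none.
(* The set [B] consists of [u] and [v] except that [z], the target of the walk, is never deleted;
   hence the four cases. *)
have [B [cB Bx Bz hB]] : exists B, [/\ connected_off B, ~ B x, ~ B z &
    forall t, t <> z -> t = u \/ t = v -> B t].
  have [uz|uz] := pselect (u = z); have [vz|vz] := pselect (v = z).
  - exists (fun=> False); split => //; first exact: connected_off0.
    by move=> t tz [|] E; apply: tz; rewrite E.
  - exists (fun t => t = v); split => //; first exact: connected_off1.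
      by move=> /esym.
    by move=> t tz [E|//]; case: tz; rewrite E.
  - exists (fun t => t = u); split => //; first exact: connected_off1.
      by move=> /esym.
    by move=> t tz [//|E]; case: tz; rewrite E.
  - exists (fun t => t = u \/ t = v); split => //; first exact: connected_off2.
      by case.
    by case=> /esym.
pose X t := t <> z /\ exists p, [/\ path (delete_vertex z) x p, last x p = t, u \notin x :: p & v \notin x :: p].
suff [zz _] : X z by [].
apply: (cB X) Bx Bz _ => [s t Bs Bt est [sz [p [pp lp up vp]]]|]; last first.
  by split => //; exists [::]; rewrite !inE; split => //; apply/eqP => /esym.
have [tz|tz] := pselect (t = z).
  case: none; exists p; split => //; rewrite lp; apply: NW.
  by case: he => -> _; rewrite -tz.
split => //; exists (rcons p t); split; rewrite ?last_rcons //.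
- rewrite rcons_path pp lp /delete_vertex /= est; apply/and3P; split => //; exact/eqP.
- by rewrite -rcons_cons mem_rcons inE negb_or up andbT; apply/eqP => E; apply: Bt; apply: hB; auto.
- by rewrite -rcons_cons mem_rcons inE negb_or vp andbT; apply/eqP => E; apply: Bt; apply: hB; auto.
Qed.

Theorem cycle_avoiding x1 x2 x3 z : z \notin [:: x1; x2; x3] ->
  exists c, is_cycle e c /\ {subset [:: x1; x2; x3] <= c} /\ z \notin c.
Proof.
rewrite !inE !negb_or => /and3P[/eqP z1 /eqP z2 /eqP z3].
have [W [cW zW NW]] := rim_exists z.
have dsym : symmetric (delete_vertex z).
  by move=> u v; rewrite /delete_vertex /=; case: he => -> _; rewrite [(u != z) && _]andbC.
have cW' : is_cycle (delete_vertex z) W.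
  case: cW => /andP[cc uc] c2; split => //; rewrite /ucycle uc andbT.
  apply: cycle_from_next => // u uW; rewrite /delete_vertex /= next_cycle //=.
  by apply/andP; split; apply: contra zW => /eqP <-; rewrite ?mem_next.
have L x : z <> x -> linked3 (delete_vertex z) W x by move=> zx; apply: linked3_rim => // /esym.
have [c [[/andP[cc uc] c2] sub]] := cycle_through_three dsym cW' (L _ z1) (L _ z2) (L _ z3).
exists c; split; last split => //.
  by split => //; rewrite /ucycle uc andbT; apply: sub_cycle cc => u v /and3P[].
by apply/negP => zc; have := next_cycle cc zc; rewrite /delete_vertex /= eqxx andbF.
Qed.
End Rim.

Local Open Scope classical_set_scope.
Local Open Scope ring_scope.

(** * Cohomology of plane sets with coefficients in Z/2 *)

Section Cocycles.
Variable X : topologicalType.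
Implicit Types (K A B : set X) (w : X -> X -> bool) (f : X -> bool).

(* Alexander-Spanier 1-cochains: only the values w x y for x close to y matter. *)
Definition cocycle K w := forall p, K p -> exists2 U, nbhs p U &
  forall x y t, U x -> K x -> U y -> K y -> U t -> K t ->
    w x y (+) w y t = w x t.

(** The cochain [w] is the coboundary of [f] near the diagonal of [K]. No continuity is asked of
    [f]. *)
Definition primitive K w f := forall p, K p -> exists2 U, nbhs p U &
  forall x y, U x -> K x -> U y -> K y -> w x y = f x (+) f y.

Definition addc w1 w2 := fun x y : X => w1 x y (+) w2 x y.
Definition zeroc := fun _ _ : X => false.

Lemma cocycle_sub K K' w : K' `<=` K -> cocycle K w -> cocycle K' w.
Proof.
move=> sub cw p /sub /cw [U pU h]; exists U => // x y t Ux /sub Kx Uy /sub Ky Ut /sub Kt.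
exact: h.
Qed.

Lemma primitive_sub K K' w f : K' `<=` K -> primitive K w f -> primitive K' w f.
Proof.
move=> sub cw p /sub /cw [U pU h]; exists U => // x y Ux /sub Kx Uy /sub Ky.
exact: h.
Qed.

Lemma primitive_add K w1 w2 f1 f2 : primitive K w1 f1 -> primitive K w2 f2 ->
  primitive K (addc w1 w2) (fun x => f1 x (+) f2 x).
Proof.
move=> h1 h2 p Kp; have [U pU hU] := h1 p Kp; have [V pV hV] := h2 p Kp.
exists (U `&` V); first exact: filterI.
move=> x y [Ux Vx] Kx [Uy Vy] Ky; rewrite /addc hU // hV //.
by case: (f1 x); case: (f2 x); case: (f1 y); case: (f2 y).
Qed.

Lemma cocycle_add K w1 w2 : cocycle K w1 -> cocycle K w2 -> cocycle K (addc w1 w2).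
Proof.
move=> h1 h2 p Kp; have [U pU hU] := h1 p Kp; have [V pV hV] := h2 p Kp.
exists (U `&` V); first exact: filterI.
move=> x y t [Ux Vx] Kx [Uy Vy] Ky [Ut Vt] Kt.
rewrite /addc -(hU x y t) // -(hV x y t) //.
by case: (w1 x y); case: (w2 x y); case: (w1 y t); case: (w2 y t).
Qed.

Lemma primitive_negb K w f b : primitive K w f -> primitive K w (fun x => f x (+) b).
Proof.
move=> h p /h [U pU hU]; exists U => // x y *; rewrite hU //.
by case: (f x); case: (f y); case: b.
Qed.

(** A primitive of zero is locally constant. The connectedness arguments about faces also pass
    through this lemma, with an indicator function as [f]. *)
Lemma connected_constant K f : connected K -> primitive K zeroc f ->
  forall x y, K x -> K y -> f x = f y.
Proof.
move=> cK hf x y Kx Ky.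
have opn b : open (interior [set t | K t -> f t = b]) /\
    forall t, K t -> f t = b -> interior [set t | K t -> f t = b] t.
  split; first exact: open_interior.
  move=> t Kt ft; have [U tU hU] := hf _ Kt; apply: (filterS _ tU) => s Us Ks.
  by have := hU s t Us Ks (nbhs_singleton tU) Kt; rewrite ft /zeroc; case: (f s); case: b {ft}.
suff : K `&` [set t | f t = f x] = K by move=> /seteqP[_ /(_ y Ky)] [_ /=].
apply: cK; first by exists x.
- exists (interior [set t | K t -> f t = f x]); first by case: (opn (f x)).
  apply/seteqP; split=> t [Kt]; last by move=> /interior_subset /(_ Kt).
  by move=> /= ft; split=> //; case: (opn (f x)) => _; exact.
- exists (~` interior [set t | K t -> f t = ~~ f x]).
    by apply: open_closedC; case: (opn (~~ f x)).
  apply/seteqP; split=> t [Kt] /= ft; split=> //.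
    by move=> /interior_subset /(_ Kt); rewrite /= ft; case: (f x).
  apply: contrapT => nft; apply: ft; case: (opn (~~ f x)) => _; apply => //.
  by case: (f t) nft; case: (f x).
Qed.

(** Only a common point [p] of [A] and [B] is delicate: for [x] in [A] and [y] in [B] near [p], the
    cocycle identity splits [w x y] at [p], where [f] and [g] agree. *)
Lemma primitive_glue A B w f g : closed A -> closed B -> cocycle (A `|` B) w ->
  primitive A w f -> primitive B w g -> (forall x, A x -> B x -> f x = g x) ->
  primitive (A `|` B) w (fun x => if `[< A x >] then f x else g x).
Proof.
move=> cA cB cw pf pg fg p ABp.
(* If [p] is outside the closed set [C], a neighbourhood of [p] misses [C], so the conclusion [C p]
   comes for free from the existence of nearby points of [C]. *)
have key : forall C h, closed C -> primitive C w h ->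
    exists2 U, nbhs p U & forall x y, U x -> C x -> U y -> C y -> 
      C p /\ w x y = h x (+) h y.
  move=> C h cC pC; have [Cp|nCp] := pselect (C p).
    by have [U pU hU] := pC p Cp; exists U => // x y *; split => //; exact: hU.
  exists (~` C); last by move=> x y.
  by apply: open_nbhs_nbhs; split=> //; exact: closed_openC.
have [U pU hU] := key _ _ cA pf; have [V pV hV] := key _ _ cB pg.
have [W pW hW] := cw p ABp.
exists (U `&` V `&` W); first by do 2?apply: filterI.
have pp : U p /\ V p /\ W p by split; [|split]; apply: nbhs_singleton.
have cross x y : U x -> W x -> V y -> W y -> A x -> B y -> w x y = f x (+) g y.
  move=> Ux Wx Vy Wy Ax By; have [Up [Vp Wp]] := pp.
  have [Ap _] := hU x x Ux Ax Ux Ax; have [Bp _] := hV y y Vy By Vy By.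
  rewrite -(hW x p y) //; try by [left|right].
  have [_ ->] := hU x p Ux Ax Up Ap; have [_ ->] := hV p y Vp Bp Vy By.
  by rewrite -fg //; case: (f x); case: (f p); case: (g y).
(* The cocycle identity gives [w x x = false]; modulo 2, antisymmetry is symmetry. *)
have sym x y : W x -> (A `|` B) x -> W y -> (A `|` B) y -> w x y = w y x.
  move=> Wx Kx Wy Ky; have := hW x y x Wx Kx Wy Ky Wx Kx.
  have := hW x x x Wx Kx Wx Kx Wx Kx.
  by case: (w x x); case: (w x y); case: (w y x).
move=> x y [[Ux Vx] Wx] Kx [[Uy Vy] Wy] Ky.
case: asboolP => Ax; case: asboolP => Ay.
- by case: (hU x y Ux Ax Uy Ay).
- by case: Ky => // By; exact: cross.
- by case: Kx => // Bx; rewrite (sym x y Wx (or_intror Bx) Wy (or_introl Ay)) cross // addbC.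
- by case: Kx => // Bx; case: Ky => // By; case: (hV x y Vx Bx Vy By).
Qed.
End Cocycles.

Definition cts_on (X Y : topologicalType) (A : set X) (f : X -> Y) :=
  forall x, A x -> forall V, nbhs (f x) V ->
    exists2 U, nbhs x U & forall y, U y -> A y -> V (f y).

Lemma cts_onP (X Y : topologicalType) (A : set X) (f : X -> Y) :
  {within A, continuous f} <-> cts_on A f.
Proof.
split=> [/subspace_continuousP cf x Ax V /(cf x Ax)|cf].
  by rewrite /= nbhs_simpl /within /= => h; exists [set y | A y -> V (f y)] => // y; exact.
apply/subspace_continuousP => x Ax V /(cf x Ax) [U xU UV].
by rewrite nbhs_simpl /within /=; apply: filterS xU => y Uy Ay; exact: UV.
Qed.

Lemma cts_on_sub (X Y : topologicalType) (A B : set X) (f : X -> Y) :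
  B `<=` A -> cts_on A f -> cts_on B f.
Proof.
move=> sub cf x /sub Ax V /(cf x Ax)[U xU UV]; exists U => // y Uy /sub; exact: UV.
Qed.

Lemma cocycle_comp (X Y : topologicalType) (L : set X) (K : set Y) (h : X -> Y) w :
  cts_on L h -> (forall x, L x -> K (h x)) -> cocycle K w ->
  cocycle L (fun x y => w (h x) (h y)).
Proof.
move=> ch LK cw p Lp; have [V pV hV] := cw _ (LK _ Lp).
have [U pU hU] := ch _ Lp _ pV; exists U => // x y t *.
by apply: hV; (try exact: hU); exact: LK.
Qed.

Lemma primitive_comp (X Y : topologicalType) (L : set X) (K : set Y) (h : X -> Y) w f :
  cts_on L h -> (forall x, L x -> K (h x)) -> primitive K w f ->
  primitive L (fun x y => w (h x) (h y)) (f \o h).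
Proof.
move=> ch LK cw p Lp; have [V pV hV] := cw _ (LK _ Lp).
have [U pU hU] := ch _ Lp _ pV; exists U => // x y *.
by apply: hV; (try exact: hU); exact: LK.
Qed.

Lemma primitive_ext (X : topologicalType) (K : set X) w w' f :
  (forall x y, K x -> K y -> w x y = w' x y) -> primitive K w f -> primitive K w' f.
Proof.
move=> ww h p /h [U pU hU]; exists U => // x y Ux Kx Uy Ky.
by rewrite -ww // hU.
Qed.

Section Plane.
Variable R : realType.
Notation P := (R * R)%type.
Implicit Types (K : set P) (p x y : P) (w : P -> P -> bool) (f : P -> bool).

Lemma nbhs_boxP p U : nbhs p U <->
  exists2 e : R, 0 < e & forall x, `|x.1 - p.1| <= e -> `|x.2 - p.2| <= e -> U x.
Proof.
split=> [/nbhs_ballP [e /= e0 eU]|[e e0 eU]].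
  exists (e / 2); first by rewrite divr_gt0.
  have h (a b : R) : `|a - b| <= e / 2 -> `|b - a| < e.
    by rewrite distrC => /le_lt_trans; apply; rewrite ltr_pdivrMr // ltr_pMr // ltr1n.
  by move=> x x1 x2; apply: eU; split; rewrite /ball /=; apply: h.
apply/nbhs_ballP; exists e => //= x [/= x1 x2]; apply: eU.
  by rewrite distrC ltW.
by rewrite distrC ltW.
Qed.

(** Compactness of an interval as an induction principle, with [Q u v] read as a property of the
    interval from [u] to [v]. The supremum of the points reachable from [a] cannot lie before
    [b]. *)
Lemma interval_ind (Q : R -> R -> Prop) (a b : R) : a <= b ->
  (forall u v u' v', u <= u' -> v' <= v -> Q u v -> Q u' v') ->
  (forall u m v, u <= m -> m <= v -> Q u m -> Q m v -> Q u v) ->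
  (forall x : R, a <= x <= b -> exists2 e, 0 < e & Q (x - e) (x + e)) -> Q a b.
Proof.
move=> ab mono glue loc.
pose S := [set x : R | a <= x <= b /\ Q a x].
have Sa : S a.
  have [|e e0 Qe] := loc a; first by rewrite lexx ab.
  split; first by rewrite lexx ab.
  by apply: mono Qe; rewrite ?gerBl ?lerDl ltW.
have hS : has_sup S by split; [exists a | exists b => x [/andP[]]].
have as_ : a <= sup S by apply: ub_le_sup => //; case: hS.
have sb : sup S <= b by apply: ge_sup => // [|x [/andP[]//]]; exists a.
have [|e e0 Qe] := loc (sup S); first by rewrite as_ sb.
have [x Sx xs] : exists2 x, S x & sup S - e < x by apply: sup_adherent.
have xsup : x <= sup S by apply: ub_le_sup => //; case: hS.
have [/andP[ax xb] Qax] := Sx.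
have Qm v : x <= v -> v <= sup S + e -> Q a v.
  by move=> xv vs; apply: (glue a x v) => //; apply: mono Qe => //; exact: ltW.
have [bs|sb'] := leP b (sup S + e); first exact: Qm.
suff /(ub_le_sup (proj2 hS)): S (sup S + e) by rewrite gerDl leNgt e0.
split; first by rewrite (ltW sb') andbT (le_trans as_) // lerDl ltW.
by apply: Qm => //; rewrite (le_trans xsup) // lerDl ltW.
Qed.
End Plane.

(** * Exactness of cocycles on convex plane sets *)

Section Plane2.
Variable R : realType.
Notation P := (R * R)%type.

Definition seg (x y : P) (t : R) : P :=
  ((1 - t) * x.1 + t * y.1, (1 - t) * x.2 + t * y.2).

Definition cvx (K : set P) :=
  forall x y t, 0 <= t <= 1 -> K x -> K y -> K (seg x y t).

Lemma mix_lt (a b c t : R) : 0 <= t <= 1 -> a < c -> b < c -> (1 - t) * a + t * b < c.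
Proof.
move=> /andP[t0 t1] ac bc; have [->|tn] := eqVneq t 0; first by lra.
have t0' : 0 < t by rewrite lt_neqAle eq_sym tn.
have h : t * b < t * c by rewrite ltr_pM2l.
have h' : (1 - t) * a <= (1 - t) * c by apply: ler_wpM2l; [rewrite subr_ge0|exact: ltW].
by lra.
Qed.

Lemma mix_gt (a b c t : R) : 0 <= t <= 1 -> c < a -> c < b -> c < (1 - t) * a + t * b.
Proof.
by move=> ht ca cb; have := @mix_lt (- a) (- b) (- c) t ht; rewrite !ltrN2 => /(_ ca cb); lra.
Qed.

Lemma seg0 x y : seg x y 0 = x.
Proof. by rewrite /seg subr0 !mul1r !mul0r !addr0 -surjective_pairing. Qed.

Lemma seg1 x y : seg x y 1 = y.
Proof. by rewrite /seg subrr !mul1r !mul0r !add0r -surjective_pairing. Qed.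

Lemma seg_continuous x y : continuous (seg x y).
Proof.
have c (a b : R) : continuous (fun t : R => (1 - t) * a + t * b).
  by move=> t; apply: cvgD; (apply: cvgM; last exact: cvg_cst) => //; apply: cvgB; [exact: cvg_cst|exact: cvg_id].
by move=> t; exact: (cvg_pair (c x.1 y.1 t) (c x.2 y.2 t)).
Qed.

Lemma connected_seg x y : connected (seg x y @` `[0, 1]).
Proof.
apply: connected_continuous_connected; first exact: segment_connected.
by apply: continuous_subspaceT => t; exact: seg_continuous.
Qed.

Lemma cvx_connected K : cvx K -> connected K.
Proof.
move=> cK; have [[x0 Kx0]|nK] := pselect (exists x, K x); last first.
  have -> : K = set0 by apply/seteqP; split => // x Kx; apply: nK; exists x.
  exact: connected0.
have -> : K = \bigcup_(y in K) (seg x0 y @` `[0, 1]).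
  apply/seteqP; split=> [y Ky|y [z Kz] [t /= ht <-]]; last by apply: cK => //; rewrite in_itv in ht.
  by exists y => //; exists 1; [rewrite /= in_itv /= lexx ler01|rewrite seg1].
apply: bigcup_connected; last by move=> *; exact: connected_seg.
exists x0 => y Ky; exists 0; last by rewrite seg0.
by rewrite /= in_itv /= lexx ler01.
Qed.

Lemma closed_coord (f : P -> R) (a : R) : continuous f ->
  closed [set x | f x <= a] /\ closed [set x | a <= f x].
Proof.
move=> cf; split.
  by apply: (@closed_comp _ _ f [set t | t <= a]) => [x _|]; [exact: cf|exact: closed_le].
by apply: (@closed_comp _ _ f [set t | a <= t]) => [x _|]; [exact: cf|exact: closed_ge].
Qed.

Definition box (a b c d : R) : set P :=
  [set x | [/\ a <= x.1, x.1 <= b, c <= x.2 & x.2 <= d]].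

Lemma closed_box a b c d : closed (box a b c d).
Proof.
have c1 : continuous (fst : P -> R) by move=> x; exact: cvg_fst.
have c2 : continuous (snd : P -> R) by move=> x; exact: cvg_snd.
have -> : box a b c d = [set x | a <= x.1] `&` [set x | x.1 <= b] `&`
    ([set x | c <= x.2] `&` [set x | x.2 <= d]).
  by apply/seteqP; split=> x; [case|case; case => ? ? [? ?]].
by apply: closedI; apply: closedI; first [exact: (closed_coord _ c1).1|
   exact: (closed_coord _ c1).2|exact: (closed_coord _ c2).1|exact: (closed_coord _ c2).2].
Qed.

Lemma cvx_box a b c d : cvx (box a b c d).
Proof.
by move=> x y t /andP[t0 t1] [? ? ? ?] [? ? ? ?]; split => /=; nra.
Qed.

Lemma box_sub (a b c d a' b' c' d' : R) : a' <= a -> b <= b' -> c' <= c -> d <= d' ->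
  box a b c d `<=` box a' b' c' d'.
Proof.
move=> h1 h2 h3 h4 x [? ? ? ?].
by split; [exact: le_trans h1 _|exact: le_trans h2|exact: le_trans h3 _|exact: le_trans h4].
Qed.

Lemma cvxI K L : cvx K -> cvx L -> cvx (K `&` L).
Proof. by move=> cK cL x y t ht [? ?] [? ?]; split; [exact: cK|exact: cL]. Qed.

(* On a connected intersection two primitives differ by a constant. *)
Lemma primitive_glue_connected (A B : set P) w f g : closed A -> closed B ->
  cocycle (A `|` B) w -> connected (A `&` B) ->
  primitive A w f -> primitive B w g -> exists h, primitive (A `|` B) w h.
Proof.
move=> cA cB cw cAB pf pg.
have cst : forall x y, (A `&` B) x -> (A `&` B) y -> f x (+) g x = f y (+) g y.
  apply: (connected_constant (f := fun x => f x (+) g x) cAB).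
  apply: (@primitive_ext _ _ (addc w w)); first by move=> x y _ _; rewrite /addc addbb.
  by apply: primitive_add; [apply: primitive_sub pf => x []|apply: primitive_sub pg => x []].
have [[x0 AB0]|nAB] := pselect (exists x, (A `&` B) x).
  have := primitive_glue cA cB cw pf (primitive_negb (f x0 (+) g x0) pg).
  move=> h; eexists; apply: h => x Ax Bx; rewrite (cst x0 x) //.
  by case: (f x); case: (g x).
have := primitive_glue cA cB cw pf pg.
by move=> h; eexists; apply: h => x Ax Bx; case: nAB; exists x.
Qed.

(* K is cut into small boxes; all intersections that arise are convex. *)
Lemma cvx_exact K w (a b c d : R) : closed K -> cvx K -> a <= b -> c <= d ->
  K `<=` box a b c d -> cocycle K w -> exists f, primitive K w f.
Proof.
move=> clK cK ab cd Kbox cw.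
pose E u v c d := exists f, primitive (K `&` box u v c d) w f.
have mono u v c1 d1 u' v' c' d' : u <= u' -> v' <= v -> c1 <= c' -> d' <= d1 ->
    E u v c1 d1 -> E u' v' c' d'.
  move=> uu vv cc dd [f pf]; exists f; apply: primitive_sub pf => x [Kx [? ? ? ?]].
  by split=> //; split; lra.
have glue A B : closed A -> closed B -> cvx A -> cvx B ->
    (exists f, primitive (K `&` A) w f) -> (exists f, primitive (K `&` B) w f) ->
    exists f, primitive ((K `&` A) `|` (K `&` B)) w f.
  move=> clA clB cA cB [f pf] [g pg].
  apply: (primitive_glue_connected _ _ _ _ pf pg); try exact: closedI.
    by apply: cocycle_sub cw => x [[]|[]].
  by apply: cvx_connected; do 3?apply: cvxI.
have gluex u m v c' d' : u <= m -> m <= v -> E u m c' d' -> E m v c' d' -> E u v c' d'.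
  move=> um mv h1 h2; have [||||f pf] := glue _ _ _ _ _ _ h1 h2;
    try exact: closed_box; try exact: cvx_box.
  exists f; apply: primitive_sub pf => x [Kx [? ? ? ?]].
  by have [xm|/ltW mx] := leP x.1 m; [left|right].
have gluey u v c' m d' : c' <= m -> m <= d' -> E u v c' m -> E u v m d' -> E u v c' d'.
  move=> um mv h1 h2; have [||||f pf] := glue _ _ _ _ _ _ h1 h2;
    try exact: closed_box; try exact: cvx_box.
  exists f; apply: primitive_sub pf => x [Kx [? ? ? ?]].
  by have [xm|/ltW mx] := leP x.2 m; [left|right].
suff [f pf] : E a b c d by exists f; apply: primitive_sub pf => x Kx; split => //; exact: Kbox.
(* Near a point of [K] the cocycle identity makes [w (x, y)] itself a primitive; away from [K] a
   small box misses [K] and any function will do. *)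
have loc (x y : R) : exists2 e, 0 < e & E (x - e) (x + e) (y - e) (y + e).
  have inbox e u : box (x - e) (x + e) (y - e) (y + e) u ->
      `|u.1 - x| <= e /\ `|u.2 - y| <= e.
    by case=> *; rewrite !ler_norml; split; apply/andP; split; lra.
  have [Kxy|nKxy] := pselect (K (x, y)).
    have [U /nbhs_boxP[e e0 eU] hU] := cw _ Kxy.
    exists e => //; exists (w (x, y)) => p [Kp _]; exists setT; first exact: filterT.
    move=> u v _ [Ku /inbox[u1 u2]] _ [Kv /inbox[v1 v2]].
    have U0 : U (x, y) by apply: eU; rewrite subrr normr0 ltW.
    have Uu := eU u u1 u2; have Uv := eU v v1 v2.
    by have := hU (x, y) u v U0 Kxy Uu Ku Uv Kv; case: (w _ u); case: (w _ v); case: (w _ _).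
  have : nbhs (x, y) (~` K) by apply: open_nbhs_nbhs; split=> //; exact: closed_openC.
  move=> /nbhs_boxP[e e0 eU]; exists e => //; exists (fun=> false) => p [Kp /inbox[p1 p2]].
  by case: (eU p).
apply: (interval_ind (Q := fun u v => E u v c d)) => //.
- by move=> u v u' v' uu vv; apply: mono.
- by move=> u m v; exact: gluex.
move=> x _.
suff [e e0 Ee] : exists2 e, 0 < e & E (x - e) (x + e) c d by exists e.
(* The inner induction builds a full vertical strip around [x], shrinking its width at each gluing;
   the outer one then glues strips. *)
apply: (interval_ind (Q := fun u v => exists2 e, 0 < e & E (x - e) (x + e) u v)) => //.
- by move=> u v u' v' uu vv [e e0 Ee]; exists e => //; apply: mono Ee.
- move=> u m v um mv [e e0 Ee] [e' e'0 Ee']; exists (Num.min e e').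
    by rewrite lt_min e0.
  by apply: (gluey _ _ _ m) => //; [apply: mono Ee|apply: mono Ee'] => //;
    rewrite ?lerB ?lerD ?ge_min ?lexx ?orbT.
by move=> y _; have [e e0 Ee] := loc x y; exists e => //; exists e.
Qed.
End Plane2.

(** * The first cohomology of a square annulus *)

Section Annulus.
Variable R : realType.
Notation P := (R * R)%type.
Implicit Types (w : P -> P -> bool) (f : P -> bool) (e : R).

Definition annL e := box (-1) (- e) (-1) 1 : set P.
Definition annR e := box e 1 (-1) 1 : set P.
Definition annT e := box (-1) 1 e 1 : set P.
Definition annB e := box (-1) 1 (-1) (- e) : set P.
Definition annulus e := annL e `|` annT e `|` annR e `|` annB e.

(** Left, top and right rectangles glue to one primitive, since consecutive ones meet in a connected
    corner. The bottom meets their union in two corners: one mismatch is absorbed into [g], and the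
    other is the class [c]. *)
Lemma annulus_class e w : 0 < e <= 1 -> cocycle (annulus e) w ->
  exists f g c, [/\ primitive (annL e `|` annT e `|` annR e) w f,
    primitive (annB e) w g, forall x, annL e x -> annB e x -> f x = g x &
    forall x, annR e x -> annB e x -> f x = g x (+) c].
Proof.
move=> /andP[e0 e1] cw.
have exb a b c d : a <= b -> c <= d -> box a b c d `<=` annulus e ->
    exists f, primitive (box a b c d) w f.
  move=> ab cd sub; apply: (@cvx_exact R (box a b c d) w a b c d) => //; first exact: closed_box.
    exact: cvx_box.
  exact: cocycle_sub cw.
have [||x ?|f1 p1] := exb (-1) (- e) (-1) 1; try lra; first by do 3 left.
have [||x ?|f2 p2] := exb (-1) 1 e 1; try lra; first by do 2 left; right.
have [||x ?|f3 p3] := exb e 1 (-1) 1; try lra; first by left; right.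
have [||x ?|g pg] := exb (-1) 1 (-1) (- e); try lra; first by right.
have cvxc (A : set P) a b c d : A = box a b c d -> connected A.
  by move=> ->; apply: cvx_connected; exact: cvx_box.
have [||f12 p12] := primitive_glue_connected (@closed_box R _ _ _ _) (@closed_box R _ _ _ _) _ _ p1 p2.
- by apply: cocycle_sub cw => x ?; do 2 left.
- apply: (cvxc _ (-1) (- e) e 1); apply/seteqP; split=> x.
    by case=> -[? ? ? ?] [? ? ? ?]; split; lra.
  by case=> *; split; split; lra.
have [||f pf] := primitive_glue_connected (closedU (@closed_box R _ _ _ _) (@closed_box R _ _ _ _)) (@closed_box R _ _ _ _) _ _ p12 p3.
- by apply: cocycle_sub cw => x ?; left.
- apply: (cvxc _ e 1 e 1); apply/seteqP; split=> x.
    by case=> -[] [? ? ? ?] [? ? ? ?]; split; lra.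
  by case=> *; split; [right|]; split; lra.
have cst (a b c d : R) : box a b c d `<=` annL e `|` annT e `|` annR e ->
    box a b c d `<=` annB e ->
    forall x y, box a b c d x -> box a b c d y -> f x (+) g x = f y (+) g y.
  move=> s1 s2.
  apply: (connected_constant (f := fun x => f x (+) g x)); first exact: cvxc.
  apply: (@primitive_ext _ _ (addc w w)); first by move=> x y _ _; rewrite /addc addbb.
  by apply: primitive_add; [exact: primitive_sub pf|exact: primitive_sub pg].
have Ne1 : - e <= 1 by lra.
have cL := cst (-1) (- e) (-1) (- e) (fun y h => or_introl (or_introl (box_sub (lexx _) (lexx _) (lexx _) Ne1 h)))
  (box_sub (lexx _) Ne1 (lexx _) (lexx _)).
have N1e : -1 <= e by lra.
have cR := cst e 1 (-1) (- e) (fun y h => or_intror (box_sub (lexx _) (lexx _) (lexx _) Ne1 h))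
  (box_sub N1e (lexx _) (lexx _) (lexx _)).
have [N11 N1Ne] : -1 <= 1 :> R /\ -1 <= - e by split; lra.
(* The constant mismatch at the lower left corner. *)
pose b := f (-1, -1) (+) g (-1, -1).
exists f, (fun x => g x (+) b), (f (1, -1) (+) g (1, -1) (+) b); split.
- exact: pf.
- exact: primitive_negb.
- move=> x [? ? ? ?] [? ? ? ?].
  have : f x (+) g x = b.
    apply: cL; split => //; rewrite /= lexx.
  by move=> <-; rewrite addbCA addbb addbF.
move=> x [? ? ? ?] [? ? ? ?].
have : f x (+) g x = f (1, -1) (+) g (1, -1).
  apply: cR; split => //; rewrite /= lexx.
by move=> <-; generalize (f x) (g x) b => -[] [] [].
Qed.

Lemma annulus_class0 e w f g : 0 < e <= 1 -> cocycle (annulus e) w ->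
  primitive (annL e `|` annT e `|` annR e) w f -> primitive (annB e) w g ->
  (forall x, annL e x -> annB e x -> f x = g x) ->
  (forall x, annR e x -> annB e x -> f x = g x) ->
  exists h, primitive (annulus e) w h.
Proof.
move=> /andP[e0 e1] cw pf pg fL fR.
eexists; apply: (primitive_glue _ _ cw pf pg).
- by do ?apply: closedU; exact: closed_box.
- exact: closed_box.
by move=> x [[|]|]; [exact: fL| |exact: fR] => -[? ? ? ?] [? ? ? ?]; exfalso; lra.
Qed.

(* H^1 of the annulus with coefficients in Z/2 has only one nonzero class. *)
Lemma annulus_dim1 e w1 w2 : 0 < e <= 1 ->
  cocycle (annulus e) w1 -> cocycle (annulus e) w2 ->
  exists f, [\/ primitive (annulus e) w1 f, primitive (annulus e) w2 f
    | primitive (annulus e) (addc w1 w2) f].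
Proof.
move=> he c1 c2.
have [f1 [g1 [d1 [pf1 pg1 L1 R1]]]] := annulus_class he c1.
have [f2 [g2 [d2 [pf2 pg2 L2 R2]]]] := annulus_class he c2.
case: d1 R1 => R1; last first.
  have [|h ph] := annulus_class0 he c1 pf1 pg1 L1.
    by move=> x ? ?; rewrite R1 // addbF.
  by exists h; constructor 1.
case: d2 R2 => R2; last first.
  have [|h ph] := annulus_class0 he c2 pf2 pg2 L2.
    by move=> x ? ?; rewrite R2 // addbF.
  by exists h; constructor 2.
have [||h ph] := annulus_class0 he (cocycle_add c1 c2) (primitive_add pf1 pf2)
  (primitive_add pg1 pg2).
- by move=> x ? ?; rewrite L1 // L2.
- by move=> x ? ?; rewrite R1 // R2 //; case: (g1 x); case: (g2 x).
by exists h; constructor 3.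
Qed.

End Annulus.

Section Winding.
Variable R : realType.
Notation P := (R * R)%type.
Implicit Types (w : P -> P -> bool) (f : P -> bool) (e : R).

(* Generator of H^1 of the punctured plane: the jump across the ray x.1 > 0, x.2 = 0. *)
Definition winding (x y : P) : bool := ((0 <= x.2) (+) (0 <= y.2)) && (0 < x.1).

(** Near a point with nonzero second coordinate the sign of [x.2] is constant and the cochain
    vanishes. Near a point with nonzero first coordinate the factor [0 < x.1] is constant, which
    leaves zero or a coboundary. *)
Lemma winding_cocycle : cocycle [set~ (0 : P)] winding.
Proof.
move=> p /= p0.
have small (u v : R) : `|u - v| <= `|v| / 2 -> v != 0 -> (0 < u) = (0 < v) /\ (0 <= u) = (0 <= v).
  move=> h; rewrite neq_lt => /orP[v0|v0].
    rewrite (ltr0_norm v0) ler_norml in h; case/andP: h => ? ?.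
    by split; apply/idP/idP; lra.
  rewrite (gtr0_norm v0) ler_norml in h; case/andP: h => ? ?.
  by split; apply/idP/idP; lra.
have [p10|p10] := eqVneq p.1 0.
  have p20 : p.2 != 0.
    by apply/eqP => p20; apply: p0; rewrite (surjective_pairing p) p10 p20.
  exists [set x | `|x.2 - p.2| <= `|p.2| / 2].
    by apply/nbhs_boxP; exists (`|p.2| / 2); rewrite ?divr_gt0 ?normr_gt0.
  move=> x y t /= /small/(_ p20)[_ h1] _ /small/(_ p20)[_ h2] _ /small/(_ p20)[_ h3] _.
  by rewrite /winding h1 h2 h3 addbb.
exists [set x | `|x.1 - p.1| <= `|p.1| / 2].
  by apply/nbhs_boxP; exists (`|p.1| / 2); rewrite ?divr_gt0 ?normr_gt0.
move=> x y t /= /small/(_ p10)[h1 _] _ /small/(_ p10)[h2 _] _ /small/(_ p10)[h3 _] _.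
rewrite /winding h1 h2; case: (0 < p.1); rewrite ?andbF ?andbT //.
by case: (_ <= _); case: (_ <= _); case: (_ <= _).
Qed.

Lemma cvx_constant (K C : set P) w f : cvx C -> C `<=` K -> primitive K w f ->
  (forall x y, C x -> C y -> w x y = false) -> forall x y, C x -> C y -> f x = f y.
Proof.
move=> cC CK pf w0; apply: connected_constant; first exact: cvx_connected.
by apply: (@primitive_ext _ _ w) => //; exact: primitive_sub pf.
Qed.

(** A primitive would be constant on each convex piece where [winding] vanishes. Going once around
    from [(1, 0)] over the top, left and bottom returns to a point just below, yet [winding] is
    nonzero between these two points. *)
Lemma winding_not_exact e f : 0 < e <= 1 -> ~ primitive (annulus e) winding f.
Proof.
move=> /andP[e0 e1] pf.
have K10 : annulus e (1, 0) by left; right; split => /=; lra.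
have [U /nbhs_boxP[d d0 dU] hU] := pf _ K10.
(* The minimum keeps [q] both in the neighbourhood of [(1, 0)] and in the annulus. *)
pose q : P := (1, - Num.min d 1).
have m0 : 0 < Num.min d 1 by rewrite lt_min d0 ltr01.
have m1 : Num.min d 1 <= 1 by rewrite ge_min lexx orbT.
have md : Num.min d 1 <= d by rewrite ge_min lexx.
have Kq : annulus e q by left; right; split => /=; lra.
have : winding (1, 0) q = f (1, 0) (+) f q.
  apply: hU => //; apply: dU => /=; rewrite ?subrr ?normr0; try exact: ltW.
  by rewrite subr0 normrN gtr0_norm.
have -> : winding (1, 0) q = true.
  rewrite /winding; apply/andP; split; last exact: ltr01.
  by apply/idP; rewrite (_ : (0 <= q.2) = false) /= ?lexx //; apply/negP; lra.
have cst C : cvx C -> C `<=` annulus e ->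
    (forall x y, C x -> C y -> winding x y = false) -> forall x y, C x -> C y -> f x = f y.
  by move=> h1 h2; apply: (cvx_constant h1 h2 pf).
suff -> : f (1, 0) = f q by rewrite addbb.
transitivity (f (1, 1)).
  apply: (cst (box e 1 0 1)); first exact: cvx_box.
  - by move=> x [? ? ? ?]; left; right; split; lra.
  - by move=> x y [_ _ x2 _] [_ _ y2 _]; rewrite /winding x2 y2.
  - by split => /=; lra.
  - by split => /=; lra.
transitivity (f (-1, 1)).
  apply: (cst (annT e)); first exact: cvx_box.
  - by move=> x ?; do 2 left; right.
  - move=> x y [_ _ x2 _] [_ _ y2 _]; rewrite /winding.
    by rewrite (le_trans (ltW e0) x2) (le_trans (ltW e0) y2).
  - by split => /=; lra.
  - by split => /=; lra.
transitivity (f (-1, -1)).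
  apply: (cst (annL e)); first exact: cvx_box.
  - by move=> x ?; do 3 left.
  - move=> x y [_ x2 _ _] _; rewrite /winding.
    by rewrite (_ : (0 < x.1) = false) ?andbF //; apply/negP; lra.
  - by split => /=; lra.
  - by split => /=; lra.
transitivity (f (1, -1)).
  apply: (cst (annB e)); first exact: cvx_box.
  - by move=> x ?; right.
  - move=> x y [_ _ _ x2] [_ _ _ y2]; rewrite /winding.
    have ng (t : R) : t < 0 -> (0 <= t) = false by move=> h; apply/negP; lra.
  by rewrite !ng //; lra.
  - by split => /=; lra.
  - by split => /=; lra.
apply: (cst (annR e `&` [set x | x.2 < 0])).
- apply: cvxI; first exact: cvx_box.
  by move=> x y t /andP[t0 t1] /= x2 y2; nra.
- by move=> x [? _]; left; right.
- move=> x y [_ /= x2] [_ /= y2]; rewrite /winding.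
  have ng (t : R) : t < 0 -> (0 <= t) = false by move=> h; apply/negP; lra.
  by rewrite !ng //; lra.
- by split; [split => /=|rewrite /=]; lra.
- by split; [split => /=|rewrite /=]; lra.
Qed.

Definition obox (r : R) : set P := [set x | `|x.1| < r /\ `|x.2| < r].

(** The punctured square is a cyclic chain of four convex halves, right, top, left and bottom,
    consecutive ones overlapping. *)
Lemma punctured_obox_connected r : 0 < r -> connected (obox r `\` [set 0]).
Proof.
move=> r0.
have ob x : obox r x <-> [/\ - r < x.1, x.1 < r, - r < x.2 & x.2 < r].
  by rewrite /obox /= !ltr_norml; split=> [[/andP[? ?] /andP[? ?]]|[-> -> -> ->]].
pose C1 := [set x | obox r x /\ 0 < x.1]; pose C2 := [set x | obox r x /\ 0 < x.2].
pose C3 := [set x | obox r x /\ x.1 < 0]; pose C4 := [set x | obox r x /\ x.2 < 0].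
have -> : obox r `\` [set 0] = C1 `|` C2 `|` C3 `|` C4.
  apply/seteqP; split=> x; last first.
    by case=> [[[]|]|] [? hx]; split => //= x0; move: hx; rewrite x0 /= ltxx.
  case=> bx /= x0; have [h|h|h1] := ltgtP x.1 0.
  - by left; right.
  - by do 3 left.
  have [h|h|h2] := ltgtP x.2 0; [by right|by do 2 left; right|].
  by case: x0; rewrite (surjective_pairing x) h1 h2.
have cv (D : set P) : cvx D -> connected (obox r `&` D).
  move=> cD; apply: cvx_connected; apply: cvxI => // x y t ht /ob[? ? ? ?] /ob[? ? ? ?].
  by apply/ob; split; [exact: mix_gt|exact: mix_lt|exact: mix_gt|exact: mix_lt].
have ptin (a b : R) : `|a| < r -> `|b| < r -> obox r (a, b) by [].
have hr : `|r / 2| < r by rewrite gtr0_norm; lra.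
have hr' : `|- (r / 2)| < r by rewrite normrN.
apply: connectedU; first by exists (r / 2, - (r / 2)); split; [do 2 left|]; split=> //=; lra.
  apply: connectedU; first by exists (- (r / 2), r / 2); split; [right|]; split=> //=; lra.
    apply: connectedU; first by exists (r / 2, r / 2); split; split=> //=; lra.
    - by apply: cv => x y t ht /= ? ?; first [exact: mix_lt|exact: mix_gt].
    - by apply: cv => x y t ht /= ? ?; first [exact: mix_lt|exact: mix_gt].
  by apply: cv => x y t ht /= ? ?; first [exact: mix_lt|exact: mix_gt].
by apply: cv => x y t ht /= ? ?; first [exact: mix_lt|exact: mix_gt].
Qed.
End Winding.

(** * Local structure of surfaces *)

Section Charts.
Variables (R : realType) (S : topologicalType).
Notation P := (R * R)%type.
Hypothesis mS : manifold2 R S.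

Definition scale (e : R) (x : P) : P := (e * x.1, e * x.2).

Lemma scale_continuous e : continuous (scale e).
Proof.
move=> x; apply: (@cvg_pair _ _ _ _ (nbhs (e * x.1)) (nbhs (e * x.2))).
  by apply: cvgM; [exact: cvg_cst|exact: cvg_fst].
by apply: cvgM; [exact: cvg_cst|exact: cvg_snd].
Qed.

Lemma continuous_cts_on (X Y : topologicalType) (A : set X) (f : X -> Y) :
  continuous f -> cts_on A f.
Proof. by move=> cf x _ V /cf fV; exists (f @^-1` V). Qed.

Lemma cts_on_comp (X Y Z : topologicalType) (A : set X) (B : set Y) (f : X -> Y) (g : Y -> Z) :
  cts_on A f -> cts_on B g -> (forall x, A x -> B (f x)) -> cts_on A (g \o f).
Proof.
move=> cf cg AB x Ax V gV; have [W fW WV] := cg _ (AB _ Ax) V gV.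
by have [U xU UW] := cf x Ax W fW; exists U => // y Uy Ay; apply: WV; [exact: UW|exact: AB].
Qed.

Lemma open_preimage_on (X Y : topologicalType) (U : set X) (D : set Y) (h : X -> Y) :
  open U -> cts_on U h -> open D -> open (U `&` h @^-1` D).
Proof.
move=> oU ch oD; rewrite openE => x [Ux Dx].
have [W xW WD] := ch x Ux D (open_nbhs_nbhs (conj oD Dx)).
have xU : nbhs x U by exact: open_nbhs_nbhs.
by apply: filterS (filterI xW xU) => y [Wy Uy]; split => //; exact: WD.
Qed.

Lemma open_obox r : open (obox r : set P).
Proof.
rewrite openE => x [x1 x2]; apply/nbhs_boxP.
have m0 : 0 < Num.min (r - `|x.1|) (r - `|x.2|) by rewrite lt_min !subr_gt0 x1 x2.
exists (Num.min (r - `|x.1|) (r - `|x.2|) / 2); first by rewrite divr_gt0.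
have key (a b m : R) : 0 < m -> `|a - b| <= m / 2 -> m <= r - `|b| -> `|a| < r.
  by move=> m00 ab mb; have := ler_normD (a - b) b; rewrite subrK; lra.
by move=> y y1 y2; split; [apply: key y1 _|apply: key y2 _] => //; rewrite ge_min lexx ?orbT.
Qed.

(** The chart is centred at [p], and its image is the open square of half-width 2, so that the
    closed unit square with all its annuli fits inside. *)
Record chart (p : S) (O : set S) (U : set S) (h : S -> P) (g : P -> S) : Prop := Chart {
  chart_open : open U;
  chart_mem : U p;
  chart_sub : U `<=` O;
  chart_cts : cts_on U h;
  chart_inv_cts : cts_on (obox 2) g;
  chart_in : forall x, U x -> obox 2 (h x);
  chart_inv_in : forall y, obox 2 y -> U (g y);
  chartK : forall x, U x -> g (h x) = x;
  chartVK : forall y, obox 2 y -> h (g y) = y;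
  chart0 : h p = 0 }.

Lemma chart_exists p O : open O -> O p -> exists U h g, chart p O U h g.
Proof.
move=> oO Op; case: mS => _ _ /(_ p)[U0 [W [f [oU0 U0p oW]]]].
case=> -[fU0 _ fsurj] /cts_onP cf [g /cts_onP cg gf].
have gK x : U0 x -> g (f x) = x by move=> Ux; apply: gf; exact/mem_set.
have fK y : W y -> f (g y) = y.
  by move=> /fsurj[x Ux <-]; rewrite gK.
have Wg y : W y -> U0 (g y) by move=> /fsurj[x Ux <-]; rewrite gK.
have Wf x : U0 x -> W (f x) by move=> Ux; exact: fU0.
have [B pB BO] : exists2 B, nbhs (f p) B & forall y, B y -> W y /\ O (g y).
  have [|B pB BO] := cg (f p) (Wf _ U0p) O.
    by rewrite gK //; exact: open_nbhs_nbhs.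
  exists (B `&` W); last by move=> y [By Wy]; split => //; exact: BO.
  by apply: filterI => //; apply: open_nbhs_nbhs; split => //; exact: Wf.
have [e e0 eB] := (nbhs_boxP _ _).1 pB.
(* With this factor the square [obox 2] is rescaled into the box of half-width [e], which lies in
   the image of the original chart and maps into [O]. *)
pose r := e / 2; have r0 : 0 < r by rewrite /r divr_gt0.
pose h (x : S) : P := (r^-1 * ((f x).1 - (f p).1), r^-1 * ((f x).2 - (f p).2)).
pose T (y : P) : P := ((f p).1 + r * y.1, (f p).2 + r * y.2).
have Th x : T (h x) = f x.
  by rewrite /T /h /= !mulrA divff ?gt_eqF // !mul1r ![_ + (_ - _)]addrC !subrK -surjective_pairing.
have TB y : obox 2 y -> W (T y) /\ O (g (T y)).
  have aux (u v : R) : `|v| < 2 -> `|u + r * v - u| <= e.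
    by rewrite addrAC subrr add0r normrM (gtr0_norm r0) /r => v2; nra.
  by move=> [y1 y2]; apply/BO/eB; exact: aux.
have Tc : continuous T.
  move=> x; apply: (@cvg_pair _ _ _ _ (nbhs ((f p).1 + r * x.1)) (nbhs ((f p).2 + r * x.2))).
    by apply: cvgD; [exact: cvg_cst|apply: cvgM; [exact: cvg_cst|exact: cvg_fst]].
  by apply: cvgD; [exact: cvg_cst|apply: cvgM; [exact: cvg_cst|exact: cvg_snd]].
have hT y : obox 2 y -> h (g (T y)) = y.
  have aux (u v : R) : r^-1 * (u + r * v - u) = v.
    by rewrite addrAC subrr add0r mulKf // gt_eqF.
  by move=> /TB[WT _]; rewrite /h fK // /T /= !aux -surjective_pairing.
have hc : cts_on U0 h.
  apply: (cts_on_comp (B := setT) cf (g := fun y : P => (r^-1 * (y.1 - (f p).1), r^-1 * (y.2 - (f p).2)) : P)) => //.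
  apply: continuous_cts_on => x; apply: (@cvg_pair _ _ _ _ (nbhs (r^-1 * (x.1 - (f p).1))) (nbhs (r^-1 * (x.2 - (f p).2)))).
    by apply: cvgM; [exact: cvg_cst|apply: cvgB; [exact: cvg_fst|exact: cvg_cst]].
  by apply: cvgM; [exact: cvg_cst|apply: cvgB; [exact: cvg_snd|exact: cvg_cst]].
exists (U0 `&` h @^-1` obox 2), h, (g \o T); split.
- by apply: open_preimage_on => //; exact: open_obox.
- by split => //; rewrite /h /obox /= !subrr !mulr0 normr0 ltr0n.
- by move=> x [U0x /TB[]]; rewrite Th gK.
- by apply: cts_on_sub hc => x [].
- apply: (cts_on_comp (B := W)) cg _; last by move=> y /TB[].
  exact: continuous_cts_on.
- by move=> x [].
- move=> y yb /=; have [Wy _] := TB _ yb; split; first exact: Wg.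
  by rewrite /= hT.
- by move=> x [U0x _]; rewrite /= Th gK.
- by move=> y yb; exact: hT.
- by rewrite /h !subrr !mulr0.
Qed.

Lemma chart_nbhs p O U h g : chart p O U h g -> forall r, 0 < r -> r <= 2 ->
  [/\ open (U `&` h @^-1` obox r), (U `&` h @^-1` obox r) p &
     forall y, obox r y -> (U `&` h @^-1` obox r) (g y)].
Proof.
case=> oU Up UO hc gc hin gin gh hg h0 r r0 r2.
have sub y : obox r y -> obox 2 y by case=> *; split; apply: lt_le_trans r2.
split; first by apply: open_preimage_on => //; exact: open_obox.
  by split => //=; rewrite h0 /obox /= normr0.
by move=> y yr; split; [exact/gin/sub|rewrite /= hg //; exact: sub].
Qed.

Lemma punctured_nbhs_connected p O : open O -> O p ->
  exists U : set S, [/\ open U, U p, U `<=` O & connected (U `\` [set p])].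
Proof.
move=> oO Op; have [U [h [g C]]] := chart_exists oO Op.
have [oU Up Ug] := chart_nbhs C ltr01 (ler1n _ 2).
case: C => _ Up' UO hc gc hin gin gh hg h0.
exists (U `&` h @^-1` obox 1); split => //; first by move=> x [/UO].
have sub y : obox 1 y -> obox 2 y by case=> *; split; apply: lt_trans (ltr1n _ 2).
have -> : U `&` h @^-1` obox 1 `\` [set p] = g @` (obox 1 `\` [set 0]).
  apply/seteqP; split=> [x [[Ux hx] /= xp]|_ [y [y1 /= y0] <-]].
    exists (h x); last exact: gh.
    by split => // /= hx0; apply: xp; rewrite -(gh x Ux) hx0 -h0 gh.
  split; first exact: Ug.
  by move=> /= gyp; apply: y0; rewrite -(hg y) ?gyp //; exact: sub.
apply: connected_continuous_connected; first exact: punctured_obox_connected.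
by apply/cts_onP; apply: cts_on_sub gc => y [/sub].
Qed.

Lemma obox_sub r s : r <= s -> obox r `<=` (obox s : set P).
Proof. by move=> rs y [? ?]; split; apply: lt_le_trans rs. Qed.

Lemma annulusP e x : 0 < e <= 1 ->
  annulus e x <-> box (-1) 1 (-1) 1 x /\ ~ (obox e : set P) x.
Proof.
move=> /andP[e0 e1]; rewrite /obox /= !ltr_norml; split.
  move=> h; split; first by case: h => [[[]|]|] [? ? ? ?]; split; lra.
  by case: h => [[[]|]|] [? ? ? ?] [/andP[? ?] /andP[? ?]]; lra.
move=> [[? ? ? ?] n].
have [?|?] := leP x.1 (- e); first by do 3 left.
have [?|?] := leP e x.1; first by left; right.
have [?|?] := leP x.2 (- e); first by right.
have [?|?] := leP e x.2; first by do 2 left; right.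
by case: n; split; apply/andP.
Qed.

Lemma box_nbhs0 (V : set P) : nbhs (0 : P) V ->
  exists2 e, 0 < e <= 1 & forall x, obox e x -> V x.
Proof.
move=> /nbhs_boxP[e e0 eV]; exists (Num.min e 1).
  by rewrite lt_min e0 ltr01 ge_min lexx orbT.
by move=> x [x1 x2]; apply: eV; rewrite subr0 ltW //;
  [apply: lt_le_trans x1 _|apply: lt_le_trans x2 _]; rewrite ge_min lexx.
Qed.

(** A closed annulus fits in between: its chart image lies in [O] minus [V'] and contains [U] minus
    [V']. Cocycles are pulled back to it, and primitives are carried from it. The hole [V'] is left
    adjustable so that it can avoid given closed sets. *)
Lemma punctured_H1_dim1 p O : open O -> O p ->
  exists U : set S, [/\ open U, U p, U `<=` O &
  forall V, nbhs p V -> exists V' : set S, [/\ open V', V' p, V' `<=` V &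
  forall w1 w2, cocycle (O `\` V') w1 -> cocycle (O `\` V') w2 ->
  exists f, [\/ primitive (U `\` V') w1 f, primitive (U `\` V') w2 f
   | primitive (U `\` V') (addc w1 w2) f]]].
Proof.
move=> oO Op; have [U [h [g C]]] := chart_exists oO Op.
have [oU1 U1p U1g] := chart_nbhs C ltr01 (ler1n _ 2).
exists (U `&` h @^-1` obox 1); split => //; first by move=> x [/(chart_sub C)].
move=> V pV.
have g0 : g 0 = p by rewrite -(chart0 C) (chartK C) //; exact: chart_mem C.
have o20 : obox 2 (0 : P) by split => /=; rewrite normr0.
have [B B0 BV] : exists2 B, nbhs (0 : P) B & forall y, B y -> obox 2 y -> V (g y).
  by apply: (chart_inv_cts C) => //; rewrite g0.
have [e /andP[e0 e1] eB] := box_nbhs0 B0.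
have e2 : e <= 2 by rewrite (le_trans e1) // ler1n.
have [oVe Vep Veg] := chart_nbhs C e0 e2.
exists (U `&` h @^-1` obox e); split => //.
  move=> x [Ux hx]; rewrite -(chartK C Ux); apply: BV; [exact: eB|exact: obox_sub hx].
have e01 : 0 < e <= 1 by rewrite e0.
have box2 y : box (-1) 1 (-1) 1 y -> (obox 2 : set P) y.
  by case=> *; split; rewrite ltr_norml; apply/andP; split; lra.
have ann2 y : annulus e y -> obox 2 y by move=> /(annulusP _ e01)[/box2].
have gann y : annulus e y -> (O `\` (U `&` h @^-1` obox e)) (g y).
  move=> ay; have y2 := ann2 _ ay; split.
    by apply: (chart_sub C); exact: (chart_inv_in C).
  by case=> _ /=; rewrite (chartVK C) //; case/(annulusP _ e01): ay.
have hann x : (U `&` h @^-1` obox 1 `\` (U `&` h @^-1` obox e)) x -> annulus e (h x).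
  move=> [[Ux [h1 h2]] nx]; apply/(annulusP _ e01); split; last by move=> hx; apply: nx.
  by move: h1 h2; rewrite !ltr_norml => /andP[? ?] /andP[? ?]; split; lra.
have gc : cts_on (annulus e) g by apply: cts_on_sub (chart_inv_cts C) => y /ann2.
move=> w1 w2 c1 c2.
have [f pf] := annulus_dim1 e01 (cocycle_comp gc gann c1) (cocycle_comp gc gann c2).
exists (f \o h).
have hc : cts_on (U `&` h @^-1` obox 1 `\` (U `&` h @^-1` obox e)) h.
  by apply: cts_on_sub (chart_cts C) => x [[]].
have key w : primitive (annulus e) (fun x y => w (g x) (g y)) f ->
   primitive (U `&` h @^-1` obox 1 `\` (U `&` h @^-1` obox e)) w (f \o h).
  move=> pw; apply: primitive_ext (primitive_comp hc hann pw).
  by move=> x y [[Ux _] _] [[Uy _] _]; rewrite !(chartK C).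
by case: pf => pf; [constructor 1|constructor 2|constructor 3]; exact: key.
Qed.

(** The class is [winding] in a chart. It remains nonzero on arbitrarily small punctured
    neighbourhoods because [winding] is unchanged by scaling, so a small annulus is as good as a
    large one. *)
Lemma punctured_H1_nonzero p O : open O -> O p ->
  exists (U0 : set S) w, [/\ open U0, U0 p, U0 `<=` O, cocycle (U0 `\` [set p]) w &
  forall U, nbhs p U -> exists V, [/\ open V, V p &
   forall f, ~ primitive (U0 `&` U `\` V) w f]].
Proof.
move=> oO Op; have [U0 [h [g C]]] := chart_exists oO Op.
exists U0, (fun x y => winding (h x) (h y)); split.
- exact: chart_open C.
- exact: chart_mem C.
- exact: chart_sub C.
- apply: (cocycle_comp _ _ (@winding_cocycle R)).
    by apply: cts_on_sub (chart_cts C) => x [].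
  move=> x [Ux /= xp] hx; apply: xp.
  by rewrite -(chartK C Ux) hx -(chart0 C) (chartK C) //; exact: chart_mem C.
move=> U pU.
have g0 : g 0 = p by rewrite -(chart0 C) (chartK C) //; exact: chart_mem C.
have o20 : obox 2 (0 : P) by split => /=; rewrite normr0.
have [B B0 BU] : exists2 B, nbhs (0 : P) B & forall y, B y -> obox 2 y -> U (g y).
  by apply: (chart_inv_cts C) => //; rewrite g0.
have [e /andP[e0 e1] eB] := box_nbhs0 B0.
(* The annulus with inner radius one half, scaled by [d], lies inside [obox e] and outside
   [obox (d / 2)]. *)
have [d dE] : exists d, d = e / 2 by exists (e / 2).
have d0 : 0 < d by rewrite dE divr_gt0.
have d2 : d / 2 <= 2 by rewrite dE; lra.
have dd0 : 0 < d / 2 by rewrite divr_gt0.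
have [oV Vp Vg] := chart_nbhs C dd0 d2.
exists (U0 `&` h @^-1` obox (d / 2)); split => // f pf.
have e01 : 0 < (2^-1 : R) <= 1 by lra.
have sc y : annulus 2^-1 y -> obox e (scale d y) /\ ~ obox (d / 2) (scale d y).
  move=> /(annulusP _ e01)[[? ? ? ?] ny]; split.
    by rewrite dE; split; rewrite /= ltr_norml; apply/andP; split; nra.
  move=> [/= n1 n2]; apply: ny; move: n1 n2; rewrite !normrM !(gtr0_norm d0).
  by rewrite !ltr_pM2l.
have e2 : e <= 2 by rewrite (le_trans e1) // ler1n.
have gs y : annulus 2^-1 y -> (U0 `&` U `\` (U0 `&` h @^-1` obox (d / 2))) (g (scale d y)).
  move=> /sc[s1 s2]; have s3 := obox_sub e2 s1; split.
    by split; [exact: (chart_inv_in C)|apply: BU => //; exact: eB].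
  by case=> _ /=; rewrite (chartVK C).
have gc : cts_on (annulus 2^-1) (g \o scale d).
  apply: (cts_on_comp (B := obox 2)) (chart_inv_cts C) _.
    by apply: continuous_cts_on; exact: scale_continuous.
  by move=> y /sc[/(obox_sub e2)].
apply: (@winding_not_exact R 2^-1 (f \o (g \o scale d)) e01).
apply: primitive_ext (primitive_comp gc gs pf).
move=> x y /sc[/(obox_sub e2) x2 _] /sc[/(obox_sub e2) y2 _].
by rewrite /= !(chartVK C) // /winding /= !pmulr_rge0 // pmulr_rgt0.
Qed.
End Charts.

(** * Chords and caps of the closed disk *)

Section Disk.
Variable R : realType.
Notation P := (R * R)%type.

Definition dot (x q : P) : R := x.1 * q.1 + x.2 * q.2.

(** Strict convexity: the squared norm of the mixture is the mixture of the squared norms minus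
    [t * (1 - t)] times the squared distance of [a] and [b]. *)
Lemma chord_open (a b : P) t : unit_circle R a -> unit_circle R b -> a <> b -> 0 < t < 1 ->
  open_disk R (seg a b t).
Proof.
rewrite /unit_circle /open_disk /seg /=; case: a => a1 a2; case: b => b1 b2 /=.
move=> ha hb ab /andP[t0 t1].
have : 0 < (a1 - b1) ^+ 2 + (a2 - b2) ^+ 2.
  rewrite lt_neqAle addr_ge0 ?sqr_ge0 // andbT eq_sym; apply/eqP => /eqP.
  rewrite paddr_eq0 ?sqr_ge0 // !sqrf_eq0 !subr_eq0 => /andP[/eqP h1 /eqP h2].
  by apply: ab; rewrite h1 h2.
set d := (X in 0 < X) => d0.
suff -> : ((1 - t) * a1 + t * b1) ^+ 2 + ((1 - t) * a2 + t * b2) ^+ 2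
  = (1 - t) * (a1 ^+ 2 + a2 ^+ 2) + t * (b1 ^+ 2 + b2 ^+ 2) - t * (1 - t) * d.
  rewrite ha hb !mulr1 subrK ltrBlDr ltrDl; apply: mulr_gt0 => //.
  by apply: mulr_gt0 => //; rewrite subr_gt0.
by rewrite /d; ring.
Qed.

Lemma cvx_closed_disk : cvx (closed_disk R).
Proof.
move=> [a1 a2] [b1 b2] t /andP[t0 t1]; rewrite /closed_disk /seg /= => ha hb.
have -> : ((1 - t) * a1 + t * b1) ^+ 2 + ((1 - t) * a2 + t * b2) ^+ 2
  = (1 - t) * (a1 ^+ 2 + a2 ^+ 2) + t * (b1 ^+ 2 + b2 ^+ 2)
    - t * (1 - t) * ((a1 - b1) ^+ 2 + (a2 - b2) ^+ 2) by ring.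
have h1 : 0 <= t * (1 - t) * ((a1 - b1) ^+ 2 + (a2 - b2) ^+ 2).
  by apply: mulr_ge0; [apply: mulr_ge0 => //; rewrite subr_ge0|rewrite addr_ge0 ?sqr_ge0].
have h2 : (1 - t) * (a1 ^+ 2 + a2 ^+ 2) <= (1 - t) * 1 by apply: ler_wpM2l => //; rewrite subr_ge0.
have h3 : t * (b1 ^+ 2 + b2 ^+ 2) <= t * 1 by apply: ler_wpM2l.
by lra.
Qed.

(** For a unit vector [q] and [x] in the disk, the squared distance is at most [2 * (1 - dot x q)],
    whence the choice of half of [d ^+ 2]. *)
Lemma cap_small (q : P) (d : R) : unit_circle R q -> 0 < d -> exists2 k, 0 < k &
  forall x, closed_disk R x -> 1 - k <= dot x q -> `|x.1 - q.1| <= d /\ `|x.2 - q.2| <= d.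
Proof.
rewrite /unit_circle /closed_disk /dot /=; case: q => q1 q2 /= hq d0.
exists (d ^+ 2 / 2); first by rewrite divr_gt0 // exprn_gt0.
case=> x1 x2 /= hx hd.
have h : (x1 - q1) ^+ 2 + (x2 - q2) ^+ 2 <= d ^+ 2.
  have -> : (x1 - q1) ^+ 2 + (x2 - q2) ^+ 2 =
    (x1 ^+ 2 + x2 ^+ 2) + (q1 ^+ 2 + q2 ^+ 2) - 2 * (x1 * q1 + x2 * q2) by ring.
  by lra.
have key (u v : R) : u ^+ 2 + v ^+ 2 <= d ^+ 2 -> `|u| <= d.
  move=> uv; rewrite -(@ler_pXn2r _ 2) ?nnegrE ?normr_ge0 ?(ltW d0) //.
  by rewrite real_normK ?num_real //; apply: le_trans uv; rewrite lerDl sqr_ge0.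
by split; [exact: key h|apply: (key _ (x1 - q1)); rewrite addrC].
Qed.

(** The counterpart of an annulus around a boundary point of the disk: for positive [r] it avoids
    [q], yet it is convex and carries no cohomology. *)
Definition cap_strip (q : P) (k r : R) : set P :=
  closed_disk R `&` [set x | 1 - k <= dot x q <= 1 - r].

Lemma cap_strip_cvx q k r : cvx (cap_strip q k r).
Proof.
apply: cvxI; first exact: cvx_closed_disk.
move=> x y t /andP[t0 t1] /= /andP[? ?] /andP[? ?].
have -> : dot (seg x y t) q = (1 - t) * dot x q + t * dot y q by rewrite /dot /seg /=; ring.
by apply/andP; split; nra.
Qed.

Lemma cap_strip_closed q k r : closed (cap_strip q k r).
Proof.
have c1 : continuous (fun x : P => x.1 ^+ 2 + x.2 ^+ 2).
  move=> x; apply: cvgD; rewrite /= !expr2.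
    by apply: cvgM; exact: cvg_fst.
  by apply: cvgM; exact: cvg_snd.
have c2 : continuous (fun x : P => dot x q).
  move=> x; apply: cvgD; apply: cvgM; try exact: cvg_cst; [exact: cvg_fst|exact: cvg_snd].
have -> : cap_strip q k r = [set x | x.1 ^+ 2 + x.2 ^+ 2 <= 1] `&`
   ([set x | 1 - k <= dot x q] `&` [set x | dot x q <= 1 - r]).
  by apply/seteqP; split=> x; [case=> ? /andP[]|case=> ? [/= h1 h2]; split => //=; rewrite h1].
apply: closedI; first exact: (closed_coord 1 c1).1.
by apply: closedI; [exact: (closed_coord _ c2).2|exact: (closed_coord _ c2).1].
Qed.

Lemma closed_disk_box : closed_disk R `<=` box (-1) 1 (-1) 1.
Proof.
move=> x; rewrite /closed_disk /= => hx.
have key (u v : R) : u ^+ 2 + v ^+ 2 <= 1 -> -1 <= u <= 1.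
  move=> uv; rewrite -ler_norml -(@ler_pXn2r _ 2) ?nnegrE ?normr_ge0 //.
  by rewrite real_normK ?num_real // expr1n; apply: le_trans uv; rewrite lerDl sqr_ge0.
have /andP[? ?] := key _ _ hx; have /andP[? ?] : -1 <= x.2 <= 1 by apply: (key _ x.1); rewrite addrC.
by split.
Qed.

Lemma cap_strip_exact q k r w : cocycle (cap_strip q k r) w ->
  exists f, primitive (cap_strip q k r) w f.
Proof.
apply: (@cvx_exact R _ w (-1) 1 (-1) 1); try lra.
- exact: cap_strip_closed.
- exact: cap_strip_cvx.
- by move=> x [/closed_disk_box].
Qed.
End Disk.

(** * Faces of a polyhedral embedding *)

Section Faces.
Variables (R : realType) (S : topologicalType).
Hypothesis hS : closed_surface R S.
Variables (V : finType) (e : rel V).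
Hypothesis he : simple_graph e.
Variables (pt : V -> S) (arc : V -> V -> set S).
Hypothesis hemb : embedding R e pt arc.
Notation P := (R * R)%type.
Notation I01 := [set t : R | 0 <= t <= 1].
Notation draw := (drawing e pt arc).
Notation fc := (face e pt arc).
Variable cyc : set S -> seq V.
Hypothesis hcyc : forall F, fc F -> is_cycle e (cyc F) /\ open_disk_bounded_by R arc F (cyc F).
Hypothesis hmeet : forall F1 F2, fc F1 -> fc F2 -> F1 <> F2 ->
  meet_properly e pt arc (frontier F1) (frontier F2).

Let haus : hausdorff_space S. Proof. by case: hS => -[]. Qed.
Let mS : manifold2 R S. Proof. by case: hS. Qed.

Lemma homeoE (X Y : topologicalType) (A : set X) (B : set Y) (f : X -> Y) :
  homeomorphism A B f -> exists g : Y -> X, [/\ cts_on A f, cts_on B g,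
    (forall x, A x -> B (f x)), (forall y, B y -> A (g y)) &
    (forall x, A x -> g (f x) = x) /\ (forall y, B y -> f (g y) = y)].
Proof.
case=> -[fAB _ fsurj] /cts_onP cf [g /cts_onP cg gf].
have gK x : A x -> g (f x) = x by move=> Ux; apply: gf; exact/mem_set.
exists g; split => //; first by move=> y /fsurj[x Ax <-]; rewrite gK.
by split => // y /fsurj[x Ax <-]; rewrite gK.
Qed.

Lemma cycle_edge c x : is_cycle e c -> x \in c -> e x (next c x).
Proof. by case=> /andP[cc _] _; exact: next_cycle. Qed.

Lemma consecutive_is_edge c x y : is_cycle e c -> consecutive c x y -> e x y.
Proof.
move=> cc /and3P[xc yc /orP[/eqP <-|/eqP <-]]; first exact: cycle_edge.
by case: he => es _; rewrite es; exact: cycle_edge.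
Qed.

Lemma arcE x y : e x y -> exists (f : R -> S) (g : S -> R), [/\ cts_on I01 f, cts_on (arc x y) g,
   (forall t, I01 t -> arc x y (f t)), (forall p, arc x y p -> I01 (g p)) &
   [/\ (forall t, I01 t -> g (f t) = t), (forall p, arc x y p -> f (g p) = p),
     f 0 = pt x & f 1 = pt y]].
Proof.
case: hemb => _ /(_ x y) h _ _ /h[[f []]]; rewrite set_itvcc.
by move=> /homeoE[g [? ? ? ? []]] ? ? ? ? _; exists f, g.
Qed.

Lemma arcC x y : e x y -> arc x y = arc y x.
Proof. by case: hemb => _ /(_ x y) h _ _ /h[]. Qed.

Lemma arc_ends x y : e x y -> arc x y (pt x) /\ arc x y (pt y).
Proof.
move=> /arcE[f [g [_ _ fa _ [_ _ <- <-]]]].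
by split; apply: fa; rewrite /= lexx ler01.
Qed.

Lemma arc_pt x y v : e x y -> arc x y (pt v) -> v = x \/ v = y.
Proof. by case: hemb => _ _ h _; exact: h. Qed.

Lemma pt_inj : injective pt. Proof. by case: hemb. Qed.

(** Such a point serves as a probe: it lies on no other edge, so membership in a cycle or in the
    closure of a face tells whether the edge [xy] belongs to it. *)
Lemma arc_interior x y : e x y -> exists2 q, arc x y q & forall v, q <> pt v.
Proof.
move=> exy; have [f [g [_ _ fa ga [gf fg f0 f1]]]] := arcE exy.
have h01 : I01 (2^-1 : R) by rewrite /=; lra.
have h0 : I01 (0 : R) by rewrite /=; lra.
have h1 : I01 (1 : R) by rewrite /=; lra.
exists (f 2^-1) => [|v fv]; first exact: fa.
have [] := @arc_pt x y v exy; first by rewrite -fv; exact: fa.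
  by move=> vx; have := gf _ h01; rewrite fv vx -f0 gf //; lra.
by move=> vx; have := gf _ h01; rewrite fv vx -f1 gf //; lra.
Qed.

Lemma arc_unique x y u v q : e x y -> e u v -> arc x y q -> arc u v q ->
  (forall w, q <> pt w) -> (u = x /\ v = y) \/ (u = y /\ v = x).
Proof.
move=> exy euv qxy quv nv; have [E|ne] := eqVneq [set x; y]%SET [set u; v]%SET.
  have := set21 u v; have := set22 u v; rewrite -E !in_set2.
  have irr : u <> v by move=> uv; case: he => _ /(_ u); rewrite {2}uv euv.
  by move=> /orP[]/eqP ev /orP[]/eqP eu; subst u v; auto; case: irr.
case: hemb => _ _ _ /(_ x y u v exy euv ne) /(_ q) []; first by [].
by move=> w _ wq; case: (nv w).
Qed.

Lemma cycle_drawing_pt c v : is_cycle e c -> cycle_drawing arc c (pt v) <-> v \in c.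
Proof.
move=> cc; split=> [[x /= xc]|vc].
  by move=> av; have [->|->] := arc_pt (cycle_edge cc xc) av; rewrite ?mem_next.
by exists v => //; case: (arc_ends (cycle_edge cc vc)).
Qed.

Lemma cycle_drawing_arc c x y q : is_cycle e c -> e x y -> arc x y q ->
  (forall w, q <> pt w) -> cycle_drawing arc c q <-> consecutive c x y.
Proof.
move=> cc exy aq nq; split=> [[u /= uc uq]|].
  have [[ux nu]|[ux nu]] := arc_unique exy (cycle_edge cc uc) aq uq nq.
    by rewrite /consecutive -{1}ux uc -nu mem_next uc -ux eqxx.
  by rewrite consecutiveC /consecutive -{1}ux uc -nu mem_next uc -ux eqxx.
move=> /and3P[xc yc /orP[]/eqP nx]; first by exists x => //; rewrite nx.
by exists y => //; rewrite nx -arcC.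
Qed.

Lemma consecutive_arc c x y : is_cycle e c -> consecutive c x y -> arc x y `<=` cycle_drawing arc c.
Proof.
move=> cc axy q aq; have exy := consecutive_is_edge cc axy.
move: axy => /and3P[xc yc /orP[]/eqP nx]; first by exists x => //; rewrite nx.
by exists y => //; rewrite nx -arcC.
Qed.

Lemma face_disk F : fc F -> exists f g, [/\ cts_on (closed_disk R) f, cts_on (closure F) g,
   (forall x, closed_disk R x -> closure F (f x)), (forall p, closure F p -> closed_disk R (g p)) &
   [/\ (forall x, closed_disk R x -> g (f x) = x), (forall p, closure F p -> f (g p) = p),
     (forall x, open_disk R x -> F (f x)) & (forall p, frontier F p -> unit_circle R (g p))]].
Proof.
move=> /hcyc[_ [_ [f [/homeoE[g [cf cg fF gF [gf fg]]] fo fu]]]].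
exists f, g; split => //; split => //; first by move=> x ox; rewrite -fo; exists x.
move=> p; rewrite -fu => -[x xu <-]; rewrite gf //.
by move: xu; rewrite /unit_circle /closed_disk /= => ->.
Qed.

Lemma frontier_face F : fc F -> frontier F = cycle_drawing arc (cyc F).
Proof. by move=> /hcyc[_ []]. Qed.

(** A point of [F] outside the interior would be a frontier point, hence the image of both an open
    disk point and a circle point, against injectivity of the disk map. *)
Lemma face_interior F : fc F -> F `<=` interior F.
Proof.
move=> fF; have [_ [_ [f [/homeoE[g [cf cg fF' gF [gf fg]]] fo fu]]]] := hcyc fF.
move=> p Fp; apply: contrapT => np.
have : frontier F p by split => //; exact: subset_closure.
move: Fp; rewrite -fu -{1}fo => -[x xo <-] [y yu fyx].
have xc : closed_disk R x by move: xo; rewrite /open_disk /closed_disk /= => /ltW.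
have yc : closed_disk R y by move: yu; rewrite /unit_circle /closed_disk /= => ->.
have yx : y = x by rewrite -(gf y yc) fyx gf.
by move: xo yu; rewrite /open_disk /unit_circle yx /= => /[swap] ->; rewrite ltxx.
Qed.

Lemma face_open F : fc F -> open F.
Proof. by move=> fF; rewrite openE; exact: face_interior. Qed.

Lemma closure_face F p : fc F -> closure F p -> F p \/ frontier F p.
Proof.
move=> fF cp; have [Fp|nFp] := pselect (F p); first by left.
by right; split => // /interior_subset.
Qed.

Lemma face_not_draw F p : fc F -> F p -> ~ draw p.
Proof. by case=> q _ -> /connected_component_sub. Qed.

Lemma frontier_draw F p : fc F -> frontier F p -> draw p.
Proof.
move=> fF; rewrite frontier_face // => -[x xc ap]; right; exists x, (next (cyc F) x).
by split => //; apply: cycle_edge => //; case: (hcyc fF).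
Qed.

Lemma face_disjoint F G p : fc F -> fc G -> F p -> G p -> F = G.
Proof. by case=> q _ -> [r _ ->] /same_connected_component -> /same_connected_component ->. Qed.

Lemma closure_disjoint F G p : fc F -> fc G -> F <> G -> closure F p -> G p -> False.
Proof.
move=> fF fG FG cp Gp; have [] := cp G; first exact: open_nbhs_nbhs (conj (face_open fG) Gp).
by move=> q [Fq Gq]; apply: FG; exact: face_disjoint Fq Gq.
Qed.

Lemma closureI_frontier F G p : fc F -> fc G -> F <> G -> closure F p -> closure G p ->
  frontier F p /\ frontier G p.
Proof.
move=> fF fG FG cF cG; split.
  by have [Fp|//] := closure_face fF cF; case: (closure_disjoint fG fF (not_eq_sym FG) cG Fp).
by have [Gp|//] := closure_face fG cG; case: (closure_disjoint fF fG FG cF Gp).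
Qed.

Lemma closure_pt F v : fc F -> closure F (pt v) <-> v \in cyc F.
Proof.
move=> fF; have [cc _] := hcyc fF; rewrite -cycle_drawing_pt // -frontier_face //; split=> [|[]//].
move=> /(closure_face fF)[Fv|//]; case: (face_not_draw fF Fv); left; exact: imageT.
Qed.

Lemma closure_arc F x y q : fc F -> e x y -> arc x y q -> (forall w, q <> pt w) ->
  closure F q <-> consecutive (cyc F) x y.
Proof.
move=> fF exy aq nq; have [cc _] := hcyc fF.
rewrite -(cycle_drawing_arc cc exy aq nq) -frontier_face //; split=> [|[]//].
move=> /(closure_face fF)[Fv|//]; case: (face_not_draw fF Fv); right; by exists x, y.
Qed.

(** Two common vertices leave only the case of a common edge. Its ends must be [u] and [v], and an
    interior point shows that both cycles traverse it. *)
Lemma faces_share F G u v : fc F -> fc G -> F <> G -> u <> v ->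
  u \in cyc F -> u \in cyc G -> v \in cyc F -> v \in cyc G ->
  [/\ consecutive (cyc F) u v, consecutive (cyc G) u v &
    forall w, w \in cyc F -> w \in cyc G -> w = u \/ w = v].
Proof.
move=> fF fG FG uv uF uG vF vG.
have [cF _] := hcyc fF; have [cG _] := hcyc fG.
have com w : w \in cyc F -> w \in cyc G -> (frontier F `&` frontier G) (pt w).
  by move=> wF wG; rewrite !frontier_face //; split; exact/cycle_drawing_pt.
case: (hmeet fF fG FG) => [E|[w E]|[x [y [exy E]]]].
- by have := com u uF uG; rewrite E.
- have := com u uF uG; have := com v vF vG; rewrite E => /= /pt_inj vw /pt_inj uw.
  by case: uv; rewrite uw vw.
have hw w : w \in cyc F -> w \in cyc G -> w = x \/ w = y.
  by move=> wF wG; have := com w wF wG; rewrite E => /(arc_pt exy).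
have [q aq nq] := arc_interior exy.
have [qF qG] : (frontier F `&` frontier G) q by rewrite E.
rewrite frontier_face // in qF; rewrite frontier_face // in qG.
have aF := (cycle_drawing_arc cF exy aq nq).1 qF.
have aG := (cycle_drawing_arc cG exy aq nq).1 qG.
have [ux|uy] := hw u uF uG; have [vx|vy] := hw v vF vG; subst.
- by [].
- by [].
- by split; rewrite 1?consecutiveC // => w wF wG; case: (hw w wF wG); auto.
- by [].
Qed.

Lemma three_in_cycle c : is_cycle e c -> exists x y z,
  [/\ x \in c, y \in c, z \in c & [/\ x <> y, y <> z & x <> z]].
Proof.
case=> /andP[_ uc]; case: c uc => [|x [|y [|z c]]] //= uc _; exists x, y, z.
rewrite !inE !eqxx !orbT; split => //.
by move: uc; rewrite !inE !negb_or => /and4P[/and3P[/eqP ? /eqP ? _] /andP[/eqP ? _] _ _].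
Qed.

(** Distinct faces share at most two vertices while a cycle has at least three, so a face is
    determined by its vertex set. Finiteness makes unions of closures of faces closed. *)
Lemma finite_faces : finite_set [set F | fc F].
Proof.
have inj F G : fc F -> fc G -> [set x in cyc F]%SET = [set x in cyc G]%SET -> F = G.
  move=> fF fG E; apply: contrapT => FG.
  have mem x : x \in cyc F -> x \in cyc G by have /setP/(_ x) := E; rewrite !inE => ->.
  have [cc _] := hcyc fF.
  have [x [y [z [xF yF zF [xy yz xz]]]]] := three_in_cycle cc.
  have [_ _ /(_ z zF (mem z zF))] := faces_share fF fG FG xy xF (mem x xF) yF (mem y yF).
  by case=> E'; [case: xz|case: yz].
pose k (A : {set V}) : set S := if pselect (exists F, fc F /\ [set x in cyc F]%SET = A)
  is left h then sval (cid h) else set0.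
apply: (@sub_finite_set _ _ [set k A | A in [set: {set V}]]); last first.
  by apply: finite_image; exact: finite_finset.
move=> F /= fF; exists [set x in cyc F]%SET => //; rewrite /k.
case: pselect => [h|[]]; last by exists F.
by case: cid => G [fG /= E]; apply: inj.
Qed.

Definition closures (Q : set S -> Prop) : set S := [set p | exists F, [/\ fc F, Q F & closure F p]].

Lemma closed_closures Q : closed (closures Q).
Proof.
have -> : closures Q = \bigcup_(F in [set F | fc F] `&` Q) closure F.
  by apply/seteqP; split=> p; [case=> F [? ? ?]; exists F|case=> F [? ?] ?; exists F].
apply: closed_bigcup; first by apply: sub_finite_set finite_faces => F [].
by move=> F _; exact: closed_closure.
Qed.

Lemma near_faces p : exists O, [/\ open O, O p &
  forall F x, fc F -> O x -> closure F x -> closure F p].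
Proof.
exists (~` closures (fun F => ~ closure F p)); split.
- exact/closed_openC/closed_closures.
- by case=> F [].
- by move=> F x fF Ox Fx; apply: contrapT => np; apply: Ox; exists F.
Qed.

Lemma closed_arc x y : e x y -> closed (arc x y).
Proof.
move=> exy; have [f [g [cf _ fa ga [_ fg _ _]]]] := arcE exy.
have -> : arc x y = f @` I01.
  by apply/seteqP; split=> [p ap|_ [t ht <-]]; [exists (g p); auto|exact: fa].
apply: compact_closed => //; apply: continuous_compact; first exact/cts_onP.
by rewrite -set_itvcc; exact: segment_compact.
Qed.

Lemma closed_vertices : closed (range pt).
Proof.
apply: (accessible_finite_set_closed.1 (hausdorff_accessible haus)).
by apply: finite_image; exact: finite_finset.
Qed.

Lemma edge_nbhs x y q : e x y -> arc x y q -> (forall v, q <> pt v) ->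
  exists O, [/\ open O, O q & forall p, O p -> (forall v, p <> pt v) /\ (draw p -> arc x y p)].
Proof.
move=> exy aq nq.
pose D := [set uv : V * V | e uv.1 uv.2 && ([set x; y] != [set uv.1; uv.2])%SET].
pose others := \bigcup_(uv in D) arc uv.1 uv.2.
have co : closed others.
  apply: closed_bigcup; first exact: finite_finset.
  by move=> [u v] /= /andP[euv _]; exact: closed_arc.
exists (~` (range pt `|` others)); split.
- by apply: closed_openC; apply: closedU => //; exact: closed_vertices.
- case=> [[v _ vq]|[[u v]]]; first by case: (nq v).
  rewrite /D /= => /andP[euv ne] quv.
  by case: (arc_unique exy euv aq quv nq) ne => -[-> ->]; rewrite ?eqxx // finset.setUC eqxx.
move=> p np; split=> [v pv|]; first by apply: np; left; exists v.
case=> [rp|[u [v [euv ap]]]]; first by case: np; left.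
have [E|ne] := eqVneq [set x; y]%SET [set u; v]%SET; last first.
  by case: np; right; exists (u, v) => //; rewrite /D /= euv.
have := set21 u v; have := set22 u v; rewrite -E !in_set2.
have irr : u <> v by move=> uv; case: he => _ /(_ u); rewrite {2}uv euv.
move=> /orP[]/eqP ev /orP[]/eqP eu; subst u v => //; first by rewrite arcC.
Qed.

Lemma open_avoid (O : set S) (s : seq S) p : open O -> O p -> exists2 q, O q & q \notin s.
Proof.
elim: s O p => [|a s IH] O p oO Op; first by exists p.
have [r [ Or ra]] : exists r, O r /\ r <> a.
  have [U [h [g C]]] := chart_exists mS oO Op.
  have o0 : obox 2 (0 : P) by split => /=; rewrite normr0.
  have o1 : obox 2 ((1, 1) : P) by split => /=; rewrite normr1 ltr1n.
  have [ga|ga] := pselect (g 0 = a); last first.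
    by exists (g 0); split => //; apply/(chart_sub C)/(chart_inv_in C).
  exists (g (1, 1)); split; first by apply/(chart_sub C)/(chart_inv_in C).
  rewrite -ga => E; have := chartVK C o1; rewrite E (chartVK C) // => -[] /eqP.
  by rewrite eq_sym oner_eq0.
have oO' : open (O `&` ~` [set a]).
  apply: openI => //; apply: closed_openC.
  exact: (accessible_closed_set1 (hausdorff_accessible haus)).
have [|q [ Oq qa] qs] := IH _ r oO' _; first by [].
by exists q => //; rewrite inE negb_or qs andbT; apply/eqP.
Qed.

(* Otherwise some open set lies inside an edge, but removing an interior point
   disconnects an arc and not a disk. *)
Lemma faces_cover p : exists2 F, fc F & closure F p.
Proof.
apply: contrapT => np.
(* An open set near [p] meeting no closure of a face; each of its points must lie on the drawing,
   for otherwise its component would be a face. *)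
pose O := ~` closures (fun=> True).
have oO : open O by exact/closed_openC/closed_closures.
have Op : O p by case=> F [fF _ cF]; apply: np; exists F.
have Odraw r : O r -> draw r.
  move=> Or; apply: contrapT => nr; apply: Or; exists (connected_component (~` draw) r).
  by split => //; [exists r|apply: subset_closure; exact: connected_component_refl].
have [q Oq qs] := open_avoid [seq pt v | v <- enum V] oO Op.
have nq v : q <> pt v by move=> qv; move/negP: qs; apply; rewrite qv map_f // mem_enum.
have [[v _ vq]|[x [y [exy aq]]]] := Odraw q Oq; first by case: (nq v).
have [ O1 [oO1 O1q hO1]] := edge_nbhs exy aq nq.
have [U [oU Uq UO cU]] := punctured_nbhs_connected mS (openI oO oO1) (conj Oq O1q).
have Ua r : U r -> arc x y r by move=> /UO[ Or /hO1[_]]; apply; exact: Odraw.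
have [f [g [cf cg fa ga [gf fg f0 f1]]]] := arcE exy.
have /andP[t0 t1] := ga q aq.
have g0 : 0 < g q.
  by rewrite lt_neqAle t0 andbT eq_sym; apply/eqP => E; apply: (nq x); rewrite -f0 -E fg.
have g1 : g q < 1.
  by rewrite lt_neqAle t1 andbT; apply/eqP => E; apply: (nq y); rewrite -f1 -E fg.
have [W qW WU] : exists2 W, nbhs (g q) W & forall t, W t -> I01 t -> U (f t).
  by apply: cf; [exact: ga|rewrite fg //; exact: open_nbhs_nbhs].
have [d /= d0 dW] := (nbhs_ballP _ _).1 qW.
pose m := Num.min d (Num.min (g q) (1 - g q)) / 2.
have [m0 m1 m2 m3] : [/\ 0 < m, m < d, m < g q & m < 1 - g q].
  have h : 0 < Num.min d (Num.min (g q) (1 - g q)) by rewrite !lt_min d0 g0 subr_gt0.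
  have [] : [/\ Num.min d (Num.min (g q) (1 - g q)) <= d,
      Num.min d (Num.min (g q) (1 - g q)) <= g q &
      Num.min d (Num.min (g q) (1 - g q)) <= 1 - g q].
    by split; rewrite !ge_min lexx ?orbT.
  by rewrite /m; move: h; move: (Num.min d _) => z *; split; lra.
clearbody m.
have inU t : `|t - g q| = m -> (U `\` [set q]) (f t).
  move=> tm; have [t1' t2'] : g q - m <= t /\ t <= g q + m.
    by have := lexx `|t - g q|; rewrite {2}tm ler_norml => /andP[? ?]; split; lra.
  have t01 : I01 t by rewrite /=; lra.
  split; first by apply: WU => //; apply: dW; rewrite /ball /= distrC tm.
  move=> /= ftq; move: tm; rewrite -ftq gf // subrr normr0; lra.
have [i1 i2] : (U `\` [set q]) (f (g q - m)) /\ (U `\` [set q]) (f (g q + m)).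
  by split; apply: inU; rewrite addrAC subrr add0r ?normrN gtr0_norm.
(* On the part of [U] other than [q], which lies on the arc, being before [q] is locally constant,
   but it differs at the parameters [g q - m] and [g q + m]. *)
have prim : primitive (U `\` [set q]) (@zeroc S) (fun r => g r < g q).
  move=> r [Ur rq].
  have gr : g r != g q by apply/eqP => E; apply: rq; rewrite /= -(fg r) ?E ?fg //; exact: Ua.
  have [B rB BU] : exists2 B, nbhs r B & forall s, B s -> arc x y s -> `|g s - g r| < `|g r - g q|.
    apply: (cg r (Ua _ Ur) [set t | `|t - g r| < `|g r - g q|]).
    apply/nbhs_ballP; exists `|g r - g q|; first by rewrite /= normr_gt0 subr_eq0.
    by move=> t; rewrite /ball /= distrC.
  exists B => // s s' Bs [/Ua Us _] Bs' [/Ua Us' _].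
  have same u : B u -> arc x y u -> (g u < g q) = (g r < g q).
    move=> Bu au; have := BU u Bu au; rewrite ltr_norml => /andP[h1 h2].
    move: h1 h2; have [h|h|h] := ltgtP (g r) (g q).
    - by rewrite (ltr0_norm (x := g r - g q)) ?subr_lt0 // => *; lra.
    - by rewrite (gtr0_norm (x := g r - g q)) ?subr_gt0 // => *; apply/negP; lra.
    - by move/eqP: gr.
  by rewrite !same // addbb.
have := connected_constant cU prim i1 i2; by rewrite /= !gf /=; lra.
Qed.

Lemma vertex_face v : exists2 F, fc F & v \in cyc F.
Proof. by have [F fF cF] := faces_cover (pt v); exists F => //; apply/closure_pt. Qed.

(* Otherwise the closures of the faces at z in Q and of those not in Q separate
   a punctured neighbourhood of z. *)
Lemma link_connected z (Q : set S -> Prop) F G : fc F -> fc G -> z \in cyc F -> z \in cyc G ->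
  Q F -> ~ Q G -> exists F' G' w, [/\ fc F', fc G', Q F', ~ Q G' &
    consecutive (cyc F') z w /\ consecutive (cyc G') z w].
Proof.
move=> fF fG zF zG QF QG; apply: contrapT => none.
have [ O [oO Oz hO]] := near_faces (pt z).
have [U [oU Uz UO cU]] := punctured_nbhs_connected mS oO Oz.
(* Both faces have [z] on their boundary by the choice of [O]. If they met in an edge, [z] would be
   one of its ends, which [none] forbids; so they meet in [z] alone. *)
have sep F' G' p : fc F' -> fc G' -> Q F' -> ~ Q G' -> U p -> closure F' p -> closure G' p ->
    p = pt z.
  move=> fF' fG' QF' QG' Up cF' cG'.
  have FG' : F' <> G' by move=> E; apply: QG'; rewrite -E.
  have zF' := (closure_pt z fF').1 (hO _ _ fF' (UO _ Up) cF').
  have zG' := (closure_pt z fG').1 (hO _ _ fG' (UO _ Up) cG').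
  have Ip := closureI_frontier fF' fG' FG' cF' cG'.
  have Iz := closureI_frontier fF' fG' FG' ((closure_pt z fF').2 zF') ((closure_pt z fG').2 zG').
  case: (hmeet fF' fG' FG') => [E|[v E]|[x [y [exy E]]]].
  - by have : (frontier F' `&` frontier G') p by []; rewrite E.
  - have : (frontier F' `&` frontier G') p by []; rewrite E => /= ->.
    by have : (frontier F' `&` frontier G') (pt z) by []; rewrite E => /= ->.
  exfalso; have [ax ay] := arc_ends exy.
  have com w : arc x y (pt w) -> w \in cyc F' /\ w \in cyc G'.
    rewrite -E => -[wF wG]; have [c1 _] := hcyc fF'; have [c2 _] := hcyc fG'.
    by rewrite frontier_face // in wF; rewrite frontier_face // in wG; split; exact/cycle_drawing_pt.
  have xy : x <> y by move=> xy; case: he => _ /(_ x); rewrite {2}xy exy.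
  have [xF xG] := com _ ax; have [yF yG] := com _ ay.
  have [a1 a2 _] := faces_share fF' fG' FG' xy xF xG yF yG.
  have : arc x y (pt z) by rewrite -E.
  move=> /(arc_pt exy)[zx|zy]; subst z; apply: none.
    by exists F', G', y.
  by exists F', G', x; split => //; rewrite !(consecutiveC _ y).
have [p1 [p1F p1U]] := (closure_pt z fF).2 zF _ (open_nbhs_nbhs (conj oU Uz)).
have [p2 [p2G p2U]] := (closure_pt z fG).2 zG _ (open_nbhs_nbhs (conj oU Uz)).
have notz H p : fc H -> H p -> p <> pt z.
  by move=> fH Hp E; apply: (face_not_draw fH Hp); left; exists z.
have prim : primitive (U `\` [set pt z]) (@zeroc S) (fun r => `[< closures Q r >]).
  move=> r [Ur rz]; have rz' : r <> pt z by [].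
  have [cr|ncr] := pselect (closures Q r).
    exists (~` closures (fun H => ~ Q H)).
      apply: open_nbhs_nbhs; split; first exact/closed_openC/closed_closures.
      move=> [G' [fG' QG' cG']]; case: cr => F' [fF' QF' cF'].
      by apply: rz'; exact: sep cF' cG'.
    have all s : (~` closures (fun H => ~ Q H)) s -> `[< closures Q s >].
      move=> ns; apply/asboolP; have [H fH cH] := faces_cover s.
      by exists H; split => //; apply: contrapT => nQ; apply: ns; exists H.
    by move=> s s' /all -> _ /all -> _.
  exists (~` closures Q); first by apply: open_nbhs_nbhs; split => //; exact/closed_openC/closed_closures.
  by move=> s s' ns _ ns' _; rewrite /zeroc !asboolF.
have := connected_constant cU prim (conj p1U (notz F p1 fF p1F)) (conj p2U (notz G p2 fG p2G)).
rewrite asboolT; last by exists F; split => //; exact: subset_closure.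
rewrite asboolF // => -[F' [fF' QF' cF']].
apply: (notz G p2 fG p2G); apply: (sep F' G) => //; exact: subset_closure.
Qed.

(** [X] holds on all or none of the vertices of a facial cycle. Closures of faces of the two kinds
    are disjoint, since any common point would give a common vertex, and together they cover the
    connected surface. *)
Lemma graph_connected (X : V -> Prop) x y : (forall u v, e u v -> X u -> X v) -> X x -> X y.
Proof.
move=> hX Xx; pose Q F := exists2 v, v \in cyc F & X v.
have Qall F : fc F -> Q F -> forall v, v \in cyc F -> X v.
  move=> fF [u uF Xu] v vF; have [cF _] := hcyc fF.
  apply: (cycle_connected cF _ uF vF Xu) => s t cst; apply: hX.
  exact: consecutive_is_edge cst.
have sep F G p : fc F -> fc G -> Q F -> ~ Q G -> closure F p -> closure G p -> False.
  move=> fF fG QF QG cF cG.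
  have FG : F <> G by move=> E; apply: QG; rewrite -E.
  have Ip := closureI_frontier fF fG FG cF cG.
  have com w : (frontier F `&` frontier G) (pt w) -> False.
    have [c1 _] := hcyc fF; have [c2 _] := hcyc fG.
    rewrite !frontier_face // => -[/(cycle_drawing_pt _ c1) wF /(cycle_drawing_pt _ c2) wG].
    by apply: QG; exists w => //; exact: Qall QF _ wF.
  case: (hmeet fF fG FG) => [E|[v E]|[a [b [eab E]]]].
  - by have : (frontier F `&` frontier G) p by []; rewrite E.
  - by apply: (com v); rewrite E.
  - by apply: (com a); rewrite E; case: (arc_ends eab).
have prim : primitive [set: S] (@zeroc S) (fun r => `[< closures Q r >]).
  move=> r _; have [cr|ncr] := pselect (closures Q r).
    exists (~` closures (fun H => ~ Q H)).
      apply: open_nbhs_nbhs; split; first exact/closed_openC/closed_closures.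
      by move=> [G' [fG' QG' cG']]; case: cr => F' [fF' QF' cF']; exact: sep cF' cG'.
    have all s : (~` closures (fun H => ~ Q H)) s -> `[< closures Q s >].
      move=> ns; apply/asboolP; have [H fH cH] := faces_cover s.
      by exists H; split => //; apply: contrapT => nQ; apply: ns; exists H.
    by move=> s s' /all -> _ /all -> _.
  exists (~` closures Q); first by apply: open_nbhs_nbhs; split => //; exact/closed_openC/closed_closures.
  by move=> s s' ns _ ns' _; rewrite /zeroc !asboolF.
have cS : connected [set: S] by case: hS.
have [F fF xF] := vertex_face x; have [G fG yG] := vertex_face y.
have := connected_constant cS prim (x := pt x) (y := pt y) I I.
rewrite asboolT; last by exists F; split => //; [exists x|apply/closure_pt].
move=> /esym/asboolP[H [fH QH cH]]; apply: (Qall H fH QH).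
exact/closure_pt.
Qed.

(* A neighbourhood of an interior point q of the edge would lie in the closed disk
   closure F, with q on the boundary circle; the winding class becomes exact on a
   convex strip cut off near q, hence on an annulus around q. *)
Lemma edge_not_one x y F : e x y -> fc F ->
  (forall G, fc G -> consecutive (cyc G) x y -> G = F) -> False.
Proof.
move=> exy fF uniF; have [q aq nq] := arc_interior exy.
have [ O [oO Oq hO]] := near_faces q.
have OF r : O r -> closure F r.
  move=> Or; have [G fG cG] := faces_cover r; suff <- : G = F by [].
  apply: uniF => //; apply/(closure_arc fG exy aq nq); exact: hO cG.
have cFq : closure F q by exact: OF.
have frq : frontier F q.
  by have [_ [_]] := hcyc fF; case: (closure_face fF cFq) => // Fq;
    case: (face_not_draw fF Fq); right; exists x, y.
have [f [g [cf cg fF' gF [gf fg _ gu]]]] := face_disk fF.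
have uq := gu _ frq; have dq : closed_disk R (g q) by exact: gF.
have [U0 [w [oU0 U0q U0O cw nw]]] := punctured_H1_nonzero mS oO Oq.
(* Caps around the boundary point [g q] are arbitrarily small, so some cap maps into [U]. *)
have capn (U : set S) : nbhs q U -> exists2 k, 0 < k &
    forall z, closed_disk R z -> 1 - k <= dot z (g q) -> U (f z).
  move=> qU; have [W /nbhs_boxP[d d0 dW] WU] : exists2 W, nbhs (g q) W &
      forall z, W z -> closed_disk R z -> U (f z).
    by apply: cf => //; rewrite fg.
  have [k k0 hk] := cap_small uq d0; exists k => // z dz kz.
  by apply: WU => //; have [? ?] := hk z dz kz; exact: dW.
have [k k0 hk] := capn U0 (open_nbhs_nbhs (conj oU0 U0q)).
have [U qU hU] : exists2 U, nbhs q U & forall r, U r -> closure F r -> 1 - k <= dot (g r) (g q).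
  have dqq : dot (g q) (g q) = 1 by rewrite /dot -!expr2.
  apply: (cg q cFq [set z | 1 - k <= dot z (g q)]).
  have cd : continuous (fun z : P => dot z (g q)).
    by move=> z; apply: cvgD; apply: cvgM; try exact: cvg_cst; [exact: cvg_fst|exact: cvg_snd].
  apply: (cd (g q) [set t | 1 - k <= t]); rewrite /= dqq.
  apply/nbhs_ballP; exists k => //= t; rewrite /ball /= ltr_norml => /andP[? ?]; lra.
have [N [oN Nq nN]] := nw U qU.
have [r r0 hr] := capn N (open_nbhs_nbhs (conj oN Nq)).
(* The outer cap [k] maps into [U0], and [U] maps back into it; the inner cap [r] maps into the hole
   [N]. Hence what lies between [N] and [U] maps into this strip. *)
pose K := cap_strip (g q) k r.
have gK s : (U0 `&` U `\` N) s -> K (g s).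
  move=> [[U0s Us] nNs]; have cs := OF _ (U0O _ U0s); split; first exact: gF.
  rewrite /= hU //=; apply/ltW; rewrite ltNge; apply/negP => h; apply: nNs.
  by rewrite -(fg s cs); apply: hr => //; exact: gF.
have fK z : K z -> (U0 `\` [set q]) (f z).
  move=> [dz /andP[kz zr]]; split; first exact: hk.
  move=> /= fzq; move: zr; rewrite -(gf z dz) fzq.
  have -> : dot (g q) (g q) = 1 by rewrite /dot -!expr2.
  by lra.
have cfK : cts_on K f by apply: cts_on_sub cf => z [].
have [h ph] := cap_strip_exact (cocycle_comp cfK fK cw).
apply: (nN (h \o g)).
have cgK : cts_on (U0 `&` U `\` N) g by apply: cts_on_sub cg => s [[/U0O/OF]].
apply: primitive_ext (primitive_comp cgK gK ph).
by move=> s s' [[/U0O/OF cs _] _] [[/U0O/OF cs' _] _]; rewrite !fg.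
Qed.

(** Only connectedness of the image of a chord matters for comparing the values of a primitive at
    its two ends. *)
Definition chord F (p1 p2 : S) (C : set S) :=
  [/\ connected C, closed C, C p1, C p2 & forall p, C p -> [\/ F p, p = p1 | p = p2]].

(** The straight segment between two circle points has its interior in the open disk. When both ends
    are close to the preimage of [f t0], the segment stays in a convex box there, and its image
    stays in [U]. *)
Lemma face_chord x y F (f : R -> S) (U : set S) t0 : e x y -> fc F -> consecutive (cyc F) x y ->
  cts_on I01 f -> (forall t, I01 t -> arc x y (f t)) ->
  (forall s t, I01 s -> I01 t -> f s = f t -> s = t) -> 0 < t0 < 1 ->
  nbhs (f t0) U -> exists2 d, 0 < d & forall s, 0 < s <= d ->
    exists2 C, chord F (f (t0 - s)) (f (t0 + s)) C & C `<=` U.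
Proof.
move=> exy fF aF cf fa finj /andP[t00 t01] qU.
have [cc _] := hcyc fF.
have fr t : I01 t -> frontier F (f t).
  by move=> /fa ft; rewrite frontier_face //; exact: consecutive_arc ft.
have [h [g [ch cg hF gF [gh hg ho gu]]]] := face_disk fF.
have I0 : I01 t0 by rewrite /= !ltW.
have cl t : I01 t -> closure F (f t) by case/fr.
have [W /nbhs_boxP[d1 d10 dW] WU] : exists2 W, nbhs (g (f t0)) W &
    forall z, W z -> closed_disk R z -> U (h z).
  by apply: ch; [apply: gF; exact: cl|rewrite hg //; exact: cl].
have cgf : cts_on I01 (g \o f) by apply: cts_on_comp cf cg _.
have [B tB hB] : exists2 B, nbhs t0 B & forall t, B t -> I01 t ->
    `|(g (f t)).1 - (g (f t0)).1| <= d1 /\ `|(g (f t)).2 - (g (f t0)).2| <= d1.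
  apply: (cgf t0 I0 [set z | `|z.1 - (g (f t0)).1| <= d1 /\ `|z.2 - (g (f t0)).2| <= d1]).
  by apply/nbhs_boxP; exists d1.
have [d2 /= d20 dB] := (nbhs_ballP _ _).1 tB.
pose d := Num.min d2 (Num.min t0 (1 - t0)) / 2.
have [m0 m1 m2 m3] : [/\ 0 < d, d < d2, d < t0 & d < 1 - t0].
  have hh : 0 < Num.min d2 (Num.min t0 (1 - t0)) by rewrite !lt_min d20 t00 subr_gt0.
  have [] : [/\ Num.min d2 (Num.min t0 (1 - t0)) <= d2,
      Num.min d2 (Num.min t0 (1 - t0)) <= t0 &
      Num.min d2 (Num.min t0 (1 - t0)) <= 1 - t0].
    by split; rewrite !ge_min lexx ?orbT.
  by rewrite /d; move: hh; move: (Num.min d2 _) => z *; split; lra.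
exists d => // s /andP[s0 sd].
have i1 : I01 (t0 - s) by rewrite /=; lra.
have i2 : I01 (t0 + s) by rewrite /=; lra.
have b1 : B (t0 - s) by apply: dB; rewrite /ball /= opprB addrC subrK gtr0_norm //; lra.
have b2 : B (t0 + s) by apply: dB; rewrite /ball /= opprD addrA subrr add0r normrN gtr0_norm //; lra.
have [u1 u2] := (gu _ (fr _ i1), gu _ (fr _ i2)).
have ne : g (f (t0 - s)) <> g (f (t0 + s)).
  move=> E; have : f (t0 - s) = f (t0 + s) by rewrite -(hg _ (cl _ i1)) E hg //; exact: cl.
  by move=> /finj => /(_ i1 i2); lra.
pose sg := seg (g (f (t0 - s))) (g (f (t0 + s))).
have sgd t : I01 t -> closed_disk R (sg t).
  by move=> ht; apply: cvx_closed_disk => //; apply: gF; exact: cl.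
have csg : cts_on I01 (h \o sg).
  by apply: cts_on_comp ch _ => //; apply: continuous_cts_on; exact: seg_continuous.
exists ((h \o sg) @` I01); first split.
- apply: connected_continuous_connected; last exact/cts_onP.
  by rewrite -set_itvcc; exact: segment_connected.
- apply: compact_closed => //; apply: continuous_compact; first exact/cts_onP.
  by rewrite -set_itvcc; exact: segment_compact.
- by exists 0; rewrite /= ?lexx ?ler01 // /sg seg0 hg //; exact: cl.
- by exists 1; rewrite /= ?lexx ?ler01 // /sg seg1 hg //; exact: cl.
- move=> _ [t /= ht <-]; have [->|t0'] := eqVneq t 0.
    by constructor 2; rewrite /sg seg0 hg //; exact: cl.
  have [->|t1'] := eqVneq t 1; first by constructor 3; rewrite /sg seg1 hg //; exact: cl.
  constructor 1; apply: ho; apply: chord_open => //; case/andP: ht => ? ?.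
  by rewrite !lt_neqAle eq_sym t0' t1'; apply/andP.
move=> _ [t ht <-]; apply: WU; last exact: sgd.
have [n1 n2] := hB _ b1 i1; have [n3 n4] := hB _ b2 i2.
have key (a b c : R) : `|a - c| <= d1 -> `|b - c| <= d1 -> `|(1 - t) * a + t * b - c| <= d1.
  by case/andP: ht => h0 h1; rewrite !ler_norml => /andP[? ?] /andP[? ?]; apply/andP; split; nra.
by apply: dW; exact: key.
Qed.

(* The class om F counts the passages between F and its complement on one side of
   q.  Chords of the three faces with common ends on both sides of q show that
   om F1, om F2 and their sum are nonzero. *)
Lemma edge_not_three x y F1 F2 F3 : e x y -> fc F1 -> fc F2 -> fc F3 ->
  F1 <> F2 -> F1 <> F3 -> F2 <> F3 ->
  consecutive (cyc F1) x y -> consecutive (cyc F2) x y -> consecutive (cyc F3) x y -> False.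
Proof.
move=> exy fF1 fF2 fF3 n12 n13 n23 a1 a2 a3.
have [f [ga [cf cga fa gaI [gf fg f0 f1]]]] := arcE exy.
have finj s t : I01 s -> I01 t -> f s = f t -> s = t.
  by move=> hs ht E; rewrite -(gf s hs) E gf.
have h0 : I01 (0 : R) by rewrite /=; lra.
have h1 : I01 (1 : R) by rewrite /=; lra.
have nvt t : 0 < t < 1 -> forall v, f t <> pt v.
  move=> /andP[t0 t1] v E; have ht : I01 t by rewrite /= !ltW.
  have := fa t ht; rewrite E => /(arc_pt exy)[vx|vy].
    by move: E; rewrite vx -f0 => /finj => /(_ ht h0); lra.
  by move: E; rewrite vy -f1 => /finj => /(_ ht h1); lra.
have [t0 t0E] : exists t0 : R, t0 = 2^-1 by exists 2^-1.
have t001 : 0 < t0 < 1 by rewrite t0E; lra.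
pose q := f t0; have It0 : I01 t0 by rewrite /= t0E; lra.
have aq : arc x y q by exact: fa.
have [ O [oO Oq hO]] := edge_nbhs exy aq (nvt _ t001).
have [U [oU Uq UO hU]] := punctured_H1_dim1 mS oO Oq.
have qU : nbhs q U by exact: open_nbhs_nbhs.
have [d1 d10 hd1] := face_chord exy fF1 a1 cf fa finj t001 qU.
have [d2 d20 hd2] := face_chord exy fF2 a2 cf fa finj t001 qU.
have [d3 d30 hd3] := face_chord exy fF3 a3 cf fa finj t001 qU.
(* One offset for all three faces, so that the three chords have the same ends. *)
have [s [s0 s1 s2 s3]] : exists s, [/\ 0 < s, s <= d1, s <= d2 & s <= d3 /\ s < t0].
  exists (Num.min (Num.min d1 d2) (Num.min d3 (t0 / 2))).
  rewrite !lt_min !ge_min !gt_min !lexx !orbT /= d10 d20 d30; split => //; first by lra.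
  by split => //; apply/orP; right; apply/orP; right; lra.
have [s3' st] := s3.
have [C1 ch1 C1U] : exists2 C, chord F1 (f (t0 - s)) (f (t0 + s)) C & C `<=` U by apply: hd1; rewrite s0.
have [C2 ch2 C2U] : exists2 C, chord F2 (f (t0 - s)) (f (t0 + s)) C & C `<=` U by apply: hd2; rewrite s0.
have [C3 ch3 C3U] : exists2 C, chord F3 (f (t0 - s)) (f (t0 + s)) C & C `<=` U by apply: hd3; rewrite s0.
have im : I01 (t0 - s) by rewrite /=; lra.
have ip : I01 (t0 + s) by rewrite /=; lra.
set pm := f (t0 - s) in ch1 ch2 ch3; set pp := f (t0 + s) in ch1 ch2 ch3.
have qpm : q <> pm by move=> /finj => /(_ It0 im); lra.
have qpp : q <> pp by move=> /finj => /(_ It0 ip); lra.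
have dq : draw q by right; exists x, y.
have nC F C : fc F -> chord F pm pp C -> ~ C q.
  by move=> fF [_ _ _ _ h] /h[Fq|//|//]; case: (face_not_draw fF Fq).
have [V' [oV' V'q V'V hV']] : exists V', [/\ open V', V' q, V' `<=` ~` (C1 `|` C2 `|` C3) &
  forall w1 w2, cocycle (O `\` V') w1 -> cocycle (O `\` V') w2 ->
  exists f, [\/ primitive (U `\` V') w1 f, primitive (U `\` V') w2 f
   | primitive (U `\` V') (addc w1 w2) f]].
  apply: hU; apply: open_nbhs_nbhs; split.
    apply: closed_openC; apply: closedU; last by case: ch3.
    by apply: closedU; [case: ch1|case: ch2].
  by case=> [[]|]; [exact: nC ch1|exact: nC ch2|exact: nC ch3].
have carc (a b : R) : 0 <= a -> b <= 1 -> closed (f @` [set t | a <= t <= b] `\` V').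
  move=> a0 b1; rewrite setDE; apply: closedI; last exact: open_closedC.
  apply: compact_closed => //; apply: continuous_compact.
    by apply/cts_onP; apply: cts_on_sub cf => t /= /andP[? ?]; apply/andP; split; lra.
  by rewrite -set_itvcc; exact: segment_compact.
have cS : compact [set: S] by case: hS.
have [t00 t01] : 0 <= t0 /\ t0 <= 1 by lra.
(* Outside the hole [V'] the two halves of the edge are disjoint closed sets; normality of the
   compact surface gives them disjoint open neighbourhoods, [Op] after [q] and [Om] before it. *)
have [|Op [ Om [oOp oOm sOp sOm dis]]] := (@normal_openP R S).1 (compact_normal haus cS)
  _ _ (carc t0 1 t00 (lexx _)) (carc 0 t0 (lexx _) t01).
  apply/seteqP; split=> // r [[[t /= /andP[ht1 ht2] <-] nV] [[t' /= /andP[ht1' ht2'] E] _]].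
  have tt : t' = t by apply: finj => //=; apply/andP; split; lra.
  by apply: nV; rewrite (_ : t = t0) //; lra.
have C1V' r : C1 r -> ~ V' r by move=> C1r /V'V; apply; do 2 left.
have C2V' r : C2 r -> ~ V' r by move=> C2r /V'V; apply; left; right.
have C3V' r : C3 r -> ~ V' r by move=> C3r /V'V; apply; right.
have Opp : Op pp.
  apply: sOp; split; last by apply: C1V'; case: ch1.
  by exists (t0 + s) => //=; apply/andP; split; lra.
have Ompm : Om pm.
  apply: sOm; split; last by apply: C1V'; case: ch1.
  by exists (t0 - s) => //=; apply/andP; split; lra.
have disj r : Op r -> Om r -> False by move=> o1 o2; have : (Op `&` Om) r by []; rewrite dis.
pose om F := fun r r' : S => (`[< F r >] (+) `[< F r' >]) && `[< Op r >].
(* Inside a face the indicator of [F] is constant; near the half in [Op] the cochain is the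
   coboundary of that indicator; near the half in [Om] it vanishes. *)
have com F : fc F -> cocycle (O `\` V') (om F).
  move=> fF r [ Or nV'r].
  have [dr|ndr] := pselect (draw r); last first.
    have [G fG cG] := faces_cover r.
    have Gr : G r by have [//|/frontier_draw] := closure_face fG cG; move=> /(_ fG).
    exists G; first by apply: open_nbhs_nbhs; split => //; exact: face_open.
    move=> a b c Ga _ Gb _ Gc _; rewrite /om.
    have same a' b' : G a' -> G b' -> `[< F a' >] = `[< F b' >].
      move=> Ga' Gb'; have [E|nE] := pselect (F = G); first by subst G; rewrite !asboolT.
      by rewrite !asboolF // => Fx; apply: nE; exact: face_disjoint Fx _.
    by rewrite (same a b) // (same c b) // addbb.
  have [_ /(_ dr) ar] := hO r Or.
  have /andP[g0 g1] := gaI r ar.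
  have [gt|gt] := leP t0 (ga r).
    have rOp : Op r by apply: sOp; split => //; exists (ga r); [exact/andP|exact: fg].
    exists Op; first exact: open_nbhs_nbhs.
    move=> a b c oa _ ob _ oc _; rewrite /om (asboolT oa) (asboolT ob) !andbT.
    by case: `[< F a >]; case: `[< F b >]; case: `[< F c >].
  have rOm : Om r by apply: sOm; split => //; exists (ga r); [rewrite /= g0 ltW|exact: fg].
  exists Om; first exact: open_nbhs_nbhs.
  have nOp a : Om a -> `[< Op a >] = false by move=> oa; rewrite asboolF // => /disj; apply.
  by move=> a b c /nOp ha _ /nOp hb _ _ _; rewrite /om ha hb !andbF.
(* A chord through [F] leaves [F] only at its ends, and [om F] registers only the one at [pp].
   Correcting [h] by the indicator of [pp] therefore makes it locally constant on the chord. *)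
have jump F C w h : fc F -> chord F pm pp C -> C `<=` U -> (forall r, C r -> ~ V' r) ->
    primitive (U `\` V') w h -> (forall r r', C r -> C r' -> w r r' = om F r r') -> h pp = ~~ h pm.
  move=> fF [cC clC Cm Cp hC] CU CV' ph wE.
  have nF p t : 0 < t < 1 -> p = f t -> ~ F p.
    move=> ht -> /(face_not_draw fF); apply; right; exists x, y; split => //; apply: fa.
    by case/andP: ht => ? ?; rewrite /= !ltW.
  have nFp : ~ F pp by apply: (nF _ (t0 + s)) => //; apply/andP; split; lra.
  have nFm : ~ F pm by apply: (nF _ (t0 - s)) => //; apply/andP; split; lra.
  have npm : pm <> pp by move=> E; apply: (disj pm) => //; rewrite E.
  have prim : primitive C (@zeroc S) (fun r => h r (+) `[< r = pp >]).
    have phC : primitive C (om F) h.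
      apply: (@primitive_ext _ _ w) => //; apply: primitive_sub ph => r Cr.
      by split; [exact: CU|exact: CV'].
    move=> r Cr; have [W rW hW] := phC r Cr.
    have Fpp r' : C r' -> ~ F r' -> r' <> pp -> r' = pm by move=> /hC[].
    case: (hC r Cr) => [Fr|rE|rE].
    - exists (W `&` F); first by apply: filterI => //; apply: open_nbhs_nbhs; split => //; exact: face_open.
      move=> a b [Wa Fa] Ca [Wb Fb] Cb; have := hW a b Wa Ca Wb Cb.
      have na : `[< a = pp >] = false by rewrite asboolF // => E; rewrite E in Fa.
      have nb : `[< b = pp >] = false by rewrite asboolF // => E; rewrite E in Fb.
      by rewrite /om (asboolT Fa) (asboolT Fb) /zeroc na nb /=; case: (h a); case: (h b).
    - exists (W `&` Om); first by apply: filterI => //; apply: open_nbhs_nbhs; split => //; rewrite rE.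
      move=> a b [Wa Oa] Ca [Wb Ob] Cb; have := hW a b Wa Ca Wb Cb.
      have na : `[< a = pp >] = false by rewrite asboolF // => E; rewrite E in Oa; case: (disj pp).
      have nb : `[< b = pp >] = false by rewrite asboolF // => E; rewrite E in Ob; case: (disj pp).
      have nO : `[< Op a >] = false by rewrite asboolF // => /disj; apply.
      by rewrite /om /zeroc nO andbF na nb; case: (h a); case: (h b).
    - exists (W `&` Op); first by apply: filterI => //; apply: open_nbhs_nbhs; split => //; rewrite rE.
      have FE a : Op a -> C a -> `[< F a >] = ~~ `[< a = pp >].
        move=> Oa Ca; have [Ea|nEa] := pselect (a = pp).
          by rewrite (asboolT Ea) asboolF // Ea.
        rewrite (asboolF nEa) asboolT //; apply: contrapT => nFa.
        by move: Oa; rewrite (Fpp a Ca nFa nEa) => /disj; exact.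
      move=> a b [Wa Oa] Ca [Wb Ob] Cb; have := hW a b Wa Ca Wb Cb.
      rewrite /om /zeroc (asboolT Oa) andbT !FE //.
      by case: (h a); case: (h b); case: `[< a = pp >]; case: `[< b = pp >].
  have := connected_constant cC prim Cp Cm.
  by rewrite asboolT // asboolF // addbT addbF => <-; rewrite negbK.
have flat F C w h : chord F pm pp C -> C `<=` U -> (forall r, C r -> ~ V' r) ->
    primitive (U `\` V') w h -> (forall r r', C r -> C r' -> w r r' = false) -> h pp = h pm.
  move=> [cC clC Cm Cp hC] CU CV' ph wE.
  apply: (connected_constant (f := h) cC) => //.
  apply: (@primitive_ext _ _ w) => //; apply: primitive_sub ph => r Cr.
  by split; [exact: CU|exact: CV'].
have off F G C : fc F -> fc G -> F <> G -> chord G pm pp C ->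
    forall r r', C r -> C r' -> om F r r' = false.
  move=> fF fG FG [_ _ _ _ hC] r r' Cr Cr'.
  have nF p : C p -> ~ F p.
    move=> /hC[Gp Fp|->|->]; first by apply: FG; exact: face_disjoint Fp Gp.
    - by move=> /(face_not_draw fF); apply; right; exists x, y; split => //; exact: fa.
    - by move=> /(face_not_draw fF); apply; right; exists x, y; split => //; exact: fa.
  by rewrite /om (asboolF (nF r Cr)) (asboolF (nF r' Cr')).
have o13 := off _ _ _ fF1 fF3 n13 ch3; have o23 := off _ _ _ fF2 fF3 n23 ch3.
have o12 := off _ _ _ fF1 fF2 n12 ch2.
(* In each case the chord through [F3] forces equal values of [h] at [pm] and [pp], while a chord
   through [F1] or [F2] forces different ones. For the sum, the chord through [F2] is used, where
   [om F1] vanishes. *)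
have [h [ph|ph|ph]] := hV' _ _ (com _ fF1) (com _ fF2).
- have := flat _ _ _ _ ch3 C3U C3V' ph o13.
  by rewrite (jump _ _ _ _ fF1 ch1 C1U C1V' ph) //; case: (h pm).
- have := flat _ _ _ _ ch3 C3U C3V' ph o23.
  by rewrite (jump _ _ _ _ fF2 ch2 C2U C2V' ph) //; case: (h pm).
have := flat _ _ _ _ ch3 C3U C3V' ph.
rewrite (jump _ _ _ _ fF2 ch2 C2U C2V' ph); last first.
  by move=> r r' Cr Cr'; rewrite /addc o12.
have -> : (~~ h pm = h pm) = False by apply/propext; split => //; case: (h pm).
by apply=> r r' Cr Cr'; rewrite /addc o13 ?o23.
Qed.

Lemma edge_two_faces x y : e x y -> exists F G, [/\ fc F, fc G, F <> G,
  consecutive (cyc F) x y /\ consecutive (cyc G) x y &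
  forall H, fc H -> consecutive (cyc H) x y -> H = F \/ H = G].
Proof.
move=> exy; have [q aq nq] := arc_interior exy.
have [F fF cF] := faces_cover q.
have aF : consecutive (cyc F) x y by apply/(closure_arc fF exy aq nq).
have [G [fG aG nGF]] : exists G, [/\ fc G, consecutive (cyc G) x y & G <> F].
  apply: contrapT => none; apply: (edge_not_one exy fF) => G fG aG.
  by apply: contrapT => nGF; apply: none; exists G.
exists F, G; split => //; first by move=> /esym.
move=> H fH aH; apply: contrapT => /not_orP[HF HG].
by apply: (edge_not_three exy fF fG fH) => // E; [apply: nGF|apply: HF|apply: HG].
Qed.
End Faces.

Theorem theorem1p5 (R : realType) (S : topologicalType)
    (hS : closed_surface R S)
    (V : finType) (e : rel V) (he : simple_graph e)
    (pt : V -> S) (arc : V -> V -> set S)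
    (hpoly : polyhedral_embedding R e pt arc)
    (x1 x2 x3 z : V) (hx : uniq [:: x1; x2; x3])
    (hz : z \notin [:: x1; x2; x3]) :
  exists c : seq V,
    is_cycle e c /\ {subset [:: x1; x2; x3] <= c} /\ z \notin c.
Proof.
case: hpoly => hemb hdisk hmeet.
have ex F : exists c, face e pt arc F ->
    is_cycle e c /\ open_disk_bounded_by R arc F c.
  have [fF|nF] := pselect (face e pt arc F); last by exists [::].
  by have [c cc dc] := hdisk F fF; exists c.
have {ex}[cyc hcyc] := choice ex.
apply: (cycle_avoiding (fc := face e pt arc) (cyc := cyc) he) hz.
- by move=> F /hcyc[].
- by move=> F G u v; exact: (faces_share he hemb hcyc hmeet).
- by move=> x y; exact: (edge_two_faces hS he hemb hcyc hmeet).
- by move=> z' Q F G; exact: (link_connected hS he hemb hcyc hmeet).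
- by move=> X x y; exact: (graph_connected hS he hemb hcyc hmeet).
- by move=> v; exact: (vertex_face hS he hemb hcyc hmeet).
Qed.
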